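(* Let $1\le K\le 5$ be an integer and let $P$ be a smooth function compactly supported in $(-a,a)^2$. An $O(h^{2K+1})$ corrected trapezoidal rule for the Laplace single-layer potential is given as follows: there exist correction weights $\tau_{\mu,\nu}=\tau_{\mu,\nu}(h)$, $(\mu,\nu)\in U_K$, satisfying conditions (1)–(3) listed in the context, and for such weights, with $h=a/(N+\frac12)$, $$\int_{|\mathbf{u}|\le a}\frac{P(\mathbf{u})}{r(\mathbf{u})}\,d\mathbf{u}=\sum_{|\mathbf{i}|\le N}{}^{'}\frac{P(\mathbf{i}h)}{r(\mathbf{i}h)}h^2+\sum_{(\mu,\nu)\in U_K}P(\mu h,\nu h)\,\tau_{\mu,\nu}+O(h^{2K+1})\qquad(N\to\infty).$$
   Context: Notation: $\mathbf{u}=(u,v)\in\mathbb{R}^2$, $\mathbf{i}=(i,j)\in\mathbb{Z}^2$, $d\mathbf{u}=du\,dv$; $|\mathbf{u}|=\max(|u|,|v|)$ and $|\mathbf{i}|=\max(|i|,|j|)$. A prime on a sum means $(0,0)$ is omitted. Setting: $a>0$; $\mathbf{r}:[-a,a]^2\to\mathbb{R}^3$ is a smooth regular (injective, with $\mathbf{r}_u,\mathbf{r}_v$ linearly independent) parameterization of a surface patch with $\mathbf{r}(\mathbf{0})=\mathbf{0}$; $r(\mathbf{u})=|\mathbf{r}(\mathbf{u})|$ (Euclidean norm). $Q(\mathbf{u})=Eu^2+2Fuv+Gv^2$ with $E=\mathbf{r}_u(\mathbf{0})\cdot\mathbf{r}_u(\mathbf{0})$, $F=\mathbf{r}_u(\mathbf{0})\cdot\mathbf{r}_v(\mathbf{0})$,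 $G=\mathbf{r}_v(\mathbf{0})\cdot\mathbf{r}_v(\mathbf{0})$. For $m\ge0$, $q_k^{(m)}$ is the homogeneous polynomial of degree $k$ in the Taylor expansion at $\mathbf{0}$ of $(r(\mathbf{u})^2-Q(\mathbf{u}))^m$, which begins at degree $3m$ (so $q_k^{(0)}=\delta_{0k}$). For integers $m\ge1$ set $$\mathcal{W}^{(m)}(\mathbf{u})=\sum_{n=0}^{m-1}\binom{-\frac12}{n}\frac{q^{(n)}_{m-1+2n}(\mathbf{u})}{Q(\mathbf{u})^{n+\frac12}},$$ so that $\mathcal{W}^{(1)}=Q^{-1/2}$, $\mathcal{W}^{(2)}=-\frac12 q_3^{(1)}Q^{-3/2}$, $\mathcal{W}^{(3)}=-\frac12 q_4^{(1)}Q^{-3/2}+\frac38 q_6^{(2)}Q^{-5/2}$, etc. ($\mathcal{W}^{(m)}$ collects the terms homogeneous of degree $m-2$ in the expansion of $1/r$.) For functions $f$ of the form $\mathcal{W}^{(m)}(\mathbf{u})u^\alpha v^\beta$, $$\mathcal{L}[f]:=\lim_{h\to0^+}\lim_{N\to\infty}\left(\sum_{|\mathbf{i}|<N}{}^{'}f(\mathbf{i})\eta(\mathbf{i}h)-\int_{|\mathbf{u}|<N+\frac12}f(\mathbf{u})\eta(\mathbf{u}h)\,d\mathbf{u}\right),$$ where $\eta$ is a smooth function on $\mathbb{R}^2$ with compact support in $[-a,a]^2$, $\eta(\mathbf{0})=1$, $\eta(\mathbf{u})=\eta(-\mathbf{u})$. Stencils: $U_K=\{(\mu,\nu)\in\mathbb{Z}^2:|\mu|+|\nu|\le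 K,\ \max\{|\mu|,|\nu|\}<K\}$ and $U_K^{\mathrm{flat}}=\{(\mu,\nu)\in\mathbb{Z}^2:|\mu|+|\nu|\le K-1\}$. Conditions on the weights: (1) Moment equations: for all integers $\alpha,\beta\ge0$ with $0\le\alpha+\beta\le2(K-1)$, $$\sum_{(\mu,\nu)\in U_K}(\mu h)^\alpha(\nu h)^\beta\,\tau_{\mu,\nu}=\sum_{m\in M(\alpha,\beta)}-\mathcal{L}\big[\mathcal{W}^{(m)}(\mathbf{u})u^\alpha v^\beta\big]h^{m+\alpha+\beta},$$ where $M(\alpha,\beta)=\{m\in\mathbb{Z},\,m\ge1: m+\alpha+\beta=2k-1\text{ for some integer }1\le k\le K\}$ (convention $0^0=1$; common factors of $h^{\alpha+\beta}$ may be cancelled). (2) Symmetry: $\tau_{\mu,\nu}=\tau_{-\mu,-\nu}$ for all $(\mu,\nu)\in U_K\setminus U_K^{\mathrm{flat}}$. (3) Normalization: $\tau_{\mu,\nu}+\tau_{-\mu,\nu}+\tau_{\mu,-\nu}+\tau_{-\mu,-\nu}=0$ for all $(\mu,\nu)\in U_K\setminus U_K^{\mathrm{flat}}$. *)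

(* Defs.v *)
From HB Require Import structures.
From mathcomp Require Import all_boot all_order all_algebra.
From mathcomp Require Import all_classical all_reals all_analysis.

Set Implicit Arguments.
Unset Strict Implicit.
Unset Printing Implicit Defensive.

Import Order.TTheory GRing.Theory Num.Theory.
Import numFieldNormedType.Exports.

Local Open Scope classical_set_scope.
Local Open Scope ring_scope.

(* On the product R * R the library norm `|u| is the max norm
   max(|u.1|, |u.2|). *)

Section Smooth.
Context {R : realType} {V : normedModType R}.
Implicit Types (A : set (R * R)) (f : R * R -> V).

Definition partial_u f : R * R -> V := fun x => 'D_((1 : R), (0 : R)) f x.
Definition partial_v f : R * R -> V := fun x => 'D_((0 : R), (1 : R)) f x.

(* Intended for open sets A. *)
Fixpoint Cn_on (n : nat) A f : Prop :=
  (forall x, A x -> {for x, continuous f}) /\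
  (if n is n'.+1 then
     [/\ forall x, A x -> derivable f x ((1 : R), (0 : R)) /\
                          derivable f x ((0 : R), (1 : R)),
         Cn_on n' A (partial_u f) &
         Cn_on n' A (partial_v f)]
   else True).

Definition smooth_on A f : Prop := forall n, Cn_on n A f.

Definition compactly_supported_in A f : Prop :=
  compact (closure [set x | f x != 0]) /\ closure [set x | f x != 0] `<=` A.

End Smooth.

Definition maxnorm (i : int * int) : int := Num.max `|i.1| `|i.2|.

Definition lattice_pt (R : realType) (h : R) (i : int * int) : R * R :=
  (i.1%:~R * h, i.2%:~R * h).

Definition stencil (K : nat) : set (int * int) :=
  [set p | `|p.1| + `|p.2| <= K%:Z /\ Num.max `|p.1| `|p.2| < K%:Z].

Definition stencil_flat (K : nat) : set (int * int) :=
  [set p | `|p.1| + `|p.2| <= K%:Z - 1].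

Section SingleLayer.
Context {R : realType}.
Implicit Types (r : R * R -> 'rV[R]_3) (eta : R * R -> R) (u : R * R).

Definition dot3 (x y : 'rV[R]_3) : R := \sum_(k < 3) x 0 k * y 0 k.
Definition eucl_norm (x : 'rV[R]_3) : R := Num.sqrt (dot3 x x).

(* Smoothness on the closed square means smoothness on an open neighbourhood
   of it. *)
Definition regular_patch (a : R) r : Prop :=
  [/\ exists2 U : set (R * R),
        open U /\ [set u : R * R | `|u| <= a] `<=` U & smooth_on U r,
      {in [set u : R * R | `|u| <= a] &, injective r},
      forall u, `|u| <= a -> row_free (col_mx (partial_u r u) (partial_v r u))
    & r 0 = 0].

Definition dist_r r u : R := eucl_norm (r u).

Definition first_form r u : R :=
  let ru := partial_u r 0 in
  let rv := partial_v r 0 in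
  dot3 ru ru * u.1 ^+ 2 + 2 * dot3 ru rv * u.1 * u.2 + dot3 rv rv * u.2 ^+ 2.

(* Homogeneous part of degree k of the Taylor expansion of g at the origin. *)
Definition taylor_part (g : R * R -> R) (k : nat) u : R :=
  \sum_(i < k.+1)
    iter i partial_u (iter (k - i) partial_v g) 0 / (i`! * (k - i)`!)%:R
    * u.1 ^+ i * u.2 ^+ (k - i).

Definition q_part r (m k : nat) : R * R -> R :=
  taylor_part (fun u => (dist_r r u ^+ 2 - first_form r u) ^+ m) k.

(* Generalized binomial coefficient x (x - 1) ... (x - n + 1) / n! *)
Definition gbinom (x : R) (n : nat) : R := \prod_(k < n) (x - k%:R) / n`!%:R.

(* Terms homogeneous of degree m - 2 in the expansion of 1 / r; only used for
   1 <= m. Division by zero makes it vanish at the origin. *)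
Definition Wfun r (m : nat) u : R :=
  \sum_(n < m) gbinom (- 2^-1) n *
    (q_part r n (m.-1 + 2 * n) u / first_form r u `^ (n%:R + 2^-1)).

Local Notation area := (@lebesgue_measure R \x @lebesgue_measure R)%E.

(* lattice_pt 1 i is the integer point i itself. *)
Definition Lop eta (f : R * R -> R) : R :=
  lim ((lim ((fun N : nat =>
     \sum_(i \in [set i : int * int | i != 0 /\ maxnorm i < N%:Z])
        f (lattice_pt 1 i) * eta (lattice_pt h i)
     - \int[area]_(u in [set u : R * R | (`|u| < N%:R + 2^-1)%R])
        (f u * eta (h *: u))) @ \oo)) @[h --> (0 : R)^'+]).

Definition moment_index (K al be : nat) : set nat :=
  [set m | (1 <= m)%N /\
     exists2 k, (1 <= k <= K)%N & (m + al + be = 2 * k - 1)%N].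

Record correction_weights (K : nat) r eta (h : R) (tau : int * int -> R) : Prop :=
  CorrectionWeights {
    cw_moment : forall al be : nat, (al + be <= 2 * (K - 1))%N ->
      \sum_(p \in stencil K)
        (p.1%:~R * h) ^+ al * (p.2%:~R * h) ^+ be * tau p
      = \sum_(m \in moment_index K al be)
        - Lop eta (fun u => Wfun r m u * u.1 ^+ al * u.2 ^+ be)
          * h ^+ (m + al + be);
    cw_symmetry : forall mu nu : int,
      (stencil K `\` stencil_flat K) (mu, nu) ->
      tau (mu, nu) = tau (- mu, - nu);
    cw_normalization : forall mu nu : int,
      (stencil K `\` stencil_flat K) (mu, nu) ->
      tau (mu, nu) + tau (- mu, nu) + tau (mu, - nu) + tau (- mu, - nu) = 0
  }.

Definition mesh (a : R) (N : nat) : R := a / (N%:R + 2^-1).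

(* The integrand takes the junk value 0 at the origin, a null set. *)
Definition single_layer (a : R) r (P : R * R -> R) : R :=
  \int[area]_(u in [set u : R * R | (`|u| <= a)%R]) (P u / dist_r r u).

Definition corrected_trapezoidal (K : nat) r (P : R * R -> R)
    (N : nat) (h : R) (tau : int * int -> R) : R :=
  \sum_(i \in [set i : int * int | i != 0 /\ maxnorm i <= N%:Z])
     P (lattice_pt h i) / dist_r r (lattice_pt h i) * h ^+ 2
  + \sum_(p \in stencil K) P (lattice_pt h p) * tau p.

End SingleLayer.

(* Main.v *)
(* On every unit cell compare the integral with a quadrature rule whose nodes are
   lattice points near the cell, exact for polynomials of degree < M in each variable
   and with weights of sum 1.  Summing over the cells, every lattice point receives
   total weight 1, so an integral minus the lattice sum is the sum of the cell errors,
   and for a function homogeneous of degree d the error at the cell of p is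
   O(|p|^(d - M)).  Hence for f homogeneous the cell errors have a sum, which is
   - Lop eta f whatever the cutoff eta.  Near the origin P / r is a combination of the
   functions W^(m) u^i v^j plus a remainder of degree 2K - 1; after scaling by h the
   trapezoidal error is the same combination of - Lop(W^(m) u^i v^j) h^(m + i + j), up
   to O(h^(2K + 1)).  The terms with m + i + j even vanish by parity, and the moment
   equations make the stencil sum reproduce the others.

   For the weights, split according to the parity in each variable: the symmetry and
   normalization conditions leave only the odd-odd part on the outer layer of the
   stencil, and each of the four parts solves an interpolation problem on a triangular
   grid with nodes i^2, j^2, which is uniquely solvable.  The odd moments being
   O(h^2), so is tau_p - tau_(-p), which takes care of the terms of degree 2K - 1 of P,
   not covered by the moment equations. *)

(* The integrands are built from Taylor polynomials by products and inverse square roots and are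
   singular at the origin, so bounding their derivatives of order [M] directly would be heavy.
   Derivatives are replaced by uniform local expansions: around each [x], after scaling by [|x|],
   the function is a polynomial with bounded coefficients up to [O(|z|^M)]. This passes to products
   by plain algebra and to inverse square roots by a polynomial identity for the truncated binomial
   series, and it is exactly what a quadrature rule exact on polynomials needs.

   As [M] may be taken large, no estimate has to be sharp. What matters is uniformity in [h]: the
   tail bounds have constants independent of [h], so the limit in [Lop] can be exchanged with the
   infinite sum of cell errors, and the box of summation may grow like [1 / h]. At that radius tails
   of order [n ^- (2 * K)] leave [h ^+ (2 * K)], and the scaling of [W^(m) u^i v^j] supplies the
   last factor [h]. *)
Require Import Defs.
From HB Require Import structures.
From mathcomp Require Import all_boot all_order all_algebra.
From mathcomp Require Import all_classical all_reals all_analysis.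
From mathcomp Require Import measurable_realfun.
From mathcomp Require Import ring lra zify.
Set Implicit Arguments.
Unset Strict Implicit.
Unset Printing Implicit Defensive.
Import Order.TTheory GRing.Theory Num.Theory.
Import numFieldNormedType.Exports.
Local Open Scope classical_set_scope.
Local Open Scope ring_scope.

Local Notation plane R := (measurableTypeR R * measurableTypeR R)%type.
Local Notation area := (@lebesgue_measure _ \x @lebesgue_measure _)%E.

(** * Integration on the plane *)

Section AffineChange.
Context {R : realType}.
Implicit Types (s t : R) (b : R * R) (F : R * R -> R).

Definition affine1 s t : measurableTypeR R -> measurableTypeR R := fun x => s * x + t.
Definition affine2 s b : plane R -> plane R := fun u => (s * u.1 + b.1, s * u.2 + b.2).

Lemma measurable_affine1 s t : measurable_fun setT (affine1 s t).
Proof. by apply: measurable_funD => //; apply: measurable_funM. Qed.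

HB.instance Definition _ s t := isMeasurableFun.Build _ _ _ _ _ (measurable_affine1 s t).

Lemma measurable_affine2 s b : measurable_fun setT (affine2 s b).
Proof.
apply/measurable_fun_pairP; split; apply: measurable_funD => //; exact: measurable_funM.
Qed.

HB.instance Definition _ s b := isMeasurableFun.Build _ _ _ _ _ (measurable_affine2 s b).

(** Both sides are measures in [A], so by uniqueness of Lebesgue measure half-open intervals
    suffice. A negative [s] reverses the interval and moves the closed end to the left. *)
Lemma lebesgue_affine1 s t (A : set (measurableTypeR R)) : s != 0 -> measurable A ->
  (`|s|%:E * @lebesgue_measure R (affine1 s t @^-1` A) = @lebesgue_measure R A)%E.
Proof.
move=> s0 mA.
have e := @lebesgue_measure_unique R
   (mscale (NngNum (normr_ge0 s)) (pushforward (@lebesgue_measure R) (affine1 s t))).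
rewrite [RHS](e (measurable_affine1 s t))// => {A mA e} X [[x y] /= _ <-].
rewrite /mscale/= /pushforward.
case: (ltgtP 0 s) s0 => // sg _.
  have -> : affine1 s t @^-1` `]x, y]%classic = `](x - t) / s, (y - t) / s]%classic.
    apply/seteqP; split=> z; rewrite /affine1 /= !in_itv/= ltr_pdivrMr// ler_pdivlMr// ?ltrBlDr ?lerBrDr mulrC//.
  rewrite !lebesgue_measure_itv/= !lte_fin.
  rewrite ltr_pM2r ?invr_gt0// ltrD2r; case: ifPn => _; rewrite ?mule0//.
  rewrite gtr0_norm// -!EFinD -EFinM; congr EFin.
  by field; lra.
have -> : affine1 s t @^-1` `]x, y]%classic = `[(y - t) / s, (x - t) / s[%classic.
  apply/seteqP; split=> z; rewrite /affine1 /= !in_itv/= ltr_ndivlMr// ler_ndivrMr// ?ltrBlDr ?lerBrDr andbC mulrC//.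
rewrite !lebesgue_measure_itv/= !lte_fin.
rewrite ltr_nM2r ?invr_lt0// ltrD2r; case: ifPn => _; rewrite ?mule0//.
rewrite ltr0_norm// -!EFinD -EFinM; congr EFin.
by field; lra.
Qed.

Lemma area_affine2 s b (A : set (plane R)) : s != 0 -> measurable A ->
  ((s ^+ 2)%:E * area (affine2 s b @^-1` A) = area A)%E.
Proof.
move=> s0 mA.
have e := @product_measure_unique _ _ _ _ R (@lebesgue_measure R) (@lebesgue_measure R)
   (mscale (NngNum (sqr_ge0 s)) (pushforward area (affine2 s b))).
rewrite [RHS](e (measurable_affine2 s b))// => {A mA e} X Y mX mY.
change ((s ^+ 2)%:E * area (affine2 s b @^-1` (X `*` Y)) = lebesgue_measure X * lebesgue_measure Y)%E.
have -> : affine2 s b @^-1` (X `*` Y) = (affine1 s b.1 @^-1` X) `*` (affine1 s b.2 @^-1` Y) by [].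
have mXb : measurable (affine1 s b.1 @^-1` X).
  by rewrite -[_ @^-1` _]setTI; exact: measurable_affine1.
have mYb : measurable (affine1 s b.2 @^-1` Y).
  by rewrite -[_ @^-1` _]setTI; exact: measurable_affine1.
rewrite product_measure1E// -(lebesgue_affine1 b.1 s0 mX) -(lebesgue_affine1 b.2 s0 mY).
by rewrite muleACA -EFinM -expr2 real_normK// num_real.
Qed.

Lemma ge0_integral_affine2 s b (f : plane R -> \bar R) :
  s != 0 -> measurable_fun setT f -> (forall u, 0 <= f u)%E ->
  (\int[area]_u f u = (s ^+ 2)%:E * \int[area]_u f (affine2 s b u))%E.
Proof.
move=> s0 mf f0.
rewrite [in LHS](@eq_measure_integral _ _ _ setT
   (mscale (NngNum (sqr_ge0 s)) (pushforward area (affine2 s b)))); last first.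
  by move=> A mA _; exact: esym (area_affine2 b s0 mA).
rewrite (ge0_integral_mscale _ measurableT _ mf (fun u _ => f0 u)).
by rewrite (ge0_integral_pushforward (measurable_affine2 s b) _ measurableT mf) // => u _; exact: f0.
Qed.

Lemma integrable_affine2 s b F : s != 0 -> area.-integrable setT (EFin \o F) ->
  area.-integrable setT (EFin \o (F \o affine2 s b)).
Proof.
move=> s0 iF.
have mF : measurable_fun setT (EFin \o F) by exact: (measurable_int _ iF).
apply/integrableP; split.
  by apply: (measurableT_comp mF); exact: measurable_affine2.
have /integrableP[_] := iF.
rewrite (ge0_integral_affine2 b s0)//; last exact: measurableT_comp.
have s2 : 0 < s ^+ 2 by rewrite exprn_even_gt0.
by apply: contraTT; rewrite -!leNgt !leye_eq => /eqP ->; rewrite gt0_muley ?lte_fin.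
Qed.

(** Used with [s = 1] to move a cell to the origin, with [s = h] to rescale the mesh to the unit
    lattice, and with [s = -1] for parity. *)
Lemma Rintegral_affine2 s b F : s != 0 -> area.-integrable setT (EFin \o F) ->
  \int[area]_u F u = s ^+ 2 * \int[area]_u (F (affine2 s b u)).
Proof.
move=> s0 iF.
have iFs := integrable_affine2 b s0 iF.
have mF : measurable_fun setT (EFin \o F) by exact: (measurable_int _ iF).
rewrite /Rintegral -[s ^+ 2 in RHS]/(fine (s ^+ 2)%:E) -fineM//; last exact: integrable_fin_num.
congr fine; rewrite integralE [in RHS]integralE.
rewrite (ge0_integral_affine2 b s0)//; last exact: measurable_funepos.
rewrite [X in (_ - X)%E](ge0_integral_affine2 b s0)//; last exact: measurable_funeneg.
have fp := integrable_pos_fin_num measurableT iFs.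
have E (x y : \bar R) : x \is a fin_num ->
    ((s ^+ 2)%:E * x - (s ^+ 2)%:E * y = (s ^+ 2)%:E * (x - y))%E.
  by move=> xf; rewrite muleBr// fin_num_adde_defr.
rewrite -(E _ _ fp).
congr (_ * _ - _ * _)%E; apply: eq_integral => u _; [rewrite !funeposE|rewrite !funenegE]; by [].
Qed.

End AffineChange.

Section PlaneMeasure.
Context {R : realType}.
Implicit Types (O : set (R * R)) (f g : R * R -> R) (u x : R * R) (b : R).

(** The measurable structure of the plane is generated by rectangles, so an open set is written as
    the countable union of the boxes with rational centre and radius that it contains. *)
Lemma open_measurable2 O : open O -> measurable (O : set (plane R)).
Proof.
move=> oO.
pose box (q : rat * rat * rat) : set (plane R) :=
  ball (ratr q.1.1 : R) (ratr q.2) `*` ball (ratr q.1.2 : R) (ratr q.2).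
have -> : (O : set (plane R)) =
    \bigcup_q (if `[< box q `<=` O >] then box q else set0).
  apply/seteqP; split=> [x Ox|x [q _]]; last by case: asboolP => //; apply.
  have /nbhs_ballP[e /= e0 xeO] : nbhs x O by exact: open_nbhs_nbhs.
  have [rho] := rat_in_itvoo (divr_gt0 e0 (ltr0n _ 2)).
  rewrite in_itv/= => /andP[rho0 rhoe].
  have near1 (t : R) : exists q : rat, `|ratr q - t| < ratr rho.
    have [|q] := @rat_in_itvoo _ (t - ratr rho) t; first by rewrite ltrBlDr ltrDl.
    rewrite in_itv/= => /andP[q1 q2]; exists q.
    by rewrite ltr0_norm ?subr_lt0// opprB ltrBlDr -ltrBlDl.
  have [q1 xq1] := near1 x.1; have [q2 xq2] := near1 x.2.
  exists (q1, q2, rho) => //; case: asboolP => [_|].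
    by rewrite /box; split => /=; rewrite -ball_normE/=.
  case=> y [/=]; rewrite -!ball_normE/= => y1 y2; apply: xeO; move: xq1 xq2; rewrite distrC => xq1; rewrite distrC => xq2.
  split; rewrite -ball_normE/=.
    rewrite (le_lt_trans (ler_distD (ratr q1) _ _))// (splitr e) ltrD//.
      exact: lt_trans xq1 rhoe.
    exact: lt_trans y1 rhoe.
  rewrite (le_lt_trans (ler_distD (ratr q2) _ _))// (splitr e) ltrD//.
    exact: lt_trans xq2 rhoe.
  exact: lt_trans y2 rhoe.
apply: countable_bigcupT_measurable => // q.
by case: asboolP => // _; apply: measurableX; exact: measurable_ball.
Qed.

Lemma open_continuous_measurable_fun2 O f : open O ->
  (forall x, O x -> {for x, continuous f}) ->
  measurable_fun (O : set (plane R)) f.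
Proof.
move=> oO cf; apply: (measurability _ (RGenOpens.measurableE R)).
move=> _ [_ [s [t ->] <-]].
apply: open_measurable2; rewrite openE => x [Ox fx]; apply: filterI.
  exact: open_nbhs_nbhs.
apply: cf => //; apply: open_nbhs_nbhs; split => //; exact: interval_open.
Qed.

(** The singular integrands take a default value at the origin and need not be continuous there; on
    a single point measurability is automatic. *)
Lemma continuous_off_origin_measurable f :
  (forall x, x != 0 -> {for x, continuous f}) ->
  measurable_fun (setT : set (plane R)) f.
Proof.
move=> cf.
have m0 : measurable ([set 0] : set (plane R)).
  have -> : [set 0] = ([set 0] `*` [set 0] : set (plane R)).
    apply/seteqP; split=> [_ ->//|[y z] [/= -> ->]//].
  by apply: measurableX; exact: measurable_set1.
rewrite -(setvU [set 0]); apply/measurable_funU => //; first exact: measurableC.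
split.
  apply: open_continuous_measurable_fun2 => [|x /eqP x0]; last exact: cf.
  by rewrite openC; exact/accessible_closed_set1/hausdorff_accessible.
move=> _ Y mY.
have [Y0|Y0] := pselect (Y (f 0)).
  rewrite (_ : _ `&` _ = [set 0])//; apply/seteqP; split=> [y []//|_ ->//].
rewrite (_ : _ `&` _ = set0)//; apply/seteqP; split=> [y [->]//|//].
Qed.

Definition maxball b : set (plane R) := [set u : R * R | `|u| <= b].

Lemma maxballE b : maxball b = `[- b, b]%classic `*` `[- b, b]%classic.
Proof.
apply/seteqP; split=> [[y z]|[y z]]; rewrite /maxball /= prod_normE/= ge_max !in_itv/= !ler_norml.
  by move=> /andP[-> ->].
by move=> [-> ->].
Qed.

Lemma measurable_maxball b : measurable (maxball b).
Proof. by rewrite maxballE; apply: measurableX. Qed.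

Lemma area_maxball b : 0 <= b -> area (maxball b) = ((2 * b) ^+ 2)%:E.
Proof.
move=> b0.
have -> : area (maxball b) =
    (lebesgue_measure (`[(- b)%R, b]%classic : set R) * lebesgue_measure (`[(- b)%R, b]%classic : set R))%E.
  by rewrite maxballE; apply: product_measure1E; exact: measurable_itv.
rewrite !lebesgue_measure_itv/= lte_fin.
case: ltP => [_|bb]; first by rewrite -!EFinD -EFinM; congr EFin; lra.
have -> : b = 0 by lra.
by rewrite mule0 mulr0 expr0n.
Qed.

Lemma measurable_invnorm :
  measurable_fun (setT : set (plane R)) (fun u : R * R => `|u|^-1).
Proof.
apply: continuous_off_origin_measurable => x x0.
apply: cvgV; first by rewrite normr_eq0.
exact: norm_continuous.
Qed.

(** Dyadic domination: [1 / |u|] is at most the sum over [k] of [2 ^+ k.+1] times the indicator of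
    [|u| <= 2 ^- k]. The [k]-th term has integral at most [2 ^+ k.+1 * (2 * 2 ^- k) ^+ 2 = 16 / 2 ^+
    k.+1]. *)
Lemma invnorm_integrable1 : area.-integrable (maxball (1 : R)) (fun u : R * R => (`|u|^-1)%:E).
Proof.
apply/integrableP; split.
  apply/measurable_EFinP; apply: measurable_funTS; exact: measurable_invnorm.
pose f k (u : plane R) : \bar R :=
  (2 ^+ k.+1 * \1_(maxball (2 ^- k)) u)%R%:E.
have mf k : measurable_fun (maxball (1 : R)) (f k).
  apply/measurable_EFinP; apply: measurable_funM => //; apply: measurable_indic.
  exact: measurable_maxball.
have f0 k u : (0 <= f k u)%E by rewrite lee_fin mulr_ge0// ?exprn_ge0.
have le1 (u : R * R) : maxball 1 u -> (`|(`|u|^-1)%:E| <= \sum_(0 <= k <oo) f k u)%E.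
  move=> u1; rewrite gee0_abs ?lee_fin ?invr_ge0//.
  have [->|u0] := eqVneq u 0.
    by rewrite normr0 invr0; apply: nneseries_ge0.
  have nu0 : 0 < `|u| by rewrite normr_gt0.
  have [k uk] : exists k, `|u| <= 2 ^- k /\ `|u|^-1 <= 2 ^+ k.+1.
    have [n nu] : exists n, `|u|^-1 <= 2 ^+ n.+1.
      have iu : 0 <= `|u|^-1 by rewrite invr_ge0.
      have h := archi_boundP iu.
      exists (Num.bound `|u|^-1); apply: (le_trans (ltW h)).
      by rewrite -natrX ler_nat ltnW// ltnW// ltn_expl.
    (* The least such index also gives [|u| <= 2 ^- k]: otherwise its predecessor would do. *)
    pose P n := `|u|^-1 <= 2 ^+ n.+1.
    case: (ex_minnP (ex_intro P n nu)) => k uk mink; exists k; split => //.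
    case: k => [|k] in uk mink *; first by rewrite expr0 invr1.
    rewrite leNgt; apply/negP => hk.
    have : P k by rewrite /P -[leRHS]invrK lef_pV2 ?posrE ?invr_gt0 ?exprn_gt0// ltW.
    by move=> /mink; rewrite ltnn.
  have [ul ur] := uk.
  have -> : (`|u|^-1)%:E = ((`|u|^-1)%:E + 0)%E by rewrite adde0.
  apply: (@le_trans _ _ (f k u)).
    rewrite adde0 /f indicE mem_set ?mulr1 ?lee_fin//.
  apply: (le_trans _ (@nneseries_lim_ge _ _ _ 0 k.+1 _)) => //.
  by rewrite big_nat_recr//= leeDr// sume_ge0.
apply: (@le_lt_trans _ _ (\int[area]_(u in maxball (1 : R)) \sum_(0 <= k <oo) f k u)%E).
  apply: ge0_le_integral; [exact: measurable_maxball|by []| |exact: ge0_emeasurable_sum|exact: le1].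
  - apply: measurableT_comp => //; apply/measurable_EFinP; apply: measurable_funTS; exact: measurable_invnorm.
rewrite integral_nneseries//; last exact: measurable_maxball.
apply: (@le_lt_trans _ _ (\sum_(0 <= k <oo) (16 / (2 ^ (k + 1))%:R)%:E)%E).
  apply: lee_nneseries => [k _ _|k _]; first by apply: integral_ge0 => u _; exact: f0.
  rewrite /f; under eq_integral do rewrite EFinM.
  rewrite ge0_integralZl_EFin; [|exact: measurable_maxball|by move=> u _; rewrite lee_fin| |by rewrite exprn_ge0].
    2: by apply/measurable_EFinP; apply: measurable_indic; exact: measurable_maxball.
  rewrite integral_indic; [|exact: measurable_maxball|exact: measurable_maxball].
  apply: (@le_trans _ _ ((2 ^+ k.+1)%:E * area (maxball (2 ^- k : R)))%E).
    apply: lee_wpmul2l; first by rewrite lee_fin exprn_ge0.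
    apply: le_measure; rewrite ?inE; [apply: measurableI| |]; [exact: measurable_maxball..|].
    exact: subIsetl.
  rewrite area_maxball ?invr_ge0 ?exprn_ge0// -EFinM lee_fin addn1 natrX.
  rewrite !exprS !exprMn -exprVn.
  by rewrite le_eqVlt; apply/orP; left; apply/eqP; rewrite exprVn; field.
have := @cvg_geometric_eseries_half R 16 0.
rewrite expr0 divr1 => /cvg_lim h.
rewrite (_ : \sum_(0 <= k <oo) _ = 16%:E)%E ?ltry//.
rewrite -[RHS]h//.
Qed.

End PlaneMeasure.

(** * Quadrature on unit cells *)

Section LatticeBox.

Definition zrange (n : nat) : seq int := [seq k%:Z - n%:Z | k <- iota 0 (2 * n).+1].

Lemma mem_zrange n (k : int) : (k \in zrange n) = (`|k| <= n%:Z).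
Proof.
apply/mapP/idP => [[j]|kn]; first by rewrite mem_iota => jn ->; lia.
by exists (absz (k + n%:Z)); [rewrite mem_iota; lia|lia].
Qed.

Lemma zrange_uniq n : uniq (zrange n).
Proof. by rewrite map_inj_uniq ?iota_uniq// => i j /addIr [->]. Qed.

Definition box (n : nat) : seq (int * int) := [seq (i, j) | i <- zrange n, j <- zrange n].

Lemma mem_box n (p : int * int) : (p \in box n) = (maxnorm p <= n%:Z).
Proof.
case: p => i j; rewrite /maxnorm /= ge_max -!mem_zrange.
by apply/allpairsP/andP => [[[a b] /= [? ? [-> ->]]]//|[? ?]]; exists (i, j).
Qed.

Lemma box_uniq n : uniq (box n).
Proof. by apply: allpairs_uniq; rewrite ?zrange_uniq// => -[? ?] [? ?] _ _ [-> ->]. Qed.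

(** Allows a box to be enlarged, shrunk, translated or reflected as long as the summand vanishes on
    the difference. *)
Lemma big_uniq_supp (T : eqType) (V : zmodType) (s1 s2 : seq T) (F : T -> V) :
  uniq s1 -> uniq s2 -> (forall i, F i != 0 -> (i \in s1) = (i \in s2)) ->
  \sum_(i <- s1) F i = \sum_(i <- s2) F i.
Proof.
move=> u1 u2 h.
have E (s : seq T) : \sum_(i <- s) F i = \sum_(i <- [seq i <- s | F i != 0]) F i.
  by rewrite big_filter [RHS]big_mkcond; apply: eq_bigr => i _; case: eqP.
rewrite E [RHS]E; apply: perm_big; apply: uniq_perm; rewrite ?filter_uniq// => i.
by rewrite !mem_filter; case: (boolP (F i != 0)) => //= /h.
Qed.

End LatticeBox.

(** * Polynomial interpolation at the nodes 0, ..., M - 1 *)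

Section VandermondeInverse.
Context {R : realType}.
Variable M : nat.

Lemma vandermonde_unit : Vandermonde M (\row_(k < M) (k%:R : R)) \in unitmx.
Proof.
rewrite unitmxE det_Vandermonde unitfE; apply/prodf_neq0 => i _.
apply/prodf_neq0 => j ij; rewrite !mxE subr_eq0 eqr_nat; lia.
Qed.

(** The coefficient of degree [i] of the Lagrange basis polynomial of the node [k]. *)
Definition vinv (k i : 'I_M) : R := invmx (Vandermonde M (\row_(k < M) (k%:R : R))) k i.

Lemma vinvP (a i : 'I_M) : \sum_(k < M) (k%:R : R) ^+ a * vinv k i = (a == i)%:R.
Proof.
have /matrixP/(_ a i) := mulmxV vandermonde_unit.
by rewrite !mxE => <-; apply: eq_bigr => k _; rewrite !mxE.
Qed.

Definition pv (c : nat -> nat -> R) (z : R * R) : R :=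
  \sum_(i < M) \sum_(j < M) c i j * z.1 ^+ i * z.2 ^+ j.

(** Interpolation on a grid of mesh [d] recovers the coefficients. The mesh 1 yields the quadrature
    weights; a small mesh is needed in [jets_cls], where values are controlled only near the
    origin. *)
Lemma pv_coef (c : nat -> nat -> R) (d : R) (i j : 'I_M) :
  c i j * d ^+ (i + j) =
  \sum_(k < M) \sum_(l < M) vinv k i * vinv l j * pv c (d * k%:R, d * l%:R).
Proof.
transitivity (\sum_(a < M) \sum_(b < M) c a b * d ^+ (a + b) * ((a == i)%:R * (b == j)%:R)).
  rewrite (bigD1 i)//= (bigD1 j)//= !eqxx !mulr1 big1 ?addr0; last first.
    by move=> b /negPf ->; rewrite !mulr0.
  rewrite big1 ?addr0// => a /negPf ->; rewrite big1// => b _.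
  by rewrite mul0r mulr0.
under eq_bigr do under eq_bigr do rewrite -!vinvP big_distrlr/= mulr_sumr.
under eq_bigr do under eq_bigr do under eq_bigr do rewrite mulr_sumr.
under eq_bigr do rewrite exchange_big/=.
rewrite exchange_big/=; apply: eq_bigr => k _.
under eq_bigr do rewrite exchange_big/=.
rewrite exchange_big/=; apply: eq_bigr => l _.
rewrite /pv mulr_sumr; apply: eq_bigr => a _; rewrite mulr_sumr; apply: eq_bigr => b _.
by rewrite /= !exprMn exprD; ring.
Qed.

End VandermondeInverse.

Lemma Rintegral_sum d (T : measurableType d) (R : realType) (mu : {measure set T -> \bar R})
    (D : set T) (I : Type) (s : seq I) (h : I -> T -> R) : measurable D ->
  (forall i, mu.-integrable D (EFin \o h i)) ->
  \int[mu]_(x in D) (\sum_(i <- s) h i x) = \sum_(i <- s) \int[mu]_(x in D) h i x.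
Proof.
move=> mD ih; elim: s => [|i s IHs].
  by under eq_Rintegral do rewrite big_nil; rewrite big_nil Rintegral_cst// mul0r.
under eq_Rintegral do rewrite big_cons; rewrite big_cons RintegralD//; first by rewrite IHs.
rewrite /comp; under eq_fun do rewrite -sumEFin.
by apply: integrable_sum => // j _; exact: ih.
Qed.

Section LocalError.
Context {R : realType}.
Variable M : nat.
Implicit Types (F : R * R -> R) (p : int * int).

Definition pt p : R * R := (p.1%:~R, p.2%:~R).

Lemma pt0 : pt 0 = 0.
Proof. by []. Qed.

(** Half-open, so that the cells partition the plane exactly and each point has a unique
    [cell_of]. *)
Definition cell p : set (plane R) :=
  `](p.1%:~R - 2^-1)%R, (p.1%:~R + 2^-1)%R]%classic `*`
  `](p.2%:~R - 2^-1)%R, (p.2%:~R + 2^-1)%R]%classic.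

Lemma measurable_cell p : measurable (cell p).
Proof. by apply: measurableX; exact: measurable_itv. Qed.

Lemma area_cell p : area (cell p) = 1%E.
Proof.
have -> : area (cell p) = (lebesgue_measure (`](p.1%:~R - 2^-1)%R, (p.1%:~R + 2^-1)%R]%classic : set R) *
    lebesgue_measure (`](p.2%:~R - 2^-1)%R, (p.2%:~R + 2^-1)%R]%classic : set R))%E.
  by apply: product_measure1E; exact: measurable_itv.
rewrite !lebesgue_measure_itv/= !lte_fin !ltrD2l.
have -> : - 2^-1 < 2^-1 :> R by lra.
by rewrite -!EFinD -EFinM; congr EFin; lra.
Qed.

Lemma cell_norm p (u : R * R) : cell p u -> `|u - pt p| <= 2^-1.
Proof.
case: u => a b [/=]; rewrite !in_itv/= => /andP[a1 a2] /andP[b1 b2].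
rewrite prod_normE/= ge_max !ler_norml; apply/andP; split; apply/andP; split; lra.
Qed.

Lemma bounded_integrable_cell p F (A : R) : measurable_fun (cell p) F ->
  (forall u, cell p u -> `|F u| <= A) -> area.-integrable (cell p) (EFin \o F).
Proof.
move=> mF FA; apply: measurable_bounded_integrable => //; first exact: measurable_cell.
  by change (area (cell p) < +oo)%E; rewrite area_cell ltry.
exists A; split; first exact: num_real.
by move=> B AB u /FA h; apply: le_trans h (ltW AB).
Qed.

Lemma Rintegral_cell_le p F (A : R) : area.-integrable (cell p) (EFin \o F) ->
  (forall u, cell p u -> `|F u| <= A) -> `|\int[area]_(u in cell p) F u| <= A.
Proof.
move=> iF FA; have mc := measurable_cell p.
apply: (le_trans (le_normr_Rintegral mc iF)).
apply: (@le_trans _ _ (\int[area]_(u in cell p) A)).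
  apply: le_Rintegral => //; first exact: (integrable_norm iF).
  apply: (@bounded_integrable_cell _ _ `|A|) => // u _.
rewrite Rintegral_cst//; change (A * fine (area (cell p)) <= A).
by rewrite area_cell mulr1.
Qed.

Lemma Rintegral_cell p F : area.-integrable (cell p) (EFin \o F) ->
  \int[area]_(u in cell p) F u = \int[area]_(u in cell 0) F (u + pt p) /\
  area.-integrable (cell 0) (EFin \o (fun u => F (u + pt p))).
Proof.
move=> iF; have mc := measurable_cell.
have iG : area.-integrable setT (EFin \o (F \_ (cell p))).
  by rewrite -restrict_EFin; apply/(integrable_mkcond _ (mc p)).
have E : (F \_ (cell p)) \o affine2 1 (pt p) = (fun u => F (u + pt p)) \_ (cell 0).
  apply/funext => u; rewrite /patch /affine2/= !mul1r.
  congr (if _ then _ else _).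
  apply/idP/idP; rewrite !inE => -[] /=; rewrite !in_itv/= => /andP[? ?] /andP[? ?];
    by split; rewrite /= in_itv/=; apply/andP; split; lra.
split.
  rewrite Rintegral_mkcond (Rintegral_affine2 (pt p) (oner_neq0 _) iG) expr1n mul1r.
  rewrite [RHS]Rintegral_mkcond -E//.
have := integrable_affine2 (pt p) (oner_neq0 _) iG.
by rewrite E -restrict_EFin => /(integrable_mkcond _ (mc 0)).
Qed.

Lemma measurable_monomial (i j : nat) :
  measurable_fun (setT : set (plane R)) (fun u : R * R => u.1 ^+ i * u.2 ^+ j).
Proof. by apply: measurable_funM; apply: measurable_funX. Qed.

Definition cmoment (i j : nat) : R := \int[area]_(u in cell 0) (u.1 ^+ i * u.2 ^+ j).

Lemma monomial_integrable_cell0 (i j : nat) :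
  area.-integrable (cell 0) (EFin \o (fun u : R * R => u.1 ^+ i * u.2 ^+ j)).
Proof.
apply: (@bounded_integrable_cell _ _ 1).
  by apply: measurable_funTS; exact: measurable_monomial.
move=> u /cell_norm; rewrite /pt/= subr0 prod_normE ge_max => /andP[u1 u2].
by rewrite normrM !normrX mulr_ile1 ?exprn_ge0 ?exprn_ile1//; lra.
Qed.

Lemma pv_integrable_cell0 (c : nat -> nat -> R) : area.-integrable (cell 0) (EFin \o (pv M c)).
Proof.
rewrite /pv.
have -> : EFin \o (fun z : R * R => \sum_(i < M) \sum_(j < M) c i j * z.1 ^+ i * z.2 ^+ j)
  = (fun z : plane R => \sum_(i < M) (\sum_(j < M) (c i j * (z.1 ^+ i * z.2 ^+ j))%:E)%R)%E.
  apply/funext => z /=; rewrite -sumEFin; apply: eq_bigr => i _; rewrite -sumEFin.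
  by apply: eq_bigr => j _; rewrite mulrA.
have mc := measurable_cell 0.
apply: (integrable_sum mc) => i _; apply: (integrable_sum mc) => j _.
under eq_fun do rewrite EFinM.
by apply: integrableZl => //; exact: monomial_integrable_cell0.
Qed.

Lemma Rintegral_pv (c : nat -> nat -> R) :
  \int[area]_(u in cell 0) pv M c u = \sum_(i < M) \sum_(j < M) c i j * cmoment i j.
Proof.
have mc := measurable_cell 0.
have im (i j : nat) := monomial_integrable_cell0 i j.
have ic (i j : nat) : area.-integrable (cell 0) (EFin \o (fun z : plane R => c i j * (z.1 ^+ i * z.2 ^+ j))).
  by rewrite /comp; under eq_fun do rewrite EFinM; apply: integrableZl => //; exact: im.
rewrite /pv; under eq_Rintegral do under eq_bigr do under eq_bigr do rewrite -mulrA.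
rewrite Rintegral_sum//; last first.
  move=> i; rewrite /comp; under eq_fun do rewrite -sumEFin.
  by apply: integrable_sum => // j _; exact: ic.
apply: eq_bigr => i _; rewrite Rintegral_sum//.
by apply: eq_bigr => j _; rewrite RintegralZl//; exact: im.
Qed.

Definition cweight (k l : 'I_M) : R :=
  \sum_(i < M) \sum_(j < M) vinv k i * vinv l j * cmoment i j.

Lemma cweight_exact (c : nat -> nat -> R) :
  \int[area]_(u in cell 0) pv M c u =
  \sum_(k < M) \sum_(l < M) cweight k l * pv M c (k%:R, l%:R).
Proof.
rewrite Rintegral_pv.
transitivity (\sum_(i < M) \sum_(j < M) \sum_(k < M) \sum_(l < M)
   vinv k i * vinv l j * cmoment i j * pv M c (k%:R, l%:R) : R).
  apply: eq_bigr => i _; apply: eq_bigr => j _.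
  have := @pv_coef R M c 1 i j; rewrite expr1n mulr1 => ->.
  rewrite mulr_suml; apply: eq_bigr => k _; rewrite mulr_suml; apply: eq_bigr => l _.
  by rewrite !mul1r; ring.
under eq_bigr do rewrite exchange_big/=.
rewrite exchange_big/=; apply: eq_bigr => k _.
under eq_bigr do rewrite exchange_big/=.
rewrite exchange_big/=; apply: eq_bigr => l _.
rewrite mulr_suml; apply: eq_bigr => i _; rewrite mulr_suml; apply: eq_bigr => j _.
by [].
Qed.

Definition cweight1 : R := \sum_(k < M) \sum_(l < M) `|cweight k l|.

(* The weights integrate over a cell the Lagrange interpolant at the nodes
   [p + (k, l)] with [k, l < M]. *)
Definition lerr F p : R :=
  \int[area]_(u in cell p) F u -
  \sum_(k < M) \sum_(l < M) cweight k l * F (pt p + (k%:R, l%:R)).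

(** Exactness lets the polynomial be subtracted for free. The difference is at most [A] on the cell,
    which has area 1, and at all nodes, which lie within [M] of [pt p]. *)
Lemma lerr_bound F p (c : nat -> nat -> R) (A : R) : (0 < M)%N ->
  area.-integrable (cell p) (EFin \o F) ->
  (forall z, `|z| <= M%:R -> `|F (pt p + z) - pv M c z| <= A) ->
  `|lerr F p| <= A * (1 + cweight1).
Proof.
move=> M0 iF FA; have [_ iF0] := Rintegral_cell iF.
have ip := pv_integrable_cell0 c.
rewrite /lerr (Rintegral_cell iF).1.
have -> : \int[area]_(u in cell 0) F (u + pt p) =
    \int[area]_(u in cell 0) (F (u + pt p) - pv M c u) + \int[area]_(u in cell 0) pv M c u.
  rewrite RintegralB ?subrK//; exact: measurable_cell.
rewrite cweight_exact -addrA -sumrB mulrDr mulr1.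
apply: (le_trans (ler_normD _ _)); apply: lerD.
  apply: Rintegral_cell_le.
    exact: (integrableB (measurable_cell 0) iF0 ip).
  move=> u /cell_norm; rewrite pt0 subr0 => u1.
  rewrite (addrC u); apply: FA; apply: (le_trans u1).
  by rewrite (@le_trans _ _ 1)// ?ler1n//; lra.
rewrite /cweight1 mulr_sumr; apply: (le_trans (ler_norm_sum _ _ _)); apply: ler_sum => k _.
rewrite -sumrB mulr_sumr; apply: (le_trans (ler_norm_sum _ _ _)); apply: ler_sum => l _.
rewrite -mulrBr normrM mulrC ler_wpM2r// distrC FA// prod_normE/= ge_max !ger0_norm//.
by rewrite !ler_nat !(ltnW (ltn_ord _)).
Qed.

Lemma cweight_sum : (0 < M)%N -> \sum_(k < M) \sum_(l < M) cweight k l = 1.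
Proof.
move=> M0.
have pv1 u : pv M (fun i j => ((i == 0)%N && (j == 0)%N)%:R) u = 1 :> R.
  rewrite /pv (bigD1 (Ordinal M0))//= (bigD1 (Ordinal M0))//= !expr0 !mulr1.
  rewrite big1 ?addr0 => [|j /negPf j0]; last first.
    by have -> : (j == 0 :> nat)%N = false by []; rewrite !mul0r.
  rewrite big1 ?addr0// => i /negPf i0; rewrite big1// => j _.
  by have -> : (i == 0 :> nat)%N = false by []; rewrite !mul0r.
have := cweight_exact (fun i j => ((i == 0)%N && (j == 0)%N)%:R).
under eq_Rintegral do rewrite pv1; rewrite Rintegral_cst; last exact: measurable_cell.
rewrite -[X in fine X]/(area (cell 0)) area_cell mulr1 => ->.
by apply: eq_bigr => k _; apply: eq_bigr => l _; rewrite pv1 mulr1.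
Qed.

Definition cell_of (u : R * R) : int * int :=
  (Num.ceil (u.1 - 2^-1), Num.ceil (u.2 - 2^-1)).

Lemma mem_cell p (u : R * R) : (u \in cell p) = (p == cell_of u).
Proof.
case: p u => a b [x y]; apply/idP/eqP; rewrite inE /cell /cell_of /=.
  rewrite !in_itv/= => -[/andP[? ?] /andP[? ?]].
  by congr pair; apply/esym/ceil_def; apply/andP; split; rewrite ?intrB; lra.
move=> [-> ->]; rewrite !in_itv/=.
have := ceil_itv (x - 2^-1); have := ceil_itv (y - 2^-1); rewrite !intrB.
move=> /andP[? ?] /andP[? ?]; split; apply/andP; split; lra.
Qed.

(* Each lattice point receives all the weights, which sum to 1. *)
Lemma sum_lerr F (n m : nat) : (0 < M)%N -> area.-integrable setT (EFin \o F) ->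
  (forall u, n%:R < `|u| -> F u = 0) -> (n + M < m)%N ->
  \sum_(p <- box m) lerr F p = \int[area]_u F u - \sum_(p <- box m) F (pt p).
Proof.
move=> M0 iF F0 nm; rewrite /lerr sumrB; congr (_ - _).
  have iFp p : area.-integrable (cell p) (EFin \o F).
    by apply: integrableS iF => //; exact: measurable_cell.
  under eq_bigr do rewrite Rintegral_mkcond.
  rewrite -Rintegral_sum//; last first.
    move=> p; rewrite -restrict_EFin; apply/(integrable_mkcond _ (measurable_cell p)).
    exact: iFp.
  apply: eq_Rintegral => u _; rewrite /patch.
  under eq_bigr do rewrite mem_cell (_ : (point : R) = 0)//.
  have [um|um] := boolP (cell_of u \in box m).
    rewrite (bigD1_seq (cell_of u)) ?box_uniq//= ifT// big1 /= ?addr0// => p /negPf pu.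
    by rewrite pu.
  rewrite big_seq big1 => [|p pm]; last first.
    by case: eqP => // e; rewrite -e pm in um.
  rewrite F0//; rewrite ltNge; apply: contra um => un.
  have /cell_norm uc : cell (cell_of u) u by apply/set_mem; rewrite mem_cell.
  have : `|pt (cell_of u)| <= n%:R + 1.
    rewrite -[pt _](subrK u); apply: (le_trans (ler_normD _ _)).
    by rewrite addrC lerD// distrC (le_trans uc)//; lra.
  rewrite natr1 prod_normE mem_box /maxnorm !ge_max /= -!intr_norm !pmulrn !ler_int//.
  by move=> /andP[? ?]; apply/andP; split; lia.
rewrite exchange_big/=.
under eq_bigr do rewrite exchange_big/=.
under eq_bigr do under eq_bigr do rewrite -mulr_sumr.
(* Translation by a node moves the support of [F], contained in [box n], by less than [M], so it
   stays inside [box m]. *)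
have E (k l : 'I_M) : \sum_(p <- box m) F (pt p + (k%:R, l%:R)) = \sum_(p <- box m) F (pt p).
  pose q : int * int := (k%:Z, l%:Z).
  have pq p : pt p + (k%:R, l%:R) = pt (p + q) by rewrite /pt /q /= !rmorphD.
  under eq_bigr do rewrite pq.
  rewrite -(big_map (fun p => p + q) xpredT (fun p => F (pt p))).
  apply: big_uniq_supp; rewrite ?box_uniq ?map_inj_uniq ?box_uniq//; first exact: addIr.
  move=> p Fp0.
  have pn : maxnorm p <= n%:Z.
    have : ~ (n%:R < `|pt p|) by move/F0 => h; rewrite h eqxx in Fp0.
    move/negP; rewrite -leNgt prod_normE /maxnorm !ge_max /= -!intr_norm !pmulrn !ler_int//.
  have -> : p \in box m by rewrite mem_box; lia.
  apply/mapP; exists (p - q); last by rewrite subrK.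
  rewrite mem_box; move: pn; rewrite /maxnorm /q /= !ge_max.
  have := ltn_ord k; have := ltn_ord l; lia.
under eq_bigr do under eq_bigr do rewrite E.
under eq_bigr do rewrite -mulr_suml.
by rewrite -mulr_suml cweight_sum// mul1r.
Qed.

End LocalError.

(** * Uniform jets *)

Section BinomialSeries.
Context {R : realType}.

Definition bser (n : nat) (t : R) : R := \sum_(k < n) gbinom (- 2^-1) k * t ^+ k.

Lemma gbinom0 (x : R) : gbinom x 0 = 1.
Proof. by rewrite /gbinom big_ord0 fact0 divr1. Qed.

Lemma gbinomS (x : R) k : gbinom x k.+1 * k.+1%:R = gbinom x k * (x - k%:R).
Proof.
rewrite /gbinom big_ord_recr /= factS natrM.
have k0 : (1 + k%:R : R) != 0 by rewrite nat1r pnatr_eq0.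
have f0 : (k`!%:R : R) != 0 by rewrite pnatr_eq0 -lt0n fact_gt0.
by field; rewrite k0 f0.
Qed.

(** The series of [(1 + t) ^ (-1/2)] solves [2 (1 + t) y' + y = 0]; its truncation [S] solves this
    up to one monomial. Hence the derivative of [S ^+ 2 * (1 + 'X)] is a multiple of the same
    monomial, and only the constant term survives below the order of truncation. *)
Lemma bser_sqr n : exists H : {poly R}, forall t, bser n t ^+ 2 * (1 + t) = 1 + t ^+ n * H.[t].
Proof.
case: n => [|n].
  exists (-1)%:P => t; rewrite /bser big_ord0 expr0n mul0r mul1r hornerC; lra.
pose S : {poly R} := \poly_(k < n.+1) gbinom (- 2^-1) k.
have SE t : S.[t] = bser n.+1 t by rewrite horner_poly.
pose T : {poly R} := S ^+ 2 * (1 + 'X).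
(* The recurrence [gbinomS] cancels all coefficients except the last one, where the truncation
   shows. *)
have S' : (2 : R) *: S^`() * (1 + 'X) + S = (((2 * n + 1)%:R : R) * gbinom (- 2^-1) n) *: 'X^n.
  apply/polyP => k; rewrite mulrDr mulr1 coefD coefD -scalerAl !coefZ coefMX coef_deriv coefXn.
  have -> : (if k == 0%N then 0 else S^`()`_k.-1) = S`_k *+ k.
    by case: k => [|k]; rewrite ?mulr0n//= coef_deriv.
  rewrite -(mulr_natr _ k.+1) -(mulr_natr _ k) !coef_poly !ltnS.
  have g := gbinomS (- 2^-1) k.
  have [kn|kn|->] := ltngtP k n; rewrite /= ?mul0r ?mulr0 ?addr0 ?add0r//.
    by rewrite g; lra.
  by rewrite natrD natrM; lra.
have T' : T^`() = S * ((((2 * n + 1)%:R : R) * gbinom (- 2^-1) n) *: 'X^n).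
  rewrite -S' /T derivM derivD derivC derivX add0r mulr1 expr2 derivM.
  rewrite -mul_polyC; ring.
have T0 k : (0 < k <= n)%N -> T`_k = 0.
  case: k => // k /= kn; have := coef_deriv T k; rewrite T' -scalerAr coefZ coefMXn kn mulr0.
  by move/esym/eqP; rewrite mulrn_eq0 => /eqP.
exists (drop_poly n.+1 T) => t.
rewrite -SE; transitivity T.[t]; first by rewrite /T !hornerE.
have T1 : take_poly n.+1 T = 1.
  apply/polyP => k; rewrite coef_take_poly coef1 ltnS.
  case: k => [|k]; last by case: ifPn => // kn; rewrite T0.
  have S0 : S.[0] = 1.
    rewrite SE /bser big_ord_recl big1 ?addr0.
      by rewrite gbinom0 expr0 mulr1.
    by move=> i _; rewrite expr0n mulr0.
  by rewrite -horner_coef0 /T hornerM hornerD hornerX hornerC expr2 hornerM S0 addr0 !mulr1.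
rewrite -{1}(poly_take_drop n.+1 T) T1 !hornerE mulrC//.
Qed.

Lemma poly_bound1 (p : {poly R}) : exists2 K : R, 0 <= K & forall t, `|t| <= 1 -> `|p.[t]| <= K.
Proof.
exists (\sum_(i < size p) `|p`_i|); first by apply: sumr_ge0.
move=> t t1; rewrite horner_coef; apply: (le_trans (ler_norm_sum _ _ _)); apply: ler_sum => i _.
by rewrite normrM normrX ler_piMr// exprn_ile1.
Qed.

(** With [w = Num.sqrt (1 + t)] and [S = bser n t], the identity reads [(S w - 1) (S w + 1) = t ^+ n
    * H.[t]]; dividing by [w (S w + 1)] gives an exact remainder carrying the factor [t ^+ n]. *)
Lemma bser_sqrt n t (H : {poly R}) : 0 < 1 + t -> 0 <= bser n t ->
  (forall t, bser n t ^+ 2 * (1 + t) = 1 + t ^+ n * H.[t]) ->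
  (Num.sqrt (1 + t))^-1 = bser n t -
    t ^+ n * H.[t] * ((Num.sqrt (1 + t))^-1 * (1 + bser n t * Num.sqrt (1 + t))^-1).
Proof.
move=> t1 S0 HE; set w := Num.sqrt (1 + t).
have w0 : 0 < w by rewrite sqrtr_gt0.
have w2 : w ^+ 2 = 1 + t by rewrite sqr_sqrtr// ltW.
have := HE t; rewrite -w2 => e.
have d0 : 0 < 1 + bser n t * w by rewrite ltr_wpDr// mulr_ge0// ltW.
have {e} e : t ^+ n * H.[t] = (bser n t * w - 1) * (bser n t * w + 1).
  by rewrite -[LHS](addKr 1) -e; ring.
rewrite e; field; rewrite gt_eqF//= gt_eqF//.
Qed.

Lemma bser_half n : (0 < n)%N -> exists2 d : R, 0 < d <= 2^-1 & forall t : R, `|t| <= d -> 2^-1 <= bser n t.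
Proof.
case: n => // n _.
pose K := \sum_(k < n) `|gbinom (- 2^-1 : R) k.+1|.
have K0 : 0 <= K by apply: sumr_ge0.
(* For [|t|] below this value, which is at most 1, the terms after the leading 1 add up to at most
   [|t| * K <= 1/2]. *)
exists (2 * (1 + K))^-1.
  rewrite invr_gt0 mulr_gt0 ?ltr_wpDr//= lef_pV2 ?posrE ?mulr_gt0 ?ltr_wpDr//; lra.
move=> t td; rewrite /bser big_ord_recl /= expr0 mulr1.
rewrite gbinom0.
set s := \sum_(i < n) _.
suff : `|s| <= 2^-1 by rewrite ler_norml => /andP[]; lra.
have t1 : `|t| <= 1.
  by apply: (le_trans td); rewrite invf_le1 ?mulr_gt0 ?ltr_wpDr//; lra.
apply: (@le_trans _ _ (`|t| * K)).
  rewrite mulr_sumr; apply: (le_trans (ler_norm_sum _ _ _)); apply: ler_sum => i _.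
  rewrite /bump/= add1n normrM normrX exprS mulrC -mulrA ler_wpM2l// ler_piMl// exprn_ile1//.
rewrite (le_trans (ler_wpM2r K0 td))// ler_pdivrMl ?mulr_gt0 ?ltr_wpDr//; lra.
Qed.

End BinomialSeries.

Section Jets.
Context {R : realType}.
Variable M : nat.

Lemma expr_le_ge1 (t : R) (m n : nat) : 0 <= t <= 1 -> (m <= n)%N -> t ^+ n <= t ^+ m.
Proof.
move=> /andP[t0 t1] mn; rewrite -(subnK mn) exprD ler_piMl ?exprn_ge0// exprn_ile1//.
Qed.

Lemma norm_mono_le (z : R * R) (a b : nat) : `|z.1 ^+ a * z.2 ^+ b| <= `|z| ^+ (a + b).
Proof.
rewrite normrM !normrX exprD ler_pM// ?exprn_ge0//; apply: lerXn2r; rewrite ?nnegrE// prod_normE le_max lexx ?orbT//.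
Qed.

Lemma norm_mono_le_trunc (z : R * R) (a b n : nat) : `|z| <= 1 -> (n <= a + b)%N ->
  `|z.1 ^+ a * z.2 ^+ b| <= `|z| ^+ n.
Proof.
move=> z1 nab; apply: (le_trans (norm_mono_le z a b)).
by apply: expr_le_ge1 => //; rewrite normr_ge0.
Qed.

Section Families.
Variables (X : Type) (D : set X).
Implicit Types (phi psi : X -> R * R -> R).

(** A substitute for uniform bounds on derivatives at the origin. The constants [C] and [e] serve
    all parameters [x] at once; the polynomial may depend on [x]. *)
Definition jets phi : Prop :=
  exists (C e : R) (c : X -> nat -> nat -> R), [/\ 0 <= C, 0 < e <= 1 &
    forall x, D x -> (forall i j, `|c x i j| <= C) /\
      forall z, `|z| <= e -> `|phi x z - pv M (c x) z| <= C * `|z| ^+ M].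

Lemma jets_ext phi psi (e : R) : 0 < e ->
  (forall x z, D x -> `|z| <= e -> phi x z = psi x z) -> jets phi -> jets psi.
Proof.
move=> e0 h [C [d [c [C0 /andP[d0 d1] H]]]]; exists C, (Num.min d e), c; split => //.
  by rewrite lt_min d0 e0/= ge_min d1.
move=> x Dx; have [cC Hc] := H x Dx; split=> // z; rewrite le_min => /andP[zd ze].
by rewrite -h// Hc.
Qed.

Lemma jets_O phi (C e : R) : 0 < e ->
  (forall x z, D x -> `|z| <= e -> `|phi x z| <= C * `|z| ^+ M) -> jets phi.
Proof.
move=> e0 h; exists `|C|, (Num.min e 1), (fun _ _ _ => 0); split => //.
  by rewrite lt_min e0 ltr01/= ge_min lexx orbT.
move=> x Dx; split=> [i j|z]; first by rewrite normr0.
rewrite le_min => /andP[ze _]; rewrite /pv big1 ?subr0 => [|i _]; last first.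
  by rewrite big1// => j _; rewrite !mul0r.
by rewrite (le_trans (h _ _ Dx ze))// ler_wpM2r ?exprn_ge0// ler_norm.
Qed.

Lemma jets_add phi psi : jets phi -> jets psi -> jets (fun x z => phi x z + psi x z).
Proof.
move=> [C [e [c [C0 /andP[e0 e1] H]]]] [C' [e' [c' [C0' /andP[e0' e1'] H']]]].
exists (C + C'), (Num.min e e'), (fun x i j => c x i j + c' x i j); split.
- by rewrite addr_ge0.
- by rewrite lt_min e0 e0'/= ge_min e1.
move=> x Dx; have [cC Hc] := H x Dx; have [cC' Hc'] := H' x Dx; split=> [i j|z].
  by rewrite (le_trans (ler_normD _ _))// lerD.
rewrite le_min => /andP[ze ze'].
have -> : pv M (fun i j => c x i j + c' x i j) z = pv M (c x) z + pv M (c' x) z.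
  rewrite /pv -big_split; apply: eq_bigr => i _; rewrite -big_split; apply: eq_bigr => j _ /=.
  by rewrite !mulrDl.
rewrite opprD addrACA (le_trans (ler_normD _ _))// mulrDl lerD ?Hc ?Hc'//.
Qed.

Lemma jets_mono (b : X -> R) (B : R) (i j : nat) : (forall x, D x -> `|b x| <= B) ->
  jets (fun x z => b x * z.1 ^+ i * z.2 ^+ j).
Proof.
move=> bB; have [/andP[iM jM]|ij] := boolP ((i < M) && (j < M))%N; last first.
  apply: (@jets_O _ B 1) => // x z Dx z1; rewrite -mulrA normrM ler_pM// ?bB//.
  apply: norm_mono_le_trunc => //; lia.
exists `|B|, 1, (fun x a b' => (b x) * ((a == i) && (b' == j))%:R); split => //.
  by rewrite ltr01 lexx.
move=> x Dx; split=> [a b'|z z1].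
  case: (_ && _); rewrite ?mulr1 ?mulr0 ?normr0//.
  by rewrite (le_trans (bB _ Dx))// ler_norm.
rewrite /pv (bigD1 (Ordinal iM))//= (bigD1 (Ordinal jM))//= !eqxx mulr1.
rewrite big1 ?addr0 => [|k /negPf k0]; last first.
  by have -> : (k == j :> nat) = false by []; rewrite mulr0 !mul0r.
rewrite big1 ?addr0 => [|k /negPf k0]; last first.
  by rewrite big1// => l _; have -> : (k == i :> nat) = false by []; rewrite mulr0 !mul0r.
by rewrite subrr normr0 mulr_ge0 ?exprn_ge0.
Qed.

Lemma jets_cst (b : X -> R) (B : R) : (forall x, D x -> `|b x| <= B) -> jets (fun x _ => b x).
Proof.
move=> bB; apply: (@jets_ext _ _ 1 _ _ (@jets_mono b B 0 0 bB)) => // x z _ _.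
by rewrite !expr0 !mulr1.
Qed.

Lemma jets_sum (I : Type) (s : seq I) (phi : I -> X -> R * R -> R) :
  (forall i, jets (phi i)) -> jets (fun x z => \sum_(i <- s) phi i x z).
Proof.
move=> h; elim: s => [|i s IHs].
  apply: (@jets_ext _ _ 1 _ _ (@jets_cst (fun=> 0) 0 _)) => // x *; rewrite ?big_nil ?normr0//.
apply: (@jets_ext _ _ 1 _ _ (jets_add (h i) IHs)) => // x z *.
by rewrite big_cons.
Qed.

Lemma pv_bound (c : nat -> nat -> R) C z : (forall i j, `|c i j| <= C) -> `|z| <= 1 ->
  `|pv M c z| <= C *+ (M * M).
Proof.
move=> cC z1; have -> : C *+ (M * M) = \sum_(i < M) \sum_(j < M) C.
  by rewrite !sumr_const !card_ord mulrnA.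
rewrite /pv; apply: (le_trans (ler_norm_sum _ _ _)); apply: ler_sum => i _.
apply: (le_trans (ler_norm_sum _ _ _)); apply: ler_sum => j _.
rewrite -mulrA normrM -[leRHS]mulr1 ler_pM//.
by have := @norm_mono_le_trunc z i j 0 z1 (leq0n _); rewrite expr0.
Qed.

Lemma jets_bounded phi : jets phi -> exists C e : R, [/\ 0 <= C, 0 < e <= 1 &
  forall x z, D x -> `|z| <= e -> `|phi x z| <= C].
Proof.
move=> [C [e [c [C0 /andP[e0 e1] H]]]]; exists (C *+ (M * M) + C), e; split.
- by rewrite addr_ge0// mulrn_wge0.
- by rewrite e0.
move=> x z Dx ze; have [cC Hc] := H x Dx.
have z1 : `|z| <= 1 by exact: le_trans ze e1.
rewrite -[phi x z](subrK (pv M (c x) z)) addrC (le_trans (ler_normD _ _))//.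
rewrite lerD ?pv_bound// (le_trans (Hc _ ze))// ler_piMr// exprn_ile1//.
Qed.

(** The product of the two polynomials exceeds degree [M], but it is a sum of monomials with bounded
    coefficients, each of which has jets by [jets_mono]. The rest is [O(|z| ^ M)] because [phi] is
    bounded. *)
Lemma jets_mul phi psi : jets phi -> jets psi -> jets (fun x z => phi x z * psi x z).
Proof.
move=> jphi jpsi; have [K [d [K0 /andP[d0 d1] HK]]] := jets_bounded jphi.
move: jphi jpsi => [C [e [c [C0 /andP[e0 e1] H]]]] [C' [e' [c' [C0' /andP[e0' e1'] H']]]].
have jp : jets (fun x z => pv M (c x) z * pv M (c' x) z).
  apply: (@jets_ext (fun x z => \sum_(i < M) \sum_(k < M) \sum_(j < M) \sum_(l < M)
    (c x i j * c' x k l) * z.1 ^+ (i + k) * z.2 ^+ (j + l)) _ 1) => //.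
    move=> x z Dx z1; rewrite /pv big_distrlr/=; apply: eq_bigr => i _; apply: eq_bigr => k _.
    rewrite big_distrlr/=; apply: eq_bigr => j _; apply: eq_bigr => l _.
    by rewrite !exprD; ring.
  do 4 (apply: jets_sum => ?).
  apply: (@jets_mono _ (C * C')) => x Dx; rewrite normrM ler_pM//.
    by have [] := H x Dx.
  by have [] := H' x Dx.
have jr : jets (fun x z => phi x z * (psi x z - pv M (c' x) z) + (phi x z - pv M (c x) z) * pv M (c' x) z).
  apply: (@jets_O _ (K * C' + C * (C' *+ (M * M))) (Num.min d (Num.min e e'))).
    by rewrite !lt_min d0 e0 e0'.
  move=> x z Dx; rewrite !le_min => /and3P[zd ze ze'].
  have [cC Hc] := H x Dx; have [cC' Hc'] := H' x Dx.
  rewrite (le_trans (ler_normD _ _))// [leRHS]mulrDl !normrM lerD//.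
    by rewrite -mulrA ler_pM// ?HK ?Hc'.
  rewrite mulrAC ler_pM// ?Hc// pv_bound//; exact: le_trans ze' e1'.
apply: (@jets_ext _ _ 1 _ _ (jets_add jp jr)) => // x z _ _; ring.
Qed.

Lemma jets_exp phi k : jets phi -> jets (fun x z => phi x z ^+ k).
Proof.
move=> jphi; elim: k => [|k IHk].
  by apply: (@jets_cst (fun=> 1) 1) => x _; rewrite normr1.
by apply: (@jets_ext _ _ 1 _ _ (jets_mul jphi IHk)) => // x z *; rewrite exprS.
Qed.

Lemma jets_lip phi : (0 < M)%N -> jets phi -> exists K e : R, [/\ 0 <= K, 0 < e <= 1 &
  forall x z, D x -> `|z| <= e -> `|phi x z - phi x 0| <= K * `|z|].
Proof.
move=> M0 [C [e [c [C0 /andP[e0 e1] H]]]]; exists (C *+ (M * M) + C), e; split.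
- by rewrite addr_ge0// mulrn_wge0.
- by rewrite e0.
move=> x z Dx ze; have [cC Hc] := H x Dx.
have z1 : `|z| <= 1 by exact: le_trans ze e1.
(* At [z = 0] the error bound is [C * 0 ^+ M = 0], as [M] is positive. *)
have p0 : phi x 0 = pv M (c x) 0.
  have e00 : `|0 : R * R| <= e by rewrite normr0 ltW.
  apply/eqP; rewrite -subr_eq0 -normr_le0 (le_trans (Hc 0 e00))// normr0 expr0n.
  by rewrite gtn_eqF// mulr0.
have -> : phi x z - phi x 0 = (pv M (c x) z - pv M (c x) 0) + (phi x z - pv M (c x) z).
  by rewrite p0; ring.
rewrite (le_trans (ler_normD _ _))// [leRHS]mulrDl lerD//; last first.
  by rewrite (le_trans (Hc _ ze))// ler_wpM2l// -[leRHS]expr1 expr_le_ge1// normr_ge0.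
rewrite mulrnAl; have -> : (C * `|z|) *+ (M * M) = \sum_(i < M) \sum_(j < M) C * `|z|.
  by rewrite !sumr_const !card_ord mulrnA.
rewrite /pv -sumrB; apply: (le_trans (ler_norm_sum _ _ _)); apply: ler_sum => i _.
rewrite -sumrB; apply: (le_trans (ler_norm_sum _ _ _)); apply: ler_sum => j _ /=.
rewrite -!mulrA -mulrBr normrM ler_pM//.
have [ij0|ij0] := eqVneq (i + j)%N 0%N; last first.
  have -> : (0 : R) ^+ i * 0 ^+ j = 0 by rewrite -exprD expr0n (negPf ij0).
  by rewrite subr0 -[leRHS]expr1 norm_mono_le_trunc// lt0n.
by move/eqP: ij0; rewrite addn_eq0 => /andP[/eqP -> /eqP ->]; rewrite !expr0 subrr normr0.
Qed.

(** Factor [phi x z = phi x 0 * (1 + E x z)]. The lower bound [c0] makes [E = O(|z|)] uniform, so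
    the remainder of the binomial series truncated at order [M] is [O(|z| ^ M)], and the truncated
    series is a polynomial in [E]. *)
Lemma jets_invsqrt phi (c0 : R) : (0 < M)%N -> 0 < c0 -> (forall x, D x -> c0 <= phi x 0) ->
  jets phi -> jets (fun x z => (Num.sqrt (phi x z))^-1).
Proof.
move=> M0 c00 hc jphi.
have [K [e1 [K0 /andP[e10 e11] HK]]] := jets_lip M0 jphi.
have t0 x : D x -> 0 < phi x 0 by move=> /hc; exact: lt_le_trans.
pose E x z := (phi x 0)^-1 * phi x z + (-1).
have jE : jets E.
  apply: jets_add; last by apply: (@jets_cst (fun=> -1) 1) => x _; rewrite normrN1.
  apply: jets_mul => //; apply: (@jets_cst _ c0^-1) => x Dx.
  by rewrite normfV ger0_norm ?(ltW (t0 x Dx))// lef_pV2 ?posrE ?hc// t0.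
have EK x z : D x -> `|z| <= e1 -> `|E x z| <= K / c0 * `|z|.
  move=> Dx ze; have -> : E x z = (phi x z - phi x 0) / phi x 0.
    by rewrite /E; field; rewrite gt_eqF// t0.
  rewrite normrM mulrAC ler_pM// ?HK// normfV ger0_norm ?(ltW (t0 x Dx))//.
  by rewrite lef_pV2 ?posrE ?hc// t0.
have [H HE] := @bser_sqr R M.
have [KH KH0 HKH] := poly_bound1 H.
have [d /andP[d0 d2] hd] := @bser_half R M M0.
(* Keeps [|E|] below the threshold [d] of [bser_half]; the summand 1 keeps the denominator positive
   when [K = 0]. *)
pose e := Num.min e1 (d / (K / c0 + 1)).
have Kc0 : 0 <= K / c0 by rewrite divr_ge0// ltW.
have e0 : 0 < e by rewrite lt_min e10 divr_gt0// ltr_wpDl.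
have Ed x z : D x -> `|z| <= e -> `|E x z| <= d.
  move=> Dx; rewrite le_min => /andP[ze1 zd]; rewrite (le_trans (EK _ _ Dx ze1))//.
  move: zd; rewrite ler_pdivlMr ?ltr_wpDl// mulrDr mulr1 mulrC => zd.
  by apply: le_trans zd; rewrite lerDl.
have jS : jets (fun x z => bser M (E x z)).
  rewrite /bser; apply: jets_sum => k; apply: jets_mul; last exact: jets_exp.
  by apply: (@jets_cst (fun=> _) `|gbinom (- 2^-1) k|).
have jr : jets (fun x z => - (E x z ^+ M * H.[E x z] *
    ((Num.sqrt (1 + E x z))^-1 * (1 + bser M (E x z) * Num.sqrt (1 + E x z))^-1))).
  apply: (@jets_O _ ((K / c0) ^+ M * KH * 2) e) => // x z Dx ze.
  have ze1 : `|z| <= e1 by move: ze; rewrite le_min => /andP[].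
  have Edx := Ed x z Dx ze.
  have E1 : 2^-1 <= 1 + E x z by move: Edx; rewrite ler_norml => /andP[]; lra.
  have -> : (K / c0) ^+ M * KH * 2 * `|z| ^+ M = ((K / c0 * `|z|) ^+ M * KH) * 2.
    by rewrite [in RHS]exprMn; ring.
  rewrite normrN normrM ler_pM//.
    rewrite normrM ler_pM//; last by rewrite HKH// (le_trans Edx)//; lra.
    by rewrite normrX; apply: lerXn2r; [rewrite nnegrE|rewrite nnegrE mulr_ge0|exact: EK].
  set w := Num.sqrt _; have w2 : 2^-1 <= w.
    rewrite -(@ler_pXn2r _ 2) ?nnegrE ?sqrtr_ge0// sqr_sqrtr; lra.
  have S2 := hd _ Edx.
  have Sw : 0 <= bser M (E x z) * w by rewrite mulr_ge0//; lra.
  rewrite -[leRHS]mulr1 normrM !ger0_norm ?invr_ge0//; [|lra..].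
  rewrite ler_pM ?invr_ge0//; [lra|lra| |].
    by rewrite -[leRHS]invrK lef_pV2 ?posrE ?invr_gt0//; lra.
  by rewrite invf_le1//; lra.
apply: (@jets_ext (fun x z => (Num.sqrt (phi x 0))^-1 * (bser M (E x z) +
  - (E x z ^+ M * H.[E x z] *
    ((Num.sqrt (1 + E x z))^-1 * (1 + bser M (E x z) * Num.sqrt (1 + E x z))^-1)))) _ e) => //; last first.
  apply: jets_mul; last exact: jets_add.
  apply: (@jets_cst _ (Num.sqrt c0)^-1) => x Dx.
  rewrite ger0_norm ?invr_ge0 ?sqrtr_ge0// lef_pV2 ?posrE ?sqrtr_gt0 ?t0//.
  by rewrite ler_wsqrtr// hc.
move=> x z Dx ze; have Edx := Ed x z Dx ze.
rewrite -bser_sqrt//; last 2 first.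
- by move: Edx; rewrite ler_norml => /andP[]; lra.
- by apply: le_trans (hd _ Edx); rewrite invr_ge0.
rewrite -invfM -sqrtrM ?(ltW (t0 x Dx))//; congr (Num.sqrt _)^-1.
by rewrite /E; field; rewrite gt_eqF// t0.
Qed.

End Families.
End Jets.

(** * Functions with a singularity of homogeneous type at the origin *)

Section SingularClass.
Context {R : realType}.
Variable M : nat.
Implicit Types (D : set (R * R)) (s t : int) (g : R * R -> R) (x z : R * R).

(* [g] behaves on [D] like a function smooth off the origin and homogeneous of
   degree [s], up to derivatives of order [M]. *)
Definition cls D s g : Prop :=
  jets M (D `\ 0) (fun x z => `|x| ^ (- s) * g (x + `|x| *: z)).

Lemma cls_sub D D' s g : D' `<=` D -> cls D s g -> cls D' s g.
Proof.
move=> DD [C [e [c [C0 e0 H]]]]; exists C, e, c; split => // x [/DD Dx x0].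
exact: H.
Qed.

Lemma cls_union D D' s g : cls D s g -> cls D' s g -> cls (D `|` D') s g.
Proof.
move=> [C [e [c [C0 /andP[e0 e1] H]]]] [C' [e' [c' [C0' /andP[e0' e1'] H']]]].
exists (C + C'), (Num.min e e'), (fun x => if `[< D x >] then c x else c' x); split.
- exact: addr_ge0.
- by rewrite lt_min e0 e0' ge_min e1.
move=> x [DDx x0]; case: asboolP => Dx.
  have [cC Hc] := H x (conj Dx x0); split=> [i j|z]; first by rewrite (le_trans (cC i j))// lerDl.
  rewrite le_min => /andP[ze _]; rewrite (le_trans (Hc z ze))// ler_wpM2r ?exprn_ge0// lerDl//.
have D'x : D' x by case: DDx.
have [cC Hc] := H' x (conj D'x x0); split=> [i j|z]; first by rewrite (le_trans (cC i j))// lerDr.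
rewrite le_min => /andP[_ ze]; rewrite (le_trans (Hc z ze))// ler_wpM2r ?exprn_ge0// lerDr//.
Qed.

(** Agreement on [D] alone would not do: [cls] looks at balls of radius proportional to [|x|] around
    the points of [D], and these may leave [D]. *)
Lemma cls_ext D s g g' (e : R) : 0 < e ->
  (forall x y, D x -> x != 0 -> `|y - x| <= e * `|x| -> g y = g' y) -> cls D s g -> cls D s g'.
Proof.
move=> e0 h; apply: (@jets_ext _ _ _ _ _ _ e) => // x z [Dx /eqP x0] ze.
rewrite (h x)// addrC addKr normrZ normr_id mulrC ler_wpM2r//.
Qed.

Lemma cls_add D s g g' : cls D s g -> cls D s g' -> cls D s (fun u => g u + g' u).
Proof.
move=> c1 c2; apply: (@jets_ext _ _ _ _ _ _ 1 _ _ (jets_add c1 c2)) => // x z _ _.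
by rewrite mulrDr.
Qed.

Lemma cls_mul D s t g g' : cls D s g -> cls D t g' -> cls D (s + t) (fun u => g u * g' u).
Proof.
move=> c1 c2; apply: (@jets_ext _ _ _ _ _ _ 1 _ _ (jets_mul c1 c2)) => // x z [_ /eqP x0] _.
by rewrite opprD expfzDr ?normr_eq0//; ring.
Qed.

Lemma cls_cst D (k : R) : cls D 0 (fun=> k).
Proof.
apply: (@jets_ext _ _ _ _ _ _ 1 _ _ (@jets_cst _ _ _ _ (fun=> k) `|k| _)) => //.
by move=> x z _ _; rewrite oppr0 expr0z mul1r.
Qed.

Lemma cls_scale D s (k : R) g : cls D s g -> cls D s (fun u => k * g u).
Proof. by move=> c; rewrite -[s]add0r; apply: cls_mul => //; exact: cls_cst. Qed.

Lemma cls_sum D s (I : Type) (r : seq I) (G : I -> R * R -> R) : (forall i, cls D s (G i)) ->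
  cls D s (fun u => \sum_(i <- r) G i u).
Proof.
move=> h; apply: (@jets_ext _ _ _ _ _ _ 1 _ _ (jets_sum r h)) => // x z _ _.
by rewrite mulr_sumr.
Qed.

Lemma cls_coord1 D : cls D 1 (fun u => u.1).
Proof.
have j1 : jets M (D `\ 0) (fun x _ => `|x| ^ (-1) * x.1).
  apply: (@jets_cst _ _ _ _ _ 1) => x [_ /eqP x0].
  rewrite exprN1 normrM normfV normr_id mulrC ler_pdivrMr ?normr_gt0// mul1r.
  by rewrite prod_normE le_max lexx.
have j2 : jets M (D `\ 0) (fun x z => 1 * z.1 ^+ 1 * z.2 ^+ 0).
  by apply: (@jets_mono _ _ _ _ (fun=> 1) 1) => x _; rewrite normr1.
apply: (@jets_ext _ _ _ _ _ _ 1 _ _ (jets_add j1 j2)) => // x z [_ /eqP x0] _.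
rewrite expr1 expr0 !mulr1 mul1r exprN1 mulrDr /=; congr (_ + _).
by rewrite mulrA mulVf ?mul1r// normr_eq0.
Qed.

Lemma cls_coord2 D : cls D 1 (fun u => u.2).
Proof.
have j1 : jets M (D `\ 0) (fun x _ => `|x| ^ (-1) * x.2).
  apply: (@jets_cst _ _ _ _ _ 1) => x [_ /eqP x0].
  rewrite exprN1 normrM normfV normr_id mulrC ler_pdivrMr ?normr_gt0// mul1r.
  by rewrite prod_normE le_max lexx orbT.
have j2 : jets M (D `\ 0) (fun x z => 1 * z.1 ^+ 0 * z.2 ^+ 1).
  by apply: (@jets_mono _ _ _ _ (fun=> 1) 1) => x _; rewrite normr1.
apply: (@jets_ext _ _ _ _ _ _ 1 _ _ (jets_add j1 j2)) => // x z [_ /eqP x0] _.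
rewrite expr1 expr0 !mulr1 mul1r exprN1 mulrDr /=; congr (_ + _).
by rewrite mulrA mulVf ?mul1r// normr_eq0.
Qed.

Lemma cls_exp D s g (k : nat) : cls D s g -> cls D (s * k%:Z) (fun u => g u ^+ k).
Proof.
move=> c; elim: k => [|k IHk]; first by rewrite mulr0; exact: cls_cst.
have -> : s * k.+1%:Z = s + s * k%:Z by lia.
apply: (@cls_ext _ _ _ _ 1 _ _ (cls_mul c IHk)) => // x y *.
by rewrite exprS.
Qed.

Lemma cls_monomial D (i j : nat) : cls D (i + j)%:Z (fun u => u.1 ^+ i * u.2 ^+ j).
Proof.
have := cls_mul (cls_exp i (@cls_coord1 D)) (cls_exp j (@cls_coord2 D)).
by rewrite !mul1r -PoszD.
Qed.

(** The degree is written [s + s] so that halving it stays within the integers; the lower bound is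
    the scaled form of the one in [jets_invsqrt]. *)
Lemma cls_invsqrt D s g (c0 : R) : (0 < M)%N -> 0 < c0 ->
  (forall x, D x -> x != 0 -> c0 * `|x| ^ (s + s) <= g x) ->
  cls D (s + s) g -> cls D (- s) (fun u => (Num.sqrt (g u))^-1).
Proof.
move=> M0 c00 h c.
have hp x : (D `\ 0) x -> c0 <= `|x| ^ (- (s + s)) * g (x + `|x| *: 0).
  move=> [Dx /eqP x0]; rewrite scaler0 addr0 -invr_expz.
  by rewrite ler_pdivlMl ?exprz_gt0 ?normr_gt0// mulrC h.
apply: (@jets_ext _ _ _ _ _ _ 1 _ _ (jets_invsqrt M0 c00 hp c)) => // x z [Dx /eqP x0] _.
have nx : `|x| ^ (- (s + s)) = (`|x| ^ (- s)) ^+ 2.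
  by rewrite opprD expfzDr ?normr_eq0.
have nx0 : 0 < `|x| ^ (- s) by rewrite exprz_gt0 ?normr_gt0.
rewrite nx sqrtrM ?sqr_ge0// sqrtr_sqr ger0_norm ?ltW// invfM; congr (_ * _).
by rewrite invr_expz.
Qed.

Lemma cls_down D s t g (b : R) : (forall x, D x -> `|x| <= b) -> t <= s -> cls D s g -> cls D t g.
Proof.
move=> Db ts c.
have j : jets M (D `\ 0) (fun x _ => `|x| ^ (s - t)).
  apply: (@jets_cst _ _ _ _ _ (b ^ (s - t))) => x [Dx _].
  have -> : s - t = `|s - t|%N%:Z by lia.
  by rewrite -!exprnP ger0_norm ?exprn_ge0// lerXn2r ?nnegrE ?Db// (le_trans _ (Db _ Dx)).
apply: (@jets_ext _ _ _ _ _ _ 1 _ _ (jets_mul j c)) => // x z [_ /eqP x0] _.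
by rewrite mulrA -expfzDr ?normr_eq0//; congr (_ ^ _ * _); lia.
Qed.

(** On an annulus every power of [|x|] is bounded above and below, so the degree may be changed at
    will. *)
Lemma cls_far D s t g (b d : R) : 0 < d -> (forall x, D x -> d <= `|x| <= b) -> cls D s g -> cls D t g.
Proof.
move=> d0 Db c.
have j : jets M (D `\ 0) (fun x _ => `|x| ^ (s - t)).
  apply: (@jets_cst _ _ _ _ _ (b ^+ `|s - t|%N + d^-1 ^+ `|s - t|%N)) => x [Dx _].
  have /andP[dx xb] := Db _ Dx.
  have x0 : 0 < `|x| by exact: lt_le_trans dx.
  have b0 : 0 < b by exact: lt_le_trans xb.
  rewrite ger0_norm ?exprz_ge0//; have [st|st] := leP 0 (s - t).
    have -> : s - t = `|s - t|%N%:Z by lia.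
    rewrite -exprnP absz_nat (@le_trans _ _ (b ^+ `|s - t|))//.
      by rewrite lerXn2r ?nnegrE// ltW.
    by rewrite lerDl exprn_ge0// invr_ge0 ltW.
  have {1}-> : s - t = - `|s - t|%N%:Z by lia.
  rewrite -exprnN exprVn (@le_trans _ _ (d ^- `|s - t|))//.
    by rewrite lef_pV2 ?posrE ?exprn_gt0//; apply: lerXn2r; rewrite ?nnegrE// ltW.
  by rewrite lerDr exprn_ge0// ltW.
apply: (@jets_ext _ _ _ _ _ _ 1 _ _ (jets_mul j c)) => // x z [_ /eqP x0] _.
by rewrite mulrA -expfzDr ?normr_eq0//; congr (_ ^ _ * _); lia.
Qed.

Lemma cls_bound D s g : cls D s g -> exists2 C : R, 0 <= C & forall x, D x -> x != 0 -> `|g x| <= C * `|x| ^ s.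
Proof.
move=> /jets_bounded[C [e [C0 /andP[e0 _] H]]]; exists C => // x Dx x0.
have e00 : `|0 : R * R| <= e by rewrite normr0 ltW.
have := H x 0 (conj Dx (elimN eqP x0)) e00; rewrite scaler0 addr0 normrM.
have nx0 : 0 < `|x| ^ (- s) by rewrite exprz_gt0 ?normr_gt0.
by rewrite (ger0_norm (ltW nx0)) mulrC -ler_pdivlMr// -invr_expz invrK.
Qed.

(** Expand at [x = h *: pt p]: a displacement [y] with [|y| <= M] in lattice units is
    [z = y / |pt p|] in the scale of [x]. The error of the expansion is then of order
    [|x| ^ s * (M / |pt p|) ^ M], uniformly in [h]. *)
Lemma cls_lerr D s g : cls D s g -> (0 < M)%N -> exists (C : R) (n0 : nat), [/\ 0 <= C, (0 < n0)%N &
  forall (h : R) p, 0 < h -> n0%:R <= `|pt p : R * R| -> D (h *: pt p) ->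
    area.-integrable (cell p) (EFin \o (fun u => g (h *: u))) ->
    `|lerr M (fun u => g (h *: u)) p| <= C * (h ^ s * `|pt p : R * R| ^ (s - M%:Z))].
Proof.
move=> [C [e [c [C0 /andP[e0 e1] H]]]] M0.
(* From this distance on, all nodes of the rule at [p] lie within the radius [e] of the expansion at
   [x]. *)
exists (C * M%:R ^+ M * (1 + cweight1 M)), (Num.bound (M%:R / e)).+1; split => //.
  by rewrite mulr_ge0 ?addr_ge0// ?mulr_ge0 ?exprn_ge0//; do 2 (apply: sumr_ge0 => ? _).
move=> h p h0 pn Dp ip.
have p0 : 0 < `|pt p : R * R| by apply: lt_le_trans pn; rewrite ltr0n.
have x0 : h *: pt p != 0 :> R * R by rewrite scaler_eq0 negb_or gt_eqF//= -normr_gt0.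
have [cC Hc] := H _ (conj Dp (elimN eqP x0)).
set x : R * R := h *: pt p in x0 Hc cC Dp.
have nx : `|x| = h * `|pt p : R * R| by rewrite normrZ gtr0_norm.
have xs0 : 0 < `|x| ^ s by rewrite exprz_gt0 ?normr_gt0.
have Me : M%:R / `|pt p : R * R| <= e.
  rewrite ler_pdivrMr// mulrC -ler_pdivrMr//; apply: le_trans pn.
  have Me0 : 0 <= M%:R / e by rewrite divr_ge0// ltW.
  by apply: (le_trans (ltW (archi_boundP Me0))); rewrite ler_nat.
have := @lerr_bound _ M (fun u => g (h *: u)) p
  (fun i j => `|x| ^ s * c x i j * `|pt p : R * R| ^- (i + j))
  (`|x| ^ s * C * (M%:R / `|pt p : R * R|) ^+ M) M0 ip.
have -> : `|x| ^ s * C * (M%:R / `|pt p : R * R|) ^+ M * (1 + cweight1 M) =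
  C * M%:R ^+ M * (1 + cweight1 M) * (h ^ s * `|pt p : R * R| ^ (s - M%:Z)).
  rewrite nx expfzMl expfzDr ?gt_eqF// expr_div_n exprnN; ring.
apply => y yM.
pose z : R * R := `|pt p : R * R|^-1 *: y.
have ze : `|z| <= e.
  rewrite normrZ normfV normr_id mulrC; apply: le_trans Me.
  by rewrite ler_wpM2r// invr_ge0 ltW.
have xz : h *: (pt p + y) = x + `|x| *: z.
  by rewrite scalerDr /z scalerA nx mulfK ?gt_eqF.
have -> : pv M (fun i j => `|x| ^ s * c x i j * `|pt p : R * R| ^- (i + j)) y = `|x| ^ s * pv M (c x) z.
  rewrite /pv mulr_sumr; apply: eq_bigr => i _; rewrite mulr_sumr; apply: eq_bigr => j _.
  have -> : z.1 = `|pt p : R * R|^-1 * y.1 by [].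
  have -> : z.2 = `|pt p : R * R|^-1 * y.2 by [].
  rewrite -exprVn exprD; set q := _^-1; rewrite !exprMn; ring.
have := Hc z ze; rewrite -xz => hz.
have -> : g (h *: (pt p + y)) = `|x| ^ s * (`|x| ^ (- s) * g (h *: (pt p + y))).
  by rewrite mulrA -expfzDr ?normr_eq0// subrr expr0z mul1r.
rewrite -mulrBr normrM gtr0_norm// -mulrA ler_wpM2l// ?(ltW xs0)//.
apply: (le_trans hz); rewrite ler_wpM2l//; apply: lerXn2r; rewrite ?nnegrE ?divr_ge0//.
by rewrite normrZ normfV normr_id mulrC ler_wpM2r// invr_ge0.
Qed.

End SingularClass.

(** * Taylor expansions *)

Section Taylor.
Context {R : realType}.

Lemma mean_value_le (f df : R -> R) (x y B : R) :
  (forall t, `|t - x| <= `|y| -> is_derive t 1 f (df t)) ->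
  (forall t, `|t - x| <= `|y| -> `|df t| <= B) ->
  `|f (x + y) - f x| <= B * `|y|.
Proof.
move=> hf hB.
have [->|y0] := eqVneq y 0; first by rewrite addr0 subrr !normr0 mulr0.
have cf t : `|t - x| <= `|y| -> {for t, continuous f}.
  move=> /hf h; apply/differentiable_continuous/derivable1_diffP; exact: ex_derive.
have key (a b : R) : a < b -> (forall t, a <= t <= b -> `|t - x| <= `|y|) -> `|f b - f a| <= B * (b - a).
  move=> ab hab.
  have [||c cab ->] := @MVT R f df a b ab.
  - by move=> t; rewrite in_itv/= => /andP[? ?]; apply: hf; apply: hab; rewrite !ltW.
  - apply: continuous_in_subspaceT => t; rewrite inE/= in_itv/= => tab; exact/cf/hab.
  rewrite normrM [X in _ * X]gtr0_norm ?subr_gt0// ler_wpM2r ?subr_ge0 ?(ltW ab)//.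
  by apply: hB; apply: hab; move: cab; rewrite in_itv/= => /andP[? ?]; rewrite !ltW.
have [ypos|yneg] := ltP 0 y.
  rewrite (gtr0_norm ypos); have -> : B * y = B * (x + y - x) by rewrite addrC addKr.
  apply: key; first by rewrite ltrDl.
  by move=> t /andP[? ?]; rewrite ler_norml gtr0_norm//; apply/andP; split; lra.
have {}yneg : y < 0 by rewrite lt_neqAle y0.
rewrite (ltr0_norm yneg) distrC; have -> : B * - y = B * (x - (x + y)) by congr (_ * _); lra.
apply: key; first by rewrite gtrDl.
by move=> t /andP[? ?]; rewrite ler_norml ltr0_norm//; apply/andP; split; lra.
Qed.

Lemma is_derive_taylor_sum (c : nat -> R) (x t : R) (n : nat) :
  is_derive t 1 (fun t => \sum_(k < n.+1) c k * (t - x) ^+ k / k`!%:R)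
    (\sum_(k < n) c k.+1 * (t - x) ^+ k / k`!%:R).
Proof.
elim: n => [|n IHn].
  rewrite big_ord0 [X in is_derive _ _ X _](_ : _ = cst (c 0%N)); first exact: is_derive_cst.
  by apply/funext => u; rewrite big_ord1 expr0 fact0 mulr1 divr1.
rewrite big_ord_recr/=.
have := is_deriveX n.+1 (is_derive_shift t 1 (- x)).
move=> /(is_deriveZ (c n.+1 / n.+1`!%:R)) /(is_deriveD IHn) h.
rewrite [X in is_derive _ _ X _](_ : _ =
  (fun t => \sum_(k < n.+1) c k * (t - x) ^+ k / k`!%:R) + (c n.+1 / n.+1`!%:R) \*: shift (- x) ^+ n.+1).
  apply: (is_derive_eq h); congr (_ + _).
  rewrite /= factS natrM /GRing.scale/= mulr1.
  have n0 : (1 + n%:R : R) != 0 by rewrite nat1r pnatr_eq0.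
  have f0 : (n`!%:R : R) != 0 by rewrite pnatr_eq0 -lt0n fact_gt0.
  by field; rewrite n0 f0.
apply/funext => u; rewrite big_ord_recr/=; congr (_ + _).
rewrite /GRing.scale/= mulrAC; congr (_ * _).
by elim: n.+1 => [|m IHm]; rewrite ?expr0// !exprS IHm.
Qed.

(** [phi k] plays the role of the [k]-th derivative. The remainder has as derivative the remainder
    of [phi 1] of one order less, so the mean value inequality gives the bound by induction, without
    the factorial. *)
Lemma taylor1 (n : nat) (phi : nat -> R -> R) (x y B : R) :
  (forall k t, (k < n)%N -> `|t - x| <= `|y| -> is_derive t 1 (phi k) (phi k.+1 t)) ->
  (forall t, `|t - x| <= `|y| -> `|phi n t| <= B) ->
  `|phi 0%N (x + y) - \sum_(k < n) phi k x * y ^+ k / k`!%:R| <= B * `|y| ^+ n.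
Proof.
elim: n phi x y => [|n IHn] phi x y hd hB.
  by rewrite big_ord0 subr0 expr0 mulr1 hB// addrC addKr.
pose psi t := phi 0%N t - \sum_(k < n.+1) phi k x * (t - x) ^+ k / k`!%:R.
pose dpsi t := phi 1%N t - \sum_(k < n) phi k.+1 x * (t - x) ^+ k / k`!%:R.
have -> : phi 0%N (x + y) - \sum_(k < n.+1) phi k x * y ^+ k / k`!%:R = psi (x + y) - psi x.
  rewrite /psi; under [in RHS]eq_bigr do rewrite (addrC x) addrK.
  rewrite subrr; rewrite [X in _ = _ - (_ - X)]big_ord_recl/= expr0 fact0 mulr1 divr1.
  rewrite [X in _ = _ - (_ - (_ + X))]big1 ?addr0 ?subrr ?subr0//.
  by move=> i _; rewrite expr0n/= mulr0 mul0r.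
rewrite exprSr mulrA; apply: (@mean_value_le psi dpsi) => t ht.
  exact: (is_deriveB (hd 0%N t isT ht) (is_derive_taylor_sum (fun k => phi k x) x t n)).
have B0 : 0 <= B by apply: (le_trans (normr_ge0 _) (hB x _)); rewrite subrr normr0.
have -> : dpsi t = phi 1%N (x + (t - x)) - \sum_(k < n) phi k.+1 x * (t - x) ^+ k / k`!%:R.
  by rewrite /dpsi (addrC x) subrK.
apply: (@le_trans _ _ (B * `|t - x| ^+ n)).
  apply: (IHn (fun k => phi k.+1)) => [k u kn ux|u ux].
    by apply: hd => //; exact: le_trans ux ht.
  by apply: hB; exact: le_trans ux ht.
by rewrite ler_wpM2l// lerXn2r ?nnegrE.
Qed.

End Taylor.

Section Partials.
Context {R : realType}.
Implicit Types (F : R * R -> R) (x : R * R).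

Lemma is_derive_partial_u F (a b : R) : derivable F (a, b) ((1 : R), (0 : R)) ->
  is_derive a 1 (fun t => F (t, b)) (partial_u F (a, b)).
Proof.
move=> dF.
have E : (fun h : R => h^-1 *: ((F \o shift (a, b)) (h *: ((1 : R), (0 : R))) - F (a, b))) =
   (fun h : R => h^-1 *: (((fun t => F (t, b)) \o shift a) (h *: (1 : R)) - (fun t => F (t, b)) a)).
  apply/funext => h /=; congr (_ *: (F _ - _)).
  by rewrite [LHS]surjective_pairing /= scaler0 add0r.
split; first by rewrite /derivable -E.
by rewrite /derive -E.
Qed.

Lemma is_derive_partial_v F (a b : R) : derivable F (a, b) ((0 : R), (1 : R)) ->
  is_derive b 1 (fun t => F (a, t)) (partial_v F (a, b)).
Proof.
move=> dF.
have E : (fun h : R => h^-1 *: ((F \o shift (a, b)) (h *: ((0 : R), (1 : R))) - F (a, b))) =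
   (fun h : R => h^-1 *: (((fun t => F (a, t)) \o shift b) (h *: (1 : R)) - (fun t => F (a, t)) b)).
  apply/funext => h /=; congr (_ *: (F _ - _)).
  by rewrite [LHS]surjective_pairing /= scaler0 add0r.
split; first by rewrite /derivable -E.
by rewrite /derive -E.
Qed.

Implicit Types (U : set (R * R)).

Lemma Cn_on_le (n m : nat) U F : (n <= m)%N -> Cn_on m U F -> Cn_on n U F.
Proof.
elim: n m F => [|n IHn] [|m] F //= nm [cF]; first by [].
by move=> [dF u v]; split; [by []|split; [by []|exact: (IHn _ _ nm)..]].
Qed.

Lemma smooth_on_partial U F (i j : nat) : smooth_on U F ->
  smooth_on U (iter i partial_u (iter j partial_v F)).
Proof.
have pu G : smooth_on U G -> smooth_on U (partial_u G).
  by move=> sG n; have [_ []] := sG n.+1.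
have pv' G : smooth_on U G -> smooth_on U (partial_v G).
  by move=> sG n; have [_ []] := sG n.+1.
move=> sF; elim: i => [|i IHi] /=; last exact: pu.
by elim: j => [|j IHj] //=; exact: pv'.
Qed.

Definition tcoef F x (i j : nat) : R :=
  iter i partial_u (iter j partial_v F) x / (i`! * j`!)%:R.

Lemma maxball_compact (b : R) : compact [set u : R * R | `|u| <= b].
Proof.
have -> : [set u : R * R | `|u| <= b] = `[- b, b]%classic `*` `[- b, b]%classic.
  exact: maxballE.
by apply: compact_setX; exact: segment_compact.
Qed.

Lemma continuous_maxball_bounded F (b : R) : (forall x, `|x| <= b -> {for x, continuous F}) ->
  exists2 B : R, 0 <= B & forall x, `|x| <= b -> `|F x| <= B.
Proof.
move=> cF.
have : compact (F @` [set u : R * R | `|u| <= b]).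
  apply: continuous_compact; last exact: maxball_compact.
  by apply: continuous_in_subspaceT => x; rewrite inE/= => /cF.
move=> /compact_bounded[B [_ hB]]; exists (`|B| + 1); first by rewrite addr_ge0.
by move=> x xb; apply: (hB (`|B| + 1)); [rewrite ltr_pwDr// ler_norm|exists x].
Qed.

(** Taylor's formula is applied in [v], then in [u] to each coefficient, which produces a truncation
    by the degree in each variable separately. This order matches the order of differentiation in
    [tcoef], so mixed partial derivatives never have to be exchanged. *)
Lemma smooth_taylor U F (M : nat) (a : R) : smooth_on U F ->
  [set u : R * R | `|u| <= a] `<=` U -> exists2 B : R, 0 <= B &
  forall x z, `|x| + `|z| <= a -> `|z| <= 1 ->
    (forall i j, (i < M)%N -> (j < M)%N -> `|tcoef F x i j| <= B) /\
    `|F (x + z) - pv M (tcoef F x) z| <= B * `|z| ^+ M.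
Proof.
move=> sF aU.
pose G i j := iter i partial_u (iter j partial_v F).
have [B B0 hB] : exists2 B : R, 0 <= B & forall i j, (i <= M)%N -> (j <= M)%N ->
    forall x, `|x| <= a -> `|G i j x| <= B.
  have h i j := @continuous_maxball_bounded (G i j) a (fun x xa =>
     proj1 (smooth_on_partial i j sF 0) x (aU x xa)).
  have [b hb] : {b : nat -> nat -> R | forall i j, 0 <= b i j /\ forall x, `|x| <= a -> `|G i j x| <= b i j}.
    have h' ij : {b : R | 0 <= b /\ forall x, `|x| <= a -> `|G ij.1 ij.2 x| <= b}.
      by apply: cid; have [b b0 hb] := h ij.1 ij.2; exists b.
    by exists (fun i j => sval (h' (i, j))) => i j; exact: (svalP (h' (i, j))).
  exists (\sum_(i < M.+1) \sum_(j < M.+1) b i j).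
    by do 2 (apply: sumr_ge0 => ? _); exact: (hb _ _).1.
  move=> i j iM jM x xa; apply: (le_trans ((hb i j).2 x xa)).
  rewrite -ltnS in iM; rewrite -ltnS in jM.
  rewrite (bigD1 (Ordinal iM))//= (bigD1 (Ordinal jM))//= -addrA lerDl addr_ge0//.
    by apply: sumr_ge0 => ? _; exact: (hb _ _).1.
  by do 2 (apply: sumr_ge0 => ? _); exact: (hb _ _).1.
have Ba : B <= B * (1 + M%:R) by rewrite ler_peMr// lerDl.
exists (B * (1 + M%:R)); first by rewrite mulr_ge0// addr_ge0.
have fge i : 1 <= (i`!%:R : R) by rewrite ler1n fact_gt0.
move=> [x1 x2] [z1 z2] xza z1le.
have xa : `|(x1, x2)| <= a by apply: le_trans xza; rewrite lerDl.
split=> [i j iM jM|].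
  apply: (@le_trans _ _ B) => //.
  rewrite /tcoef normrM; apply: (@le_trans _ _ (B * 1)); last by rewrite mulr1.
  rewrite ler_pM//; first by apply: hB => //; exact: ltnW.
  by rewrite normfV ger0_norm// invf_le1 ?ltr0n ?muln_gt0 ?fact_gt0// ler1n muln_gt0 !fact_gt0.
have dG i j x : `|x| <= a -> derivable (G i j) x ((1 : R), (0 : R)) /\ derivable (G i j) x ((0 : R), (1 : R)).
  by move=> /aU Ux; have [_ [/(_ x Ux)]] := smooth_on_partial i j sF 1.
have inball (s t : R) : `|s - x1| <= `|z1| -> `|t - x2| <= `|z2| -> `|(s, t)| <= a.
  move=> hs ht; apply: le_trans xza; rewrite !prod_normE/= ge_max; apply/andP; split.
    rewrite -(subrK x1 s) addrC (le_trans (ler_normD _ _))// lerD// ?le_max ?lexx//.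
    by rewrite hs.
  rewrite -(subrK x2 t) addrC (le_trans (ler_normD _ _))// lerD// ?le_max ?lexx ?orbT//.
  by rewrite ht orbT.
have sub0 (s t : R) : `|s - s| <= `|t| by rewrite subrr normr0.
have z1s : `|x1 + z1 - x1| <= `|z1| by rewrite addrC addKr.
have Tv : `|F (x1 + z1, x2 + z2) - \sum_(j < M) G 0%N j (x1 + z1, x2) * z2 ^+ j / j`!%:R| <= B * `|z2| ^+ M.
  apply: (@taylor1 _ M (fun j t => G 0%N j (x1 + z1, t))) => [j t jM ht|t ht].
    exact: is_derive_partial_v (dG 0%N j _ (inball _ _ z1s ht)).2.
  by apply: hB => //; exact: inball.
have Tu (j : 'I_M) : `|G 0%N j (x1 + z1, x2) - \sum_(i < M) G i j (x1, x2) * z1 ^+ i / i`!%:R| <= B * `|z1| ^+ M.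
  apply: (@taylor1 _ M (fun i t => G i j (t, x2))) => [i t iM ht|t ht].
    exact: is_derive_partial_u (dG i j _ (inball _ _ ht (sub0 _ _))).1.
  by apply: hB => //; [exact: ltnW|exact: inball].
have nz1 : `|z1| <= `|(z1, z2)| by rewrite prod_normE le_max lexx.
have nz2 : `|z2| <= `|(z1, z2)| by rewrite prod_normE le_max lexx orbT.
have -> : F ((x1, x2) + (z1, z2)) - pv M (tcoef F (x1, x2)) (z1, z2) =
  (F (x1 + z1, x2 + z2) - \sum_(j < M) G 0%N j (x1 + z1, x2) * z2 ^+ j / j`!%:R) +
  \sum_(j < M) (G 0%N j (x1 + z1, x2) - \sum_(i < M) G i j (x1, x2) * z1 ^+ i / i`!%:R) * (z2 ^+ j / j`!%:R).
  set A := \sum_(j < M) _ * _ ^+ _ / _; rewrite -addrA; congr (_ + _).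
  have -> : pv M (tcoef F (x1, x2)) (z1, z2) =
      \sum_(j < M) (\sum_(i < M) G i j (x1, x2) * z1 ^+ i / i`!%:R) * (z2 ^+ j / j`!%:R).
    rewrite /pv exchange_big/=; apply: eq_bigr => j _.
    rewrite mulr_suml; apply: eq_bigr => i _; rewrite /tcoef /G natrM invfM.
    by ring.
  have -> : A = \sum_(j < M) G 0%N j (x1 + z1, x2) * (z2 ^+ j / j`!%:R).
    by apply: eq_bigr => j _; rewrite mulrA.
  apply/eqP; rewrite addrC -subr_eq opprK addrC -sumrB; apply/eqP.
  by apply: eq_bigr => j _; rewrite mulrBl.
rewrite (le_trans (ler_normD _ _))// mulrDr mulr1 [leRHS]mulrDl lerD//.
  by rewrite (le_trans Tv)// ler_wpM2l//; apply: lerXn2r; rewrite ?nnegrE.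
rewrite (le_trans (ler_norm_sum _ _ _))//.
have -> : B * M%:R * `|(z1, z2)| ^+ M = \sum_(j < M) B * `|(z1, z2)| ^+ M.
  by rewrite sumr_const card_ord -mulr_natr; ring.
apply: ler_sum => j _; rewrite normrM -[leRHS]mulr1 ler_pM//.
  by rewrite (le_trans (Tu j))// ler_wpM2l//; apply: lerXn2r; rewrite ?nnegrE.
rewrite normrM normrX normfV (@ger0_norm _ j`!%:R)// mulr_ile1 ?exprn_ge0 ?invr_ge0//.
  by rewrite exprn_ile1// (le_trans nz2).
by rewrite invf_le1 ?(lt_le_trans _ (fge j)).
Qed.

End Partials.

Section SmoothClass.
Context {R : realType}.
Variable M : nat.
Implicit Types (F : R * R -> R) (x y z : R * R) (D U : set (R * R)).

Lemma eq_pv (c c' : nat -> nat -> R) z : (forall i j, (i < M)%N -> (j < M)%N -> c i j = c' i j) ->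
  pv M c z = pv M c' z.
Proof. by move=> h; apply: eq_bigr => i _; apply: eq_bigr => j _; rewrite h. Qed.

Lemma smooth_jets U F (a b : R) : smooth_on U F -> [set u : R * R | `|u| <= a] `<=` U -> b < a ->
  jets M [set u : R * R | `|u| <= b] (fun x z => F (x + z)).
Proof.
move=> sF aU ba; have [B B0 hB] := smooth_taylor M sF aU.
exists B, (Num.min 1 (a - b)), (fun x i j => if (i < M)%N && (j < M)%N then tcoef F x i j else 0); split => //.
  by rewrite lt_min ltr01 subr_gt0 ba/= ge_min lexx.
have pvE x z : pv M (fun i j => if (i < M)%N && (j < M)%N then tcoef F x i j else 0) z = pv M (tcoef F x) z.
  by apply: eq_pv => i j -> ->.
move=> x /= xb; split=> [i j|z].
  case: ifPn => [/andP[iM jM]|_]; last by rewrite normr0.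
  apply: (hB x 0 _ _).1 => //; rewrite normr0 ?addr0//; exact: le_trans (ltW ba).
rewrite le_min => /andP[z1 zab]; rewrite pvE; apply: (hB x z _ _).2 => //; lra.
Qed.

(* The rescaled polynomial [c x i j * |x| ^ (i + j)] is bounded by a multiple of
   [|x| ^ k] on a grid, hence so are its coefficients. *)
Lemma jets_cls D F (k : nat) (b C e0 : R) : (forall x, D x -> `|x| <= b) -> 0 < e0 -> (k <= M)%N ->
  (0 < M)%N ->
  (forall x y, D x -> x != 0 -> `|y - x| <= e0 * `|x| -> `|F y| <= C * `|y| ^+ k) ->
  jets M D (fun x z => F (x + z)) -> cls M D k%:Z F.
Proof.
move=> Db e00 kM M0 hF [K [e [c [K0 /andP[e10 e1] H]]]].
pose b' := Num.max b 1.
have b'1 : 1 <= b' by rewrite le_max lexx orbT.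
have b'0 : 0 < b' by exact: lt_le_trans b'1.
have Db' x : D x -> `|x| <= b' by move=> /Db; rewrite /b' le_max => ->.
pose e2 := Num.min (Num.min e0 1) (e / b').
have e20 : 0 < e2 by rewrite !lt_min e00 ltr01 divr_gt0.
have [d dE] : exists d : R, d = e2 / M%:R by eexists.
have d0 : 0 < d by rewrite dE divr_gt0// ltr0n.
have C0 x y : D x -> x != 0 -> `|y - x| <= e0 * `|x| -> `|F y| <= `|C| * `|y| ^+ k.
  by move=> Dx x0 /(hF _ _ Dx x0) h; rewrite (le_trans h)// ler_wpM2r ?exprn_ge0// ler_norm.
pose B := `|C| * 2 ^+ k + K * b' ^+ (M - k).
have B0 : 0 <= B by rewrite addr_ge0// mulr_ge0// exprn_ge0// ltW.
pose V := \sum_(i < M) \sum_(j < M) `|@vinv R M i j|.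
have V0 : 0 <= V by do 2 (apply: sumr_ge0 => ? _).
have vV i j : `|@vinv R M i j| <= V.
  rewrite /V (bigD1 i)//= (bigD1 j)//= -addrA lerDl addr_ge0//.
    by apply: sumr_ge0.
  by do 2 (apply: sumr_ge0 => ? _).
pose A := (M%:R * M%:R * (V * V * B)) * (d ^- (M + M) + 1).
pose c' x i j := if (i < M)%N && (j < M)%N then `|x| ^- k * (c x i j * `|x| ^+ (i + j)) else 0.
(* Substituting [|x| *: z] multiplies the remainder by [|x| ^+ M], of which [|x| ^+ k] is kept and
   the rest is bounded on the bounded set [D]. *)
have scaled x z : D x -> x != 0 -> `|z| <= e2 ->
    `|F (x + `|x| *: z) - pv M (fun i j => c x i j * `|x| ^+ (i + j)) z| <= K * b' ^+ (M - k) * (`|x| ^+ k * `|z| ^+ M).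
  move=> Dx x0 ze2.
  have xze : `| `|x| *: z| <= e.
    rewrite normrZ normr_id (@le_trans _ _ (b' * (e / b')))//; last by rewrite mulrC divfK ?gt_eqF.
    by rewrite ler_pM ?Db'//; move: ze2; rewrite !le_min => /andP[].
  have [_ /(_ _ xze)] := H x Dx.
  have -> : pv M (c x) (`|x| *: z) = pv M (fun i j => c x i j * `|x| ^+ (i + j)) z.
    by apply: eq_bigr => i _; apply: eq_bigr => j _; rewrite /= !exprMn exprD; ring.
  move=> h; apply: (le_trans h); rewrite normrZ normr_id exprMn -!mulrA ler_wpM2l//.
  rewrite mulrA ler_wpM2r ?exprn_ge0// -{1}(subnK kM) exprD ler_wpM2r ?exprn_ge0//.
  by apply: lerXn2r; rewrite ?nnegrE ?Db'// ltW.
have pB x z : D x -> x != 0 -> `|z| <= e2 -> `|pv M (fun i j => c x i j * `|x| ^+ (i + j)) z| <= B * `|x| ^+ k.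
  move=> Dx x0 ze2; have z1 : `|z| <= 1 by move: ze2; rewrite !le_min => /andP[/andP[]].
  have ze0 : `|z| <= e0 by move: ze2; rewrite !le_min => /andP[/andP[]].
  rewrite -[pv _ _ _](subKr (F (x + `|x| *: z))).
  apply: (le_trans (ler_normB _ _)).
    rewrite mulrDl; apply: lerD; last first.
      apply: (le_trans (scaled x z Dx x0 ze2)); rewrite mulrA.
      by rewrite ler_piMr ?exprn_ile1// mulr_ge0 ?exprn_ge0// mulr_ge0 ?exprn_ge0// ltW.
    apply: (le_trans (C0 x _ Dx x0 _)).
      by rewrite addrC addKr normrZ normr_id mulrC ler_wpM2r.
    rewrite -mulrA ler_wpM2l// -exprMn; apply: lerXn2r; rewrite ?nnegrE ?mulr_ge0//.
    rewrite (le_trans (ler_normD _ _))// normrZ normr_id mulr2n mulrDl mul1r lerD//.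
    by rewrite ler_piMr.
have d1 : d <= 1.
  rewrite dE ler_pdivrMr ?ltr0n// mul1r (@le_trans _ _ 1) ?ler1n//.
  by rewrite !ge_min lexx orbT.
have dM0 : 0 <= d ^- (M + M) by rewrite invr_ge0 exprn_ge0// ltW.
have A0 : 0 <= A by rewrite /A mulr_ge0 ?addr_ge0// !mulr_ge0.
have dl (l : 'I_M) : `|d * l%:R| <= e2.
  rewrite ger0_norm ?mulr_ge0 ?(ltW d0)// dE mulrAC ler_pdivrMr ?ltr0n//.
  by rewrite ler_wpM2l ?(ltW e20)// ler_nat ltnW.
have cA x i j : D x -> x != 0 -> `|c' x i j| <= A.
  move=> Dx x0; rewrite /c'; case: ifPn => [/andP[iM jM]|_]; last by rewrite normr0.
  have xk0 : 0 < `|x| ^+ k by rewrite exprn_gt0// normr_gt0.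
  rewrite normrM ger0_norm ?invr_ge0 ?exprn_ge0// ler_pdivrMl//.
  have := pv_coef (fun i j => c x i j * `|x| ^+ (i + j)) d (Ordinal iM) (Ordinal jM).
  rewrite /=; set q := c x i j * _ => hq.
  have dij0 : 0 < d ^+ (i + j) by rewrite exprn_gt0.
  have : `|q| * d ^+ (i + j) <= M%:R * M%:R * (V * V * (B * `|x| ^+ k)).
    rewrite -[d ^+ _](ger0_norm (ltW dij0)) -normrM hq.
    have -> : M%:R * M%:R * (V * V * (B * `|x| ^+ k)) = \sum_(l < M) \sum_(m < M) V * V * (B * `|x| ^+ k).
      by rewrite !sumr_const !card_ord -mulrA !mulr_natl.
    apply: (le_trans (ler_norm_sum _ _ _)); apply: ler_sum => l _.
    apply: (le_trans (ler_norm_sum _ _ _)); apply: ler_sum => m _.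
    rewrite !normrM ler_pM ?mulr_ge0//; first by rewrite ler_pM.
    by apply: pB => //; rewrite prod_normE/= ge_max !dl.
  move=> h; rewrite -(ler_pM2r dij0); apply: (le_trans h).
  rewrite /A (_ : M%:R * M%:R * (V * V * (B * `|x| ^+ k)) = `|x| ^+ k * (M%:R * M%:R * (V * V * B)) * 1); last by ring.
  rewrite mulr1 -[leRHS]mulrA ler_wpM2l ?exprn_ge0// -[leRHS]mulrA ler_peMr//; first by rewrite !mulr_ge0.
  rewrite mulrDl mul1r (@le_trans _ _ (d ^- (M + M) * d ^+ (i + j)))//; last by rewrite lerDl ltW.
  rewrite ler_pdivlMl ?exprn_gt0// mulr1; apply: expr_le_ge1; first by rewrite d1 ltW.
  by rewrite leq_add// ltnW.
exists (A + K * b' ^+ (M - k)), e2, c'; split.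
- by rewrite addr_ge0// mulr_ge0// exprn_ge0// ltW.
- by rewrite e20 !ge_min lexx orbT.
move=> x [Dx /eqP x0]; split=> [i j|z ze2].
  by rewrite (le_trans (cA _ _ _ Dx x0))// lerDl mulr_ge0// exprn_ge0// ltW.
have xk0 : 0 < `|x| ^+ k by rewrite exprn_gt0// normr_gt0.
have -> : pv M (c' x) z = `|x| ^- k * pv M (fun i j => c x i j * `|x| ^+ (i + j)) z.
  rewrite /pv mulr_sumr; apply: eq_bigr => i _; rewrite mulr_sumr; apply: eq_bigr => j _.
  by rewrite /c' !ltn_ord/=; ring.
rewrite -exprnN -mulrBr normrM ger0_norm ?invr_ge0 ?exprn_ge0//.
rewrite ler_pdivrMl//; apply: (le_trans (scaled _ _ Dx x0 ze2)).
rewrite mulrCA ler_wpM2l ?exprn_ge0// ler_wpM2r ?exprn_ge0// lerDr.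
rewrite mulr_ge0 ?addr_ge0 ?invr_ge0 ?exprn_ge0 ?mulr_ge0//; exact: ltW.
Qed.

Lemma smooth_cls U F (a b C : R) (k : nat) : smooth_on U F -> [set u : R * R | `|u| <= a] `<=` U ->
  0 < b < a -> (k <= M)%N -> (0 < M)%N -> (forall y, `|y| <= a -> `|F y| <= C * `|y| ^+ k) ->
  cls M [set u : R * R | `|u| <= b] k%:Z F.
Proof.
move=> sF aU /andP[b0 ba] kM M0 hF.
(* For [|x| <= b] the ball of radius [(a - b) / b * |x|] around [x] stays in the ball of radius
   [a]. *)
apply: (@jets_cls _ F k b C ((a - b) / b)) => //; last exact: (smooth_jets sF aU ba).
  by rewrite divr_gt0// subr_gt0.
move=> x y /= xb x0 yx; apply: hF.
rewrite -(subrK x y) addrC (le_trans (ler_normD _ _))//.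
have : (a - b) / b * `|x| <= a - b.
  by rewrite mulrAC ler_pdivrMr// ler_wpM2l// subr_ge0 ltW.
lra.
Qed.

End SmoothClass.

(** * Stability of smoothness under algebraic operations *)

Section SmoothClosure.
Context {R : realType}.
Implicit Types (U : set (R * R)) (n : nat).

Lemma Cn_on_eq {V : normedModType R} n U (f g : R * R -> V) : open U ->
  (forall x, U x -> f x = g x) -> Cn_on n U f -> Cn_on n U g.
Proof.
move=> oU; elim: n f g => [|n IHn] f g fg /= [cf].
all: have nfg x : U x -> \forall y \near x, f y = g y.
1,3: by move=> Ux; apply: filterS (open_nbhs_nbhs (conj oU Ux)) => y; exact: fg.
all: have cg x : U x -> {for x, continuous g}.
1,3: move=> Ux; rewrite /prop_for /continuous_at -(fg _ Ux).
1,2: by apply: cvg_trans (cf x Ux); apply: near_eq_cvg; apply: filterS (nfg x Ux) => y ->.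
  by [].
move=> [df uf vf]; split=> //; split.
- by move=> x Ux; have [d1 d2] := df x Ux; split; apply: near_eq_derivable (nfg x Ux) _.
- apply: IHn uf => x Ux; exact: near_eq_derive (nfg x Ux).
- apply: IHn vf => x Ux; exact: near_eq_derive (nfg x Ux).
Qed.

Lemma Cn_on_cst n U (k : R) : Cn_on n U (fun=> k).
Proof.
elim: n k => [|n IHn] k /=; split=> //; first by move=> x _; exact: cst_continuous.
- by move=> x _; exact: cst_continuous.
have dk (v : R * R) : 'D_v (fun _ : R * R => k) = (fun=> 0).
  by apply/funext => x; exact: derive_cst.
split; [by move=> x _; split; exact: derivable_cst| |]; rewrite /partial_u /partial_v dk; exact: IHn.
Qed.

Lemma Cn_onD n U (f g : R * R -> R) : open U ->
  Cn_on n U f -> Cn_on n U g -> Cn_on n U (fun x => f x + g x).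
Proof.
move=> oU; elim: n f g => [|n IHn] f g /= [cf] + [cg].
all: have cfg x : U x -> {for x, continuous (fun x => f x + g x)}.
1,3: by move=> Ux; apply: cvgD; [exact: cf|exact: cg].
  by [].
move=> [df uf vf] [dg ug vg]; split; [exact: cfg|split].
- move=> x Ux; have [? ?] := df x Ux; have [? ?] := dg x Ux.
  by split; [exact: (@derivableD _ _ _ f g)|exact: (@derivableD _ _ _ f g)].
- apply: (Cn_on_eq oU _ (IHn _ _ uf ug)) => x Ux.
  by apply/esym/deriveD; [exact: (df x Ux).1|exact: (dg x Ux).1].
- apply: (Cn_on_eq oU _ (IHn _ _ vf vg)) => x Ux.
  by apply/esym/deriveD; [exact: (df x Ux).2|exact: (dg x Ux).2].
Qed.

Lemma Cn_onM n U (f g : R * R -> R) : open U ->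
  Cn_on n U f -> Cn_on n U g -> Cn_on n U (fun x => f x * g x).
Proof.
move=> oU; elim: n f g => [|n IHn] f g hf hg.
  by move: hf hg => /= [cf _] [cg _]; split => // x Ux; apply: cvgM; [exact: cf|exact: cg].
(* Leibniz' rule involves the factors themselves beside their derivatives, so they are needed at the
   lower order too. *)
have hf' := Cn_on_le (leqnSn n) hf; have hg' := Cn_on_le (leqnSn n) hg.
move: hf hg => /= [cf [df uf vf]] [cg [dg ug vg]]; split.
  by move=> x Ux; apply: cvgM; [exact: cf|exact: cg].
have -> : (fun x => f x * g x) = f * g by exact/funext.
split.
- move=> x Ux; have [f1 f2] := df x Ux; have [g1 g2] := dg x Ux.
  by split; [exact: (derivableM f1 g1)|exact: (derivableM f2 g2)].
- apply: (Cn_on_eq oU _ (Cn_onD oU (IHn _ _ hf' ug) (IHn _ _ hg' uf))) => x Ux.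
  by apply/esym/deriveM; [exact: (df x Ux).1|exact: (dg x Ux).1].
- apply: (Cn_on_eq oU _ (Cn_onD oU (IHn _ _ hf' vg) (IHn _ _ hg' vf))) => x Ux.
  by apply/esym/deriveM; [exact: (df x Ux).2|exact: (dg x Ux).2].
Qed.

Lemma smooth_on_eq U (f g : R * R -> R) : open U ->
  (forall x, U x -> f x = g x) -> smooth_on U f -> smooth_on U g.
Proof. by move=> oU fg sf n; exact: Cn_on_eq (sf n). Qed.

Lemma smooth_on_cst U (k : R) : smooth_on U (fun=> k).
Proof. by move=> n; exact: Cn_on_cst. Qed.

Lemma smooth_onD U (f g : R * R -> R) : open U -> smooth_on U f -> smooth_on U g ->
  smooth_on U (fun x => f x + g x).
Proof. by move=> oU sf sg n; exact: Cn_onD. Qed.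

Lemma smooth_onM U (f g : R * R -> R) : open U -> smooth_on U f -> smooth_on U g ->
  smooth_on U (fun x => f x * g x).
Proof. by move=> oU sf sg n; exact: Cn_onM. Qed.

Lemma smooth_onX U (f : R * R -> R) k : open U -> smooth_on U f -> smooth_on U (fun x => f x ^+ k).
Proof.
move=> oU sf; elim: k => [|k IHk]; first exact: smooth_on_cst.
by apply: (smooth_on_eq oU _ (smooth_onM oU sf IHk)) => x _; rewrite exprS.
Qed.

Lemma smooth_on_sum U (I : Type) (s : seq I) (f : I -> R * R -> R) : open U ->
  (forall i, smooth_on U (f i)) -> smooth_on U (fun x => \sum_(i <- s) f i x).
Proof.
move=> oU sf; elim: s => [|i s IHs].
  by apply: (smooth_on_eq oU _ (smooth_on_cst U 0)) => x _; rewrite big_nil.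
by apply: (smooth_on_eq oU _ (smooth_onD oU (sf i) IHs)) => x _; rewrite big_cons.
Qed.

Lemma is_derive_coord (p : R * R -> R) (x v : R * R) :
  (forall h, p (h *: v + x) = h * p v + p x) -> is_derive x v p (p v).
Proof.
move=> hp.
have E : h^-1 *: ((p \o shift x) (h *: v) - p x) @[h --> 0^'] --> p v.
  apply: cvg_near_cst; near=> h; rewrite /= hp addrK /GRing.scale/= mulrA mulVf ?mul1r//.
  by near: h; exact: nbhs_dnbhs_neq.
split; first by apply/cvg_ex; exists (p v).
exact: cvg_lim.
Unshelve. all: by end_near.
Qed.

Lemma smooth_on_coord U (p : R * R -> R) : open U -> continuous p ->
  (forall h v x, p (h *: v + x) = h * p v + p x) -> smooth_on U p.
Proof.
move=> oU cp hp; case=> [|n]; first by split => // x _; exact: cp.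
have d (x v : R * R) : is_derive x v p (p v) by exact: is_derive_coord.
split; [by move=> x _; exact: cp|split].
- by move=> x _; split; exact: ex_derive.
- by apply: (Cn_on_eq oU _ (Cn_on_cst n U (p (1, 0)))) => x _; rewrite /partial_u derive_val.
- by apply: (Cn_on_eq oU _ (Cn_on_cst n U (p (0, 1)))) => x _; rewrite /partial_v derive_val.
Qed.

Lemma smooth_on_fst U : open U -> smooth_on U (fun x : R * R => x.1).
Proof. by move=> oU; apply: smooth_on_coord => // x; exact: cvg_fst. Qed.

Lemma smooth_on_snd U : open U -> smooth_on U (fun x : R * R => x.2).
Proof. by move=> oU; apply: smooth_on_coord => // x; exact: cvg_snd. Qed.

Lemma smooth_on_component U m (r : R * R -> 'rV[R]_m) (k : 'I_m) : open U ->
  smooth_on U r -> smooth_on U (fun x => r x 0 k).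
Proof.
move=> oU sr n; move: (sr n) => {sr}; elim: n r => [|n IHn] r /= [cr].
all: have ck x : U x -> {for x, continuous (fun x => r x 0 k)}.
1,3: move=> Ux; apply: (@continuous_comp _ _ _ r (fun A : 'rV[R]_m => A 0 k)); [exact: cr|exact: coord_continuous].
  by [].
move=> [dr ur vr]; split => //; split.
- by move=> x Ux; have [/derivable_mxP d1 /derivable_mxP d2] := dr x Ux.
- apply: (Cn_on_eq oU _ (IHn _ ur)) => x Ux.
  by rewrite /partial_u derive_mx ?mxE//; exact: (dr x Ux).1.
- apply: (Cn_on_eq oU _ (IHn _ vr)) => x Ux.
  by rewrite /partial_v derive_mx ?mxE//; exact: (dr x Ux).2.
Qed.

End SmoothClosure.

(** * Lattice sums and the operator L *)

Section SingularIntegrable.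
Context {R : realType}.
Implicit Types (F : R * R -> R) (b C : R).

Lemma invnorm_integrable b : 0 < b ->
  area.-integrable (maxball b) (fun u : R * R => (`|u|^-1)%:E).
Proof.
move=> b0.
pose G : R * R -> R := (fun u : plane R => `|u : R * R|^-1) \_ (maxball (1 : R)).
have iG : area.-integrable setT (EFin \o G).
  rewrite /G -restrict_EFin; apply/(integrable_mkcond _ (measurable_maxball _)).
  exact: invnorm_integrable1.
have := integrable_affine2 0 (lt0r_neq0 (divr_gt0 ltr01 b0)) iG.
have -> : EFin \o (G \o affine2 (1 / b) 0) = (fun u : plane R => (b * `|u : R * R|^-1)%:E) \_ (maxball b).
  apply/funext => u; rewrite /G /patch /=.
  have -> : affine2 (1 / b) 0 u = b^-1 *: (u : R * R).
    by rewrite /affine2 /= !addr0 div1r [RHS]surjective_pairing.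
  have E : (b^-1 *: (u : R * R) \in (maxball 1 : set (plane R))) = (u \in maxball b).
    apply/idP/idP; rewrite !inE /maxball /= normrZ gtr0_norm ?invr_gt0// mulrC ler_pdivrMr// mul1r//.
  rewrite E; case: ifP => // _; rewrite normrZ gtr0_norm ?invr_gt0// invfM invrK//.
move=> /(integrable_mkcond _ (measurable_maxball b)).
have mb := measurable_maxball b.
move=> /(integrableZl mb b^-1); congr (area.-integrable _ _); apply/funext => u /=.
by rewrite -EFinM mulKf// gt_eqF.
Qed.

Lemma integrable_singular (A : set (plane R)) F b C : measurable A -> A `<=` maxball b ->
  measurable_fun A F -> (forall u, A u -> `|F u| <= C * `|u|^-1) ->
  area.-integrable A (EFin \o F).
Proof.
move=> mA Ab mF FC.
have iI : area.-integrable A (fun u : R * R => (C * `|u|^-1)%:E).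
  under eq_fun do rewrite EFinM; apply: integrableZl => //.
  have b0 : 0 < Num.max b 1 by rewrite lt_max ltr01 orbT.
  apply: (integrableS (measurable_maxball (Num.max b 1)) mA _ (invnorm_integrable b0)).
  by move=> u /Ab; rewrite /maxball/= => ub; rewrite le_max ub.
apply: (le_integrable mA _ _ iI); first exact/measurable_EFinP.
by move=> u Au /=; rewrite lee_fin (le_trans (FC _ Au))// ler_norm.
Qed.

End SingularIntegrable.

Section BoxSums.
Context {R : realType}.
Implicit Types (p : int * int) (E : int * int -> R).

Lemma norm_pt p : `|pt p : R * R| = (maxnorm p)%:~R.
Proof.
rewrite prod_normE /pt /maxnorm /= -!intr_norm; case: (leP `|p.1| `|p.2|) => h.
  by apply/max_idPr; rewrite ler_int.
by apply/max_idPl; rewrite ler_int ltW.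
Qed.

Lemma norm_pt_ge p : 0 < maxnorm p ->
  (1 + `|p.1|)%:~R <= 2 * `|pt p : R * R| /\ (1 + `|p.2|)%:~R <= 2 * `|pt p : R * R|.
Proof.
have p1 : `|p.1| <= maxnorm p by rewrite le_max lexx.
have p2 : `|p.2| <= maxnorm p by rewrite le_max lexx orbT.
move: p1 p2; rewrite norm_pt (_ : 2 = 2%:~R)// -intrM !ler_int; lia.
Qed.

Lemma sum_inv_sqr (m : nat) : \sum_(i < m.+1) (i.+1%:R ^- 2 : R) <= 2 - m.+1%:R^-1.
Proof.
elim: m => [|m IHm]; first by rewrite big_ord1 expr1n invr1; lra.
rewrite big_ord_recr/= (le_trans (lerD IHm (lexx _)))//.
rewrite -addrA lerD2l -(natr1 m.+1); set t : R := m.+1%:R.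
have t0 : 0 < t by rewrite ltr0n.
rewrite -subr_ge0.
have -> : - (t + 1)^-1 - (- t^-1 + (t + 1) ^- 2) = t^-1 * (t + 1) ^- 2.
  by clearbody t; field; apply/andP; split; lra.
by rewrite mulr_ge0 ?invr_ge0 ?exprn_ge0 ?addr_ge0 ?ltW.
Qed.

Lemma sum_zrange_inv_sqr (m : nat) : \sum_(k <- zrange m) ((1 + `|k|)%:~R ^- 2 : R) <= 4.
Proof.
rewrite /zrange big_map (_ : (2 * m).+1 = m + m.+1)%N; last by lia.
rewrite iotaD big_cat add0n; have [s sE] : exists s, s = iota m m.+1 by eexists.
rewrite -sE /=.
have iotaE k : iota 0 k = index_iota 0 k by rewrite /index_iota subn0.
have h1 : \sum_(i <- s) ((1 + `|i%:Z - m%:Z|)%:~R ^- 2 : R) = \sum_(i < m.+1) (i.+1%:R ^- 2 : R).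
  rewrite sE -[m in iota m]addn0 iotaDl big_map iotaE big_mkord; apply: eq_bigr => i _; congr (_ ^- 2).
  by have -> : 1 + `|(m + i)%N%:Z - m%:Z| = i.+1%:Z by lia.
have h2 : \sum_(i <- iota 0 m) ((1 + `|i%:Z - m%:Z|)%:~R ^- 2 : R) <= \sum_(i < m.+1) (i.+1%:R ^- 2 : R).
  rewrite iotaE big_mkord.
  rewrite (reindex_inj rev_ord_inj)/= big_ord_recl/= -[leLHS]add0r lerD ?invr_ge0 ?exprn_ge0//.
  apply: ler_sum => i _; rewrite le_eqVlt; apply/orP; left; apply/eqP; congr (_ ^- 2).
  by have -> : 1 + `|(m - i.+1)%N%:Z - m%:Z| = (bump 0 i).+1%:Z by rewrite /bump; have := ltn_ord i; lia.
have S2 : \sum_(i < m.+1) (i.+1%:R ^- 2 : R) <= 2.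
  by rewrite (le_trans (sum_inv_sqr m))// gerBl invr_ge0.
by rewrite h1 (_ : 4 = 2 + 2); [rewrite lerD// (le_trans h2)|lra].
Qed.

(** Outside the origin [1 + |i|] and [1 + |j|] are at most [2 |p|], so [|p| ^- 4] is at most 16
    times the product of [(1 + |i|) ^- 2] and [(1 + |j|) ^- 2], whose sum over a box is at most
    [4 * 4]. This explains the 4 in the exponent and the constant 256. *)
Lemma box_tail E (A : R) (q n m : nat) : (0 < n)%N -> (n <= m)%N -> 0 <= A ->
  (forall p, n%:Z < maxnorm p <= m%:Z -> `|E p| <= A * `|pt p : R * R| ^- (q + 4)) ->
  `|\sum_(p <- box m) E p - \sum_(p <- box n) E p| <= 256 * A * n%:R ^- q.
Proof.
move=> n0 nm A0 hE.
have -> : \sum_(p <- box n) E p = \sum_(p <- box m) (if p \in box n then E p else 0).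
  rewrite -big_mkcond/= -[RHS]big_filter; apply: perm_big; apply: uniq_perm; rewrite ?filter_uniq ?box_uniq//.
  by move=> p; rewrite mem_filter !mem_box; lia.
rewrite -sumrB (le_trans (ler_norm_sum _ _ _))//.
apply: (@le_trans _ _ (\sum_(p <- box m) 16 * A * n%:R ^- q * ((1 + `|p.1|)%:~R ^- 2 * (1 + `|p.2|)%:~R ^- 2))).
  rewrite big_seq [leRHS]big_seq; apply: ler_sum => p pm.
  case: ifPn => pn.
    rewrite subrr normr0 !mulr_ge0 ?invr_ge0 ?exprn_ge0 ?ler0z//; lia.
  rewrite subr0; move: pm pn; rewrite !mem_box -ltNge => pm pn.
  apply: (le_trans (hE _ _)); first by rewrite pn.
  have P0 : n%:R <= `|pt p : R * R| by rewrite norm_pt pmulrn ler_int ltW.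
  have n0R : 0 < n%:R :> R by rewrite ltr0n.
  have Pp : 0 < `|pt p : R * R| by exact: lt_le_trans P0.
  rewrite (_ : 16 * A * n%:R ^- q * ((1 + `|p.1|)%:~R ^- 2 * (1 + `|p.2|)%:~R ^- 2) =
    A * (n%:R ^- q * (16 * ((1 + `|p.1|)%:~R ^- 2 * (1 + `|p.2|)%:~R ^- 2)))); last by ring.
  rewrite ler_wpM2l// exprD invfM ler_pM ?invr_ge0 ?exprn_ge0//.
    by rewrite lef_pV2 ?posrE ?exprn_gt0//; apply: lerXn2r; rewrite ?nnegrE// ltW.
  have [f1 f2] := @norm_pt_ge p (le_lt_trans (le0z_nat n) pn).
  have g1 : 0 < (1 + `|p.1|)%:~R :> R by rewrite ltr0z; lia.
  have g2 : 0 < (1 + `|p.2|)%:~R :> R by rewrite ltr0z; lia.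
  rewrite -invfM ler_pdivlMr ?mulr_gt0 ?exprn_gt0// mulrC ler_pdivrMr ?exprn_gt0//.
  have -> : 16 * `|pt p : R * R| ^+ 4 = (2 * `|pt p : R * R|) ^+ 2 * (2 * `|pt p : R * R|) ^+ 2 by ring.
  by rewrite ler_pM ?exprn_ge0 ?(ltW g1) ?(ltW g2)//; apply: lerXn2r; rewrite ?nnegrE ?mulr_ge0// ltW.
rewrite -mulr_sumr.
have -> : \sum_(p <- box m) ((1 + `|p.1|)%:~R ^- 2 * (1 + `|p.2|)%:~R ^- 2 : R) =
  (\sum_(k <- zrange m) (1 + `|k|)%:~R ^- 2) * (\sum_(k <- zrange m) (1 + `|k|)%:~R ^- 2).
  by rewrite /box big_allpairs/= big_distrlr.
have S0 : 0 <= \sum_(k <- zrange m) ((1 + `|k|)%:~R ^- 2 : R).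
  by apply: sumr_ge0 => k _; rewrite invr_ge0 exprn_ge0// ler0z; lia.
have S4 := sum_zrange_inv_sqr m.
have -> : 256 * A * n%:R ^- q = 16 * A * n%:R ^- q * (4 * 4) by ring.
by rewrite ler_wpM2l ?ler_pM// !mulr_ge0// invr_ge0 exprn_ge0.
Qed.

End BoxSums.

(** * Cell errors of homogeneous functions and the value of L *)

Section HomogeneousError.
Context {R : realType}.
Variables (M q : nat).
Hypotheses (M0 : (0 < M)%N) (q0 : (0 < q)%N).
Implicit Types (f g F G eta : R * R -> R) (p : int * int) (h : R) (s d : int) (D : set (R * R)).

Lemma lerrZ (k : R) F p : area.-integrable (cell p) (EFin \o F) ->
  lerr M (fun u => k * F u) p = k * lerr M F p.
Proof.
move=> iF; rewrite /lerr RintegralZl//; last exact: measurable_cell.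
rewrite mulrBr; congr (_ - _); rewrite mulr_sumr; apply: eq_bigr => i _.
by rewrite mulr_sumr; apply: eq_bigr => j _; ring.
Qed.

Lemma lerrB F G p : area.-integrable (cell p) (EFin \o F) -> area.-integrable (cell p) (EFin \o G) ->
  lerr M (fun u => F u - G u) p = lerr M F p - lerr M G p.
Proof.
move=> iF iG; rewrite /lerr RintegralB//; last exact: measurable_cell.
have -> : \sum_(k < M) \sum_(l < M) cweight k l * (F (pt p + (k%:R, l%:R)) - G (pt p + (k%:R, l%:R))) =
  \sum_(k < M) \sum_(l < M) cweight k l * F (pt p + (k%:R, l%:R)) -
  \sum_(k < M) \sum_(l < M) cweight k l * G (pt p + (k%:R, l%:R)).
  by rewrite -sumrB; apply: eq_bigr => i _; rewrite -sumrB; apply: eq_bigr => j _; ring.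
by ring.
Qed.

Definition bsum F n : R := \sum_(p <- box n) lerr M F p.

(** The constants do not depend on [h]. With [h = 1] this is the Cauchy property of the cell errors;
    for small [h] it controls the rescaled integrands. *)
Lemma cls_bsum_tail D s g : cls M D s g -> s + (q + 4)%:Z <= M%:Z ->
  exists (C : R) (n0 : nat), [/\ 0 <= C, (0 < n0)%N &
  forall h n m, 0 < h -> (n0 <= n)%N -> (n <= m)%N ->
    (forall p, n%:Z < maxnorm p <= m%:Z -> D (h *: pt p)) ->
    (forall p, area.-integrable (cell p) (EFin \o (fun u => g (h *: u)))) ->
    `|bsum (fun u => g (h *: u)) m - bsum (fun u => g (h *: u)) n| <= C * h ^ s * n%:R ^- q].
Proof.
move=> cg sM; have [C [n0 [C0 n00 H]]] := cls_lerr cg M0.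
exists (256 * C), n0; split; [exact: mulr_ge0 (ler0n _ _) C0|exact: n00|].
move=> h n m h0 n0n nm hD hi.
have hs0 : 0 < h ^ s by rewrite exprz_gt0.
have -> : 256 * C * h ^ s * n%:R ^- q = 256 * (C * h ^ s) * n%:R ^- q by ring.
apply: box_tail => //; first exact: leq_trans n0n.
  by rewrite mulr_ge0// ltW.
move=> p /andP[np pm].
have n0p : n0%:R <= `|pt p : R * R|.
  by rewrite norm_pt pmulrn ler_int; apply: le_trans (ltW np); rewrite lez_nat.
apply: (le_trans (H h p h0 n0p _ (hi p))); first by apply: hD; rewrite np.
rewrite -mulrA !ler_wpM2l ?(ltW hs0)//.
have p1 : 1 <= `|pt p : R * R| by apply: le_trans n0p; rewrite ler1n.
rewrite exprnN; apply: ler_weXz2l => //; lia.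
Qed.

Lemma sing_integrable d g (b C : R) (A : set (plane R)) : (-1 <= d) -> measurable A -> A `<=` maxball b ->
  measurable_fun (setT : set (plane R)) g -> g 0 = 0 -> (forall u, A u -> u != 0 -> `|g u| <= C * `|u| ^ d) ->
  area.-integrable A (EFin \o g).
Proof.
move=> d1 mA Ab mg g0 gC; pose b' := Num.max b 1.
have b'0 : 0 < b' by rewrite lt_max ltr01 orbT.
apply: (@integrable_singular _ A g b (`|C| * b' ^ (d + 1))) => //; first exact: measurable_funTS.
move=> u Au; have [->|u0] := eqVneq (u : R * R) 0; first by rewrite g0 !normr0 invr0 mulr0.
have nu0 : 0 < `|u : R * R| by rewrite normr_gt0.
apply: (le_trans (gC u Au u0)); rewrite (@le_trans _ _ (`|C| * `|u : R * R| ^ d))//.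
  by rewrite ler_wpM2r ?exprz_ge0// ler_norm.
rewrite -mulrA ler_wpM2l// ler_pdivlMr// -[X in _ * X]expr1z -expfzDr ?gt_eqF//.
have -> : d + 1 = (absz (d + 1))%:Z by lia.
rewrite -!exprnP; apply: lerXn2r; rewrite ?nnegrE ?(ltW b'0)// /b' le_max.
by have := Ab _ Au; rewrite /maxball/= => ->.
Qed.

(** The value 0 at the origin lets a lattice sum that omits the origin be taken over a whole box. *)
Definition homog d f := [/\ cls M setT d f, f 0 = 0, measurable_fun (setT : set (plane R)) f &
  forall (l : R) u, 0 < l -> f (l *: u) = l ^ d * f u].

Lemma maxball_cell p : exists b : R, cell p `<=` maxball b.
Proof.
exists (`|pt p : R * R| + 1) => u /cell_norm uc; rewrite /maxball/=.
rewrite -(subrK (pt p) u) addrC (le_trans (ler_normD _ _))// lerD2l (le_trans uc)//; lra.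
Qed.

Lemma homog_integrable d f (A : set (plane R)) (b : R) : homog d f -> -1 <= d -> measurable A ->
  A `<=` maxball b -> area.-integrable A (EFin \o f).
Proof.
move=> [cf f0 mf _] d1 mA Ab; have [C C0 hC] := cls_bound cf.
by apply: (@sing_integrable d f b C) => // u _ u0; exact: hC.
Qed.

Lemma small_inv_exp (C e : R) (n0 : nat) : 0 <= C -> 0 < e ->
  exists2 n, (n0 <= n)%N & C * n%:R ^- q < e.
Proof.
move=> C0 e0; exists (maxn n0 (Num.bound (C / e)).+1); first by rewrite leq_maxl.
set n := maxn _ _; have n1 : (Num.bound (C / e)).+1%:R <= n%:R :> R by rewrite ler_nat leq_maxr.
have Ce0 : 0 <= C / e by rewrite divr_ge0// ltW.
have nC : C / e < n%:R.
  by apply: lt_le_trans n1; apply: (lt_le_trans (archi_boundP Ce0)); rewrite ler_nat.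
have n1' : 1 <= (n%:R : R) by apply: le_trans n1; rewrite ler1n.
have nq : (n%:R : R) <= n%:R ^+ q by rewrite -[leLHS]expr1 ler_weXn2l.
rewrite ltr_pdivrMr ?exprn_gt0 ?(lt_le_trans _ n1')// mulrC -ltr_pdivrMr//.
exact: lt_le_trans nq.
Qed.

Lemma homog_bsum_lim d f : homog d f -> -1 <= d -> d + (q + 4)%:Z <= M%:Z ->
  exists (L C : R) (n0 : nat), [/\ 0 <= C, (0 < n0)%N &
    forall n, (n0 <= n)%N -> `|bsum f n - L| <= C * n%:R ^- q].
Proof.
move=> hf d1 dM; have [cf f0 mf _] := hf.
have [C [n0 [C0 n00 H]]] := cls_bsum_tail cf dM.
have T n m : (n0 <= n)%N -> (n <= m)%N -> `|bsum f m - bsum f n| <= C * n%:R ^- q.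
  move=> n0n nm; have := H 1 n m ltr01 n0n nm (fun _ _ => I).
  rewrite exp1rz mulr1 (_ : (fun u => f (1 *: u)) = f); last by apply/funext => u; rewrite scale1r.
  apply => p; have [b pb] := maxball_cell p.
  by apply: (homog_integrable hf d1 _ pb); exact: measurable_cell.
have small e : 0 < e -> exists2 n, (n0 <= n)%N & C * n%:R ^- q < e by exact: small_inv_exp.
have cB : cvg (bsum f n @[n --> \oo]).
  apply/cauchy_cvgP/cauchy_exP => e e0; have [n n0n hn] := small e e0.
  exists (bsum f n); exists n => // m /= nm; rewrite -ball_normE/= distrC.
  exact: le_lt_trans (T n m n0n nm) hn.
exists (lim (bsum f n @[n --> \oo])), C, n0; split => // n n0n.
rewrite distrC; set L := lim _.
have cL : (fun m => `|bsum f m - bsum f n|) x @[x --> \oo] --> `|L - bsum f n|.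
  by apply: cvg_norm; apply: cvgB => //; exact: cvg_cst.
rewrite -(cvg_lim (@norm_hausdorff _ _) cL).
apply: limr_le; first by apply/cvg_ex; exists `|L - bsum f n|.
by exists n => // m /= nm; exact: T.
Qed.

Variables (a : R) (eta : R * R -> R).
Hypotheses (a0 : 0 < a) (seta : smooth_on setT eta)
  (suppeta : compactly_supported_in [set u : R * R | `|u| <= a] eta) (eta1 : eta 0 = 1).

Lemma eta_out u : a < `|u| -> eta u = 0.
Proof.
move=> ua; apply/eqP; apply: contraTT ua => eu; rewrite -leNgt.
by apply: suppeta.2; apply: subset_closure.
Qed.

(** Near the origin this is smoothness. For [|x| > 3 a] the ball of radius [|x| / 2] around [x]
    misses the support, so [eta] may be replaced there by the zero function. *)
Lemma eta_cls : cls M setT 0 eta.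
Proof.
have [B B0 hB] := @continuous_maxball_bounded R eta (4 * a) (fun x _ => proj1 (seta 0) x I).
have c1 : cls M [set u : R * R | `|u| <= 3 * a] 0 eta.
  have a34 : 0 < 3 * a < 4 * a by rewrite mulr_gt0//= ltr_pM2r// ltr_nat.
  apply: (@smooth_cls R M setT eta (4 * a) (3 * a) B 0) => //.
  by move=> y ya; rewrite expr0 mulr1 hB.
have c2 : cls M [set u : R * R | 3 * a < `|u|] 0 eta.
  apply: (@cls_ext _ _ _ _ (fun=> 0) _ 2^-1) => //; last exact: cls_cst.
  move=> x y /= xa x0 yx; rewrite eta_out//.
  have := ler_distD y x 0; rewrite !subr0 distrC => h.
  have h2 : `|x| <= 2^-1 * `|x| + `|y| by rewrite (le_trans h)// lerD2r.
  by move: xa h2 a0; set X := `|x|; set Y := `|y|; lra.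
apply: cls_sub (cls_union c1 c2) => u _.
by case: (leP `|u| (3 * a)) => h; [left|right].
Qed.

Lemma measurable_eta : measurable_fun (setT : set (plane R)) eta.
Proof.
apply: continuous_off_origin_measurable => x _; exact: (proj1 (seta 0)).
Qed.

Lemma lattice_ptE h p : lattice_pt h p = h *: (pt p : R * R).
Proof. by rewrite /lattice_pt /pt [RHS]surjective_pairing /= ![h *: _]mulrC. Qed.

Definition cutoff h f u := f u * eta (h *: u).

Lemma measurable_scale_arg h g : measurable_fun (setT : set (plane R)) g ->
  measurable_fun (setT : set (plane R)) (fun u => g (h *: u)).
Proof.
move=> mg; have := measurableT_comp mg (@measurable_affine2 R h 0).
congr (measurable_fun _ _); apply/funext => u /=; congr (g _).
by rewrite /affine2 [RHS]surjective_pairing /= !addr0.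
Qed.

Lemma cutoff_integrable d f h (A : set (plane R)) (b : R) : homog d f -> -1 <= d -> measurable A ->
  A `<=` maxball b -> area.-integrable A (EFin \o cutoff h f).
Proof.
move=> hf d1 mA Ab; have [cf f0 mf _] := hf; have [C C0 hC] := cls_bound cf.
have [B B0 hB] := @continuous_maxball_bounded R eta a (fun x _ => proj1 (seta 0) x I).
apply: (@sing_integrable d _ b (C * B)) => //.
- by apply: measurable_funM => //; apply: measurable_scale_arg; exact: measurable_eta.
- by rewrite /cutoff f0 mul0r.
move=> u _ u0; rewrite /cutoff normrM mulrAC ler_pM// ?hC//.
have [ua|ua] := leP `|h *: (u : R * R)| a; first exact: hB.
by rewrite eta_out// normr0.
Qed.

Lemma cutoff_integrableT d f h : homog d f -> -1 <= d -> 0 < h ->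
  area.-integrable setT (EFin \o cutoff h f).
Proof.
move=> hf d1 h0.
have i1 := cutoff_integrable h hf d1 (measurable_maxball (a / h)) (@subset_refl _ _).
have : area.-integrable setT ((EFin \o cutoff h f) \_ (maxball (a / h))).
  by apply/(integrable_mkcond _ (measurable_maxball _)).
congr (area.-integrable _ _); apply/funext => u; rewrite /patch; case: ifPn => //= ua.
rewrite /cutoff eta_out ?mulr0//; rewrite normrZ gtr0_norm// mulrC -ltr_pdivrMr//.
by rewrite ltNge; apply: contra ua => ua; rewrite inE.
Qed.

Lemma fsum_box (G : int * int -> R) (Q : set (int * int)) n : (forall p, Q p -> maxnorm p <= n%:Z) ->
  (forall p, maxnorm p <= n%:Z -> ~ Q p -> G p = 0) ->
  \sum_(p \in Q) G p = \sum_(p <- box n) G p.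
Proof.
move=> Qn G0; rewrite (fsbig_seq _ _ (box_uniq n)); apply: fsbig_widen.
  by move=> p /Qn pn /=; rewrite mem_box.
by move=> p [/=]; rewrite mem_box => pn Qp; exact: G0.
Qed.

(** For fixed [h] the sequence is eventually constant: once [N] exceeds the radius of the rescaled
    support, neither the sum nor the integral changes, and [sum_lerr] evaluates the difference. *)
Lemma inner_limE d f h n m : homog d f -> -1 <= d -> 0 < h -> a <= n%:R * h -> (n + M < m)%N ->
  lim ((fun N : nat =>
     \sum_(i \in [set i : int * int | i != 0 /\ maxnorm i < N%:Z])
        f (lattice_pt 1 i) * eta (lattice_pt h i)
     - \int[area]_(u in [set u : R * R | (`|u| < N%:R + 2^-1)%R])
        (f u * eta (h *: u))) @ \oo) = - bsum (cutoff h f) m.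
Proof.
move=> hf d1 h0 anh nm; have [cf f0 mf _] := hf.
have F0 u : n%:R < `|u| -> cutoff h f u = 0.
  move=> un; rewrite /cutoff eta_out ?mulr0// normrZ gtr0_norm// mulrC.
  by rewrite (le_lt_trans anh)// ltr_pM2r.
apply: cvg_lim => //; apply: cvg_near_cst; exists n.+1 => // N /= nN.
rewrite /bsum (sum_lerr M0 (cutoff_integrableT hf d1 h0) F0 nm) opprB; congr (_ - _).
  transitivity (\sum_(p <- box N) cutoff h f (pt p)).
    rewrite (@fsum_box _ _ N) => [|p [_ /ltW]//|p pN Qp].
      by apply: eq_bigr => p _; rewrite /cutoff !lattice_ptE scale1r.
    have [->|p0] := eqVneq p 0.
      by rewrite lattice_ptE pt0 scaler0 f0 mul0r.
    have pN' : N%:Z <= maxnorm p by rewrite leNgt; apply/negP => h'; apply: Qp.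
    rewrite eta_out ?mulr0// lattice_ptE normrZ gtr0_norm// (le_lt_trans anh)// mulrC.
    by rewrite ltr_pM2l// norm_pt pmulrn ltr_int; apply: lt_le_trans pN'; rewrite ltz_nat.
  apply: big_uniq_supp; rewrite ?box_uniq// => p Fp; rewrite !mem_box.
  have : ~ (n%:R < `|pt p : R * R|) by move=> /F0 h'; rewrite h' eqxx in Fp.
  move/negP; rewrite -leNgt norm_pt pmulrn ler_int; lia.
rewrite [LHS]Rintegral_mkcond; apply: eq_Rintegral => u _; rewrite /patch.
case: ifPn => //; rewrite notin_setE/= => /negP; rewrite -leNgt => uN.
rewrite F0//; apply: lt_le_trans uN; rewrite ltr_wpDr ?invr_gt0 ?ltr_nat//.
Qed.

Definition lerr_mass f p : R := \int[area]_(u in cell p) `|f u| +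
  \sum_(k < M) \sum_(l < M) `|cweight k l| * `|f (pt p + (k%:R, l%:R))|.

Lemma lerr_mass_ge0 f p : 0 <= lerr_mass f p.
Proof.
rewrite addr_ge0//; first exact: Rintegral_ge0.
by do 2 (apply: sumr_ge0 => ? _); rewrite mulr_ge0.
Qed.

Lemma lerr_le_mass F f p (w : R) : 0 <= w -> area.-integrable (cell p) (EFin \o F) ->
  area.-integrable (cell p) (EFin \o f) ->
  (forall u, `|u - pt p| <= M%:R -> `|F u| <= w * `|f u|) -> `|lerr M F p| <= w * lerr_mass f p.
Proof.
move=> w0 iF if_ Fw; rewrite /lerr /lerr_mass mulrDr (le_trans (ler_normB _ _))// lerD//.
  rewrite (le_trans (le_normr_Rintegral (measurable_cell p) iF))//.
  rewrite -RintegralZl; [|exact: measurable_cell|exact: integrable_norm if_].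
  apply: le_Rintegral; [exact: measurable_cell|exact: integrable_norm iF| |].
    have := integrableZl (measurable_cell p) w (integrable_norm if_).
    by congr (area.-integrable _ _); apply/funext => u /=.
  move=> u /cell_norm uc; apply: Fw; apply: (le_trans uc).
  by apply: (@le_trans _ _ 1); [lra|rewrite ler1n].
rewrite mulr_sumr (le_trans (ler_norm_sum _ _ _))//; apply: ler_sum => i _.
rewrite mulr_sumr (le_trans (ler_norm_sum _ _ _))//; apply: ler_sum => j _.
rewrite normrM mulrCA ler_wpM2l//; apply: Fw; rewrite addrC addKr prod_normE/= ge_max !normr_nat !ler_nat.
by rewrite !(ltnW (ltn_ord _)).
Qed.

(** Exchange of limits. On a fixed box the cutoff tends to 1 and the error sums converge; outside it
    both tails are small, the one with cutoff uniformly in [h]. Hence [Lop eta f] is minus the sum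
    of all cell errors of [f]. *)
Lemma Lop_homog d f : homog d f -> -1 <= d -> d + (q + 4)%:Z <= M%:Z ->
  exists (C : R) (n0 : nat), [/\ 0 <= C, (0 < n0)%N &
    forall n, (n0 <= n)%N -> `|bsum f n + Lop eta f| <= C * n%:R ^- q].
Proof.
move=> hf d1 dM; have [cf f0 mf fh] := hf.
have [L [C1 [n1 [C10 n10 H1]]]] := homog_bsum_lim hf d1 dM.
have cfe : cls M setT d (fun u => f u * eta u).
  by rewrite -[d]addr0; apply: cls_mul => //; exact: eta_cls.
have [C2 [n2 [C20 n20 H2]]] := cls_bsum_tail cfe dM.
suff -> : Lop eta f = - L by exists C1, n1; split => // n nn; rewrite H1.
rewrite /Lop; apply: cvg_lim => //; apply/cvgrPdist_le => e e0.
have [n nn hn] := small_inv_exp (maxn n1 n2) (addr_ge0 C10 C20) (divr_gt0 e0 (ltr0n _ 2)).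
have nn1 : (n1 <= n)%N by rewrite (leq_trans _ nn)// leq_maxl.
have nn2 : (n2 <= n)%N by rewrite (leq_trans _ nn)// leq_maxr.
pose K := \sum_(p <- box n) lerr_mass f p.
have K0 : 0 <= K by apply: sumr_ge0 => p _; exact: lerr_mass_ge0.
(* If [eta] differs from 1 by less than [w] on all points involved, the error sum over [box n]
   changes by at most [w * K <= e / 2]. *)
pose w := e / 2 / (K + 1).
have w0 : 0 < w by rewrite !divr_gt0// ltr_wpDl.
have /(@cvgrPdist_lt _ _ _ _ _) ceta := proj1 (seta 0) 0 I.
have /nbhs_ballP[dl /= dl0 hdl] := ceta w w0.
(* Bounds every point within [M] of a lattice point of [box n], hence all points seen by the rules
   of that box. *)
pose b : R := (n + M + 1)%:R.
have b0 : 0 < b by rewrite ltr0n addn1.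
near=> h.
have h0 : 0 < h by near: h; exact: nbhs_right_gt.
have hb : h < dl / b by near: h; apply: nbhs_right_lt; rewrite divr_gt0.
pose k := (Num.bound (a / h)).+1.
have ak : a <= k%:R * h.
  rewrite -ler_pdivrMr//; have ah0 : 0 <= a / h by rewrite divr_ge0// ltW.
  by apply: (le_trans (ltW (archi_boundP ah0))); rewrite ler_nat.
pose m := maxn n (k + M).+1.
have km : (k + M < m)%N by rewrite leq_maxr.
have nm : (n <= m)%N by rewrite leq_maxl.
rewrite (inner_limE hf d1 h0 ak km) opprK addrC.
have hd0 : 0 < h ^ d by rewrite exprz_gt0.
have scaleF u : cutoff h f u = h ^ (- d) * (f (h *: u) * eta (h *: u)).
  by rewrite fh// -!mulrA mulrCA !mulrA -expfzDr ?gt_eqF// subrr expr0z mul1r.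
have icell h' p : area.-integrable (cell p) (EFin \o cutoff h' f).
  have [b' pb] := maxball_cell p.
  by apply: (cutoff_integrable h' hf d1 _ pb); exact: measurable_cell.
have ifcell p : area.-integrable (cell p) (EFin \o f).
  have [b' pb] := maxball_cell p.
  by apply: (homog_integrable hf d1 _ pb); exact: measurable_cell.
have iscell p : area.-integrable (cell p) (EFin \o (fun u => f (h *: u) * eta (h *: u))).
  have := integrableZl (measurable_cell p) (h ^ d) (icell h p).
  by congr (area.-integrable _ _); apply/funext => u /=; rewrite -EFinM /cutoff fh// mulrA.
have sE j : bsum (cutoff h f) j = h ^ (- d) * bsum (fun u => f (h *: u) * eta (h *: u)) j.
  rewrite /bsum mulr_sumr; apply: eq_bigr => p _; rewrite -lerrZ//.
  by congr (lerr _ _ _); apply/funext => u; rewrite scaleF.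
(* By homogeneity [cutoff h f] is [h ^ (- d)] times the rescaling of [f * eta], and this factor
   cancels the [h ^ d] of the tail bound. *)
have t1 : `|bsum (cutoff h f) m - bsum (cutoff h f) n| <= C2 * n%:R ^- q.
  rewrite !sE -mulrBr normrM gtr0_norm ?exprz_gt0// -invr_expz ler_pdivrMl// mulrA (mulrC (h ^ d)).
  exact: (H2 h n m h0 nn2 nm (fun _ _ => I) iscell).
have t2 : `|bsum (cutoff h f) n - bsum f n| <= e / 2.
  apply: (@le_trans _ _ (w * K)); last first.
    have e2 : 0 <= e / 2 by rewrite ltW// divr_gt0.
    by rewrite /w mulrAC ler_pdivrMr ?ltr_wpDl// ler_wpM2l// lerDl.
  rewrite /bsum -sumrB mulr_sumr (le_trans (ler_norm_sum _ _ _))//.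
  rewrite big_seq [leRHS]big_seq; apply: ler_sum => p; rewrite mem_box => pn.
  rewrite -lerrB//; apply: lerr_le_mass => //; first exact: ltW.
    exact: (integrableB (measurable_cell p) (icell h p) (ifcell p)).
  move=> u up; rewrite /cutoff -{2}[f u]mulr1 -mulrBr normrM mulrC ler_wpM2r//.
  have ub : `|u| <= b.
    rewrite -(subrK (pt p) u) (le_trans (ler_normD _ _))// /b addnAC natrD addrC lerD//.
    by rewrite norm_pt pmulrn ler_int (le_trans pn)// lez_nat leq_addr.
  have := hdl (h *: u); rewrite -ball_normE/= sub0r normrN eta1 distrC => hh.
  apply/ltW/hh; rewrite normrZ gtr0_norm//.
  apply: (@le_lt_trans _ _ (h * b)); first by rewrite ler_wpM2l// ltW.
  by rewrite -ltr_pdivlMr.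
have t3 := H1 n nn1.
move: t1 t2 t3 hn.
set A := bsum (cutoff h f) m; set B := bsum (cutoff h f) n; set E := bsum f n.
have -> : A - L = (A - B) + (B - E) + (E - L) by ring.
set N := _ ^- _; move=> t1 t2 t3 hn.
rewrite (le_trans (ler_normD _ _))// (le_trans (lerD (ler_normD _ _) (lexx _)))//.
rewrite (le_trans (lerD (lerD t1 t2) t3))//.
by move: hn; rewrite mulrDl; lra.
Unshelve. all: by end_near.
Qed.

(** At every [h] the function with cutoff is odd, so both its integral and its sum over a symmetric
    box vanish before any limit is taken. *)
Lemma Lop_odd d f : (forall u, eta u = eta (- u)) -> homog d f -> -1 <= d ->
  (forall u, f (- u) = - f u) -> Lop eta f = 0.
Proof.
move=> evn hf d1 fo; rewrite /Lop; apply: cvg_lim => //; apply: cvg_near_cst.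
near=> h.
have h0 : 0 < h by near: h; exact: nbhs_right_gt.
pose k := (Num.bound (a / h)).+1.
have ak : a <= k%:R * h.
  rewrite -ler_pdivrMr//; have ah0 : 0 <= a / h by rewrite divr_ge0// ltW.
  by apply: (le_trans (ltW (archi_boundP ah0))); rewrite ler_nat.
have km : (k + M < (k + M).+1)%N by [].
have Fo u : cutoff h f (- u) = - cutoff h f u.
  by rewrite /cutoff fo scalerN -evn mulNr.
have F0 u : k%:R < `|u| -> cutoff h f u = 0.
  move=> un; rewrite /cutoff eta_out ?mulr0// normrZ gtr0_norm// mulrC.
  by rewrite (le_lt_trans ak)// ltr_pM2r.
have iF := cutoff_integrableT hf d1 h0.
rewrite (inner_limE hf d1 h0 ak km) /bsum (sum_lerr M0 iF F0 km).
have -> : \int[area]_u cutoff h f u = 0.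
  have N1 : (-1 : R) != 0 by rewrite oppr_eq0 oner_eq0.
  have := Rintegral_affine2 0 N1 iF; rewrite sqrrN expr1n mul1r.
  have -> : (fun u => cutoff h f (affine2 (-1) 0 u)) = (fun u => -1 * cutoff h f u).
    apply/funext => u; rewrite mulN1r -Fo; congr (cutoff h f _).
    by rewrite /affine2 /= !addr0 !mulN1r [RHS]surjective_pairing.
  rewrite RintegralZl// mulN1r => /eqP; rewrite -addr_eq0 -mulr2n mulrn_eq0/= => /eqP.
  by [].
have : \sum_(p <- box (k + M).+1) cutoff h f (pt p) = - \sum_(p <- box (k + M).+1) cutoff h f (pt p).
  rewrite -sumrN; under [RHS]eq_bigr do rewrite -Fo.
  have E p : - pt p = pt (- p) :> R * R by rewrite /pt /= !rmorphN.
  under [RHS]eq_bigr do rewrite E.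
  rewrite -(big_map (fun p => - p) xpredT (fun p => cutoff h f (pt p))).
  have inj : injective (fun p : int * int => - p) by move=> x y /oppr_inj.
  apply: big_uniq_supp; rewrite ?(map_inj_uniq inj) ?box_uniq//.
  move=> p _; apply/idP/mapP => [pb|[p' pb ->]].
    by exists (- p); rewrite ?opprK//; move: pb; rewrite !mem_box /maxnorm /= !normrN.
  by move: pb; rewrite !mem_box /maxnorm /= !normrN.
move/eqP; rewrite -addr_eq0 -mulr2n mulrn_eq0/= => /eqP ->.
by rewrite subrr oppr0.
Unshelve. all: by end_near.
Qed.

End HomogeneousError.

(** * Expansion of the potential *)

Section TaylorRemainder.
Context {R : realType}.
Implicit Types (F : R * R -> R) (U : set (R * R)) (u : R * R).

Lemma taylor_partE F k u : taylor_part F k u =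
  \sum_(i < k.+1) tcoef F 0 i (k - i) * (u.1 ^+ i * u.2 ^+ (k - i)).
Proof. by apply: eq_bigr => i _; rewrite mulrA. Qed.

Lemma taylor_part_homog F k (l : R) u : taylor_part F k (l *: u) = l ^+ k * taylor_part F k u.
Proof.
rewrite !taylor_partE mulr_sumr; apply: eq_bigr => i _.
have ik : (i <= k)%N by rewrite -ltnS.
rewrite /= !exprMn -[in l ^+ k](subnKC ik) exprD; ring.
Qed.

Lemma taylor_part_bound F k : exists2 C : R, 0 <= C & forall u, `|taylor_part F k u| <= C * `|u| ^+ k.
Proof.
exists (\sum_(i < k.+1) `|tcoef F 0 i (k - i)|); first exact: sumr_ge0.
move=> u; rewrite taylor_partE mulr_suml (le_trans (ler_norm_sum _ _ _))//; apply: ler_sum => i _.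
have ik : (i <= k)%N by rewrite -ltnS.
by rewrite normrM ler_wpM2l// (le_trans (norm_mono_le _ _ _))// subnKC.
Qed.

Lemma taylor_part_cls M D F k : cls M D k%:Z (taylor_part F k).
Proof.
apply: (@cls_ext _ _ _ _ (fun u => \sum_(i < k.+1) tcoef F 0 i (k - i) * (u.1 ^+ i * u.2 ^+ (k - i))) _ 1) => //.
  by move=> *; rewrite taylor_partE.
apply: cls_sum => i; apply: cls_scale; have := @cls_monomial R M D i (k - i).
by rewrite subnKC// -ltnS.
Qed.

Lemma big_antidiag n (G : nat -> nat -> R) :
  \sum_(i < n) \sum_(j < n | (i + j < n)%N) G i j = \sum_(k < n) \sum_(i < k.+1) G i (k - i)%N.
Proof.
transitivity (\sum_(i < n) \sum_(k < n | (i <= k)%N) G i (k - i)%N).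
  apply: eq_bigr => i _.
  transitivity (\sum_(0 <= j < n - i) G i j).
    rewrite big_mkord (big_ord_widen n (fun j => G i j) (leq_subr i n)).
    by apply: eq_bigl => j; have := ltn_ord i; lia.
  transitivity (\sum_(i <= k < n) G i (k - i)%N); last by rewrite big_geq_mkord.
  have := @big_addn _ 0 +%R 0 n i xpredT (fun k => G i (k - i)%N); rewrite add0n => ->.
  by apply: eq_bigr => j _; rewrite addnK.
rewrite (exchange_big_dep xpredT)//=; apply: eq_bigr => k _.
rewrite (big_ord_widen n (fun i => G i (k - i)%N) (ltn_ord k)).
by apply: eq_bigl => i; rewrite ltnS.
Qed.

Lemma pv_tcoef F J u : pv J.+1 (tcoef F 0) u =
  \sum_(k < J.+1) taylor_part F k u +
  \sum_(i < J.+1) \sum_(j < J.+1 | (J < i + j)%N) tcoef F 0 i j * (u.1 ^+ i * u.2 ^+ j).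
Proof.
pose G (i j : nat) := tcoef F 0 i j * (u.1 ^+ i * u.2 ^+ j).
have -> : pv J.+1 (tcoef F 0) u = \sum_(i < J.+1) \sum_(j < J.+1) G i j.
  by apply: eq_bigr => i _; apply: eq_bigr => j _; rewrite /G mulrA.
under eq_bigr => i _ do rewrite (bigID (fun j : 'I_J.+1 => (J < i + j)%N))/= addrC.
rewrite big_split/=; congr (_ + _).
under eq_bigr do (under eq_bigl do rewrite -leqNgt -ltnS).
by rewrite big_antidiag; apply: eq_bigr => k _; rewrite taylor_partE.
Qed.

(** For [|u| <= 1] this follows from [smooth_taylor], the surplus monomials having total degree
    above [J]. For [|u| > 1] the function and the Taylor polynomial are bounded, while [|u| ^+ J.+1]
    is at least 1. *)
Lemma smooth_taylor_remainder U F (a : R) J : 0 < a -> smooth_on U F ->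
  [set u : R * R | `|u| <= a] `<=` U ->
  exists2 C : R, 0 <= C & forall u, `|u| <= a ->
    `|F u - \sum_(k < J.+1) taylor_part F k u| <= C * `|u| ^+ J.+1.
Proof.
move=> a0 sF aU; have [B B0 hB] := smooth_taylor J.+1 sF aU.
pose C1 := B + \sum_(i < J.+1) \sum_(j < J.+1) `|tcoef F 0 i j|.
have C10 : 0 <= C1 by rewrite addr_ge0//; do 2 (apply: sumr_ge0 => ? _).
have near1 u : `|u| <= a -> `|u| <= 1 -> `|F u - \sum_(k < J.+1) taylor_part F k u| <= C1 * `|u| ^+ J.+1.
  move=> ua u1; have := (hB 0 u _ u1).2; rewrite normr0 !add0r => /(_ ua) h.
  move: h; rewrite pv_tcoef; set T := \sum_(k < J.+1) taylor_part _ _ _; set Y := \sum_(i < J.+1) _ => h.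
  have -> : F u - T = (F u - (T + Y)) + Y by ring.
  rewrite (le_trans (ler_normD _ _))// mulrDl lerD//.
  rewrite mulr_suml (le_trans (ler_norm_sum _ _ _))//; apply: ler_sum => i _.
  rewrite mulr_suml (le_trans (ler_norm_sum _ _ _))// big_mkcond/=; apply: ler_sum => j _.
  case: ifPn => [ij|_]; last by rewrite mulr_ge0// exprn_ge0.
  by rewrite normrM ler_wpM2l// norm_mono_le_trunc.
have [B2 B20 hB2] := @continuous_maxball_bounded R F a (fun x xa => proj1 (sF 0) x (aU x xa)).
have [c hc] : {c : nat -> R | forall k, 0 <= c k /\ forall u, `|taylor_part F k u| <= c k * `|u| ^+ k}.
  have h k : {c : R | 0 <= c /\ forall u, `|taylor_part F k u| <= c * `|u| ^+ k}.
    by apply: cid; have [c c0 hc] := taylor_part_bound F k; exists c.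
  by exists (fun k => sval (h k)) => k; exact: svalP (h k).
pose C2 := B2 + \sum_(k < J.+1) c k * a ^+ k.
have C20 : 0 <= C2.
  by rewrite addr_ge0//; apply: sumr_ge0 => k _; rewrite mulr_ge0 ?(hc _).1// exprn_ge0// ltW.
have C120 : 0 <= C1 + C2 by exact: addr_ge0.
exists (C1 + C2) => //.
move=> u ua; have [u1|u1] := leP `|u| 1.
  by rewrite (le_trans (near1 u ua u1))// ler_wpM2r ?exprn_ge0// lerDl.
apply: (@le_trans _ _ C2).
  rewrite (le_trans (ler_normB _ _))// lerD ?hB2// (le_trans (ler_norm_sum _ _ _))//.
  apply: ler_sum => k _; rewrite (le_trans ((hc k).2 u))// ler_wpM2l ?(hc _).1//.
  by apply: lerXn2r; rewrite ?nnegrE// ltW.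
rewrite (@le_trans _ _ (C1 + C2))// ?lerDr// ler_peMr//.
by rewrite exprn_ege1// ltW.
Qed.

(** If all lower parts vanish, [t ^+ k] times the part of degree [k] is [O(t ^+ k.+1)] along the ray
    through [u]; let [t] tend to 0. *)
Lemma taylor_part_vanish U F (a C : R) m : 0 < a -> smooth_on U F ->
  [set u : R * R | `|u| <= a] `<=` U -> (forall u, `|u| <= a -> `|F u| <= C * `|u| ^+ m) ->
  forall k u, (k < m)%N -> taylor_part F k u = 0.
Proof.
move=> a0 sF aU hF k; elim/ltn_ind: k => k IHk u km.
have [C1 C10 h1] := smooth_taylor_remainder k a0 sF aU.
apply/eqP; rewrite -normr_le0; apply/ler_addgt0Pl => e e0; rewrite addr0.
pose A := `|C| * `|u| ^+ m + C1 * `|u| ^+ k.+1.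
have A0 : 0 <= A by rewrite addr_ge0// mulr_ge0// exprn_ge0.
(* The three bounds keep powers of [t] decreasing, [t *: u] in the ball of radius [a], and [t * A]
   below [e]. *)
pose t := Num.min (Num.min 1 (a / (`|u| + 1))) (e / (A + 1)).
have t0 : 0 < t by rewrite !lt_min ltr01 !divr_gt0// ltr_wpDl.
have t1 : t <= 1 by rewrite !ge_min lexx.
have tu : `|t *: u| <= a.
  rewrite normrZ gtr0_norm// (@le_trans _ _ (a / (`|u| + 1) * `|u|))//.
    by rewrite ler_wpM2r// !ge_min lexx orbT.
  by rewrite mulrAC ler_pdivrMr ?ltr_wpDl// ler_wpM2l ?lerDl// ltW.
have tA : t * A <= e.
  rewrite (@le_trans _ _ (e / (A + 1) * A))//; first by rewrite ler_wpM2r// ge_min lexx orbT.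
  by rewrite mulrAC ler_pdivrMr ?ltr_wpDl// ler_wpM2l ?lerDl// ltW.
have tk0 : 0 < t ^+ k by rewrite exprn_gt0.
apply: le_trans tA; rewrite -(ler_pM2l tk0) -[X in X * _ <= _](gtr0_norm tk0) -normrM -taylor_part_homog.
have := h1 _ tu; rewrite big_ord_recr/= big1 ?add0r; last by move=> i _; rewrite IHk// (ltn_trans _ km).
move=> h; have hFt := hF _ tu.
rewrite -[taylor_part _ _ _](subKr (F (t *: u))) (le_trans (ler_normB _ _))//.
have -> : t ^+ k * (t * A) = `|C| * (t ^+ k.+1 * `|u| ^+ m) + C1 * (t ^+ k.+1 * `|u| ^+ k.+1).
  have -> : t ^+ k.+1 = t * t ^+ k by exact: exprS.
  have id5 (T x c y d z : R) : T * (x * (c * y + d * z)) = c * (x * T * y) + d * (x * T * z) by ring.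
  exact: id5.
apply: lerD; last by apply: (le_trans h); rewrite normrZ gtr0_norm// exprMn.
apply: (le_trans hFt); apply: (@le_trans _ _ (`|C| * `|t *: u| ^+ m)).
  by rewrite ler_wpM2r ?exprn_ge0// ler_norm.
rewrite normrZ gtr0_norm// exprMn ler_wpM2l// ler_wpM2r ?exprn_ge0//.
by apply: expr_le_ge1 => //; rewrite t1 ltW.
Qed.

Lemma compact_pos (A : set (R * R)) F : compact A -> (forall x, A x -> {for x, continuous F}) ->
  (forall x, A x -> 0 < F x) -> exists2 c : R, 0 < c & forall x, A x -> c <= F x.
Proof.
move=> cA cF F0.
have : compact ((fun x => (F x)^-1) @` A).
  apply: continuous_compact => //; apply: continuous_in_subspaceT => x; rewrite inE/= => Ax.
  by apply: cvgV; [rewrite gt_eqF// F0|exact: cF].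
move=> /compact_bounded[B [_ hB]]; pose b := `|B| + 1.
have b0 : 0 < b by rewrite ltr_wpDl.
exists b^-1; first by rewrite invr_gt0.
move=> x Ax; have := hB b; rewrite ltr_pwDr ?ler_norm// => /(_ isT (F x)^-1) h.
have : `|(F x)^-1| <= b by apply: h; exists x.
rewrite ger0_norm ?invr_ge0 ?(ltW (F0 _ Ax))// => h'.
by rewrite -[leRHS]invrK lef_pV2 ?posrE ?invr_gt0 ?F0.
Qed.

End TaylorRemainder.

(** * Comparison of r^2 with the first fundamental form *)

Section PatchGeometry.
Context {R : realType}.
Variables (a : R) (r : R * R -> 'rV[R]_3) (U : set (R * R)).
Hypotheses (a0 : 0 < a) (oU : open U) (aU : [set u : R * R | `|u| <= a] `<=` U)
  (sr : smooth_on U r) (injr : {in [set u : R * R | `|u| <= a] &, injective r})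
  (indep : row_free (col_mx (partial_u r 0) (partial_v r 0))) (r0 : r 0 = 0).
Implicit Types (u x y z : R * R) (F g : R * R -> R).

Let comp (k : 'I_3) u := r u 0 k.
Let lin (k : 'I_3) u := partial_u r 0 0 k * u.1 + partial_v r 0 0 k * u.2.
Let Q u := first_form r u.
Let r2 u := dot3 (r u) (r u).

Let U0 : U 0. Proof. by apply: aU; rewrite /= normr0 ltW. Qed.
Let scomp k : smooth_on U (comp k). Proof. exact: smooth_on_component. Qed.

Lemma linE k u : taylor_part (comp k) 1 u = lin k u.
Proof.
have [_ [d _ _]] := sr 1; have [du dv] := d 0 U0.
have e1 : partial_u r 0 0 k = partial_u (comp k) 0.
  by have := congr1 (fun A : 'rV[R]_3 => A 0 k) (derive_mx du); rewrite mxE; apply.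
have e2 : partial_v r 0 0 k = partial_v (comp k) 0.
  by have := congr1 (fun A : 'rV[R]_3 => A 0 k) (derive_mx dv); rewrite mxE; apply.
rewrite /taylor_part !big_ord_recl big_ord0/= /lin e1 e2; move: (partial_u (comp k) 0) (partial_v (comp k) 0) => s t.
by rewrite !fact0 !mulr1 !divr1 !addr0 addrC.
Qed.

Lemma first_formE u : first_form r u = \sum_(k < 3) lin k u ^+ 2.
Proof.
rewrite /first_form /lin /=; move: (partial_u r 0) (partial_v r 0) => x y.
rewrite /dot3 !mulr_suml mulr_sumr !mulr_suml -!big_split/=; apply: eq_bigr => k _.
by move: (x 0 k) (y 0 k) => s t; ring.
Qed.

Lemma dist_r_sqr u : dist_r r u ^+ 2 = r2 u.
Proof. by rewrite sqr_sqrtr// sumr_ge0// => k _; rewrite -expr2 sqr_ge0. Qed.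

Lemma lin0 u : (forall k, lin k u = 0) -> u = 0.
Proof.
move: indep; rewrite /lin; move: (partial_u r 0) (partial_v r 0) => x y xy h.
have : row_mx u.1%:M u.2%:M *m col_mx x y = 0 *m col_mx x y.
  rewrite mul_row_col !mul_scalar_mx mul0mx; apply/rowP => k; rewrite !mxE -[RHS](h k).
  by rewrite [u.1 * _]mulrC [u.2 * _]mulrC.
move=> /(row_free_inj xy)/eqP; rewrite row_mx_eq0 => /andP[/eqP h1 /eqP h2].
have e1 := congr1 (fun A : 'M[R]_1 => A 0 0) h1; have e2 := congr1 (fun A : 'M[R]_1 => A 0 0) h2.
by move: e1 e2; rewrite !mxE/= !mulr1n; case: u {h h1 h2} => s t /= -> ->.
Qed.

Lemma smooth_lin V k : open V -> smooth_on V (lin k).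
Proof.
by move=> oV; apply: smooth_onD => //; apply: smooth_onM => //; do ?exact: smooth_on_cst;
  [exact: smooth_on_fst|exact: smooth_on_snd].
Qed.

Lemma smooth_first_form V : open V -> smooth_on V Q.
Proof.
move=> oV; apply: (@smooth_on_eq _ _ (fun u => \sum_(k <- index_enum 'I_3) lin k u ^+ 2)) => //.
  by move=> u _; rewrite -first_formE.
by apply: smooth_on_sum => // k; apply: smooth_onX => //; exact: smooth_lin.
Qed.

Lemma smooth_r2 : smooth_on U r2.
Proof. by apply: smooth_on_sum => // k; apply: smooth_onM => //; exact: scomp. Qed.

Lemma first_form_homog (l : R) u : first_form r (l *: u) = l ^+ 2 * first_form r u.
Proof.
rewrite /first_form; move: (partial_u r 0) (partial_v r 0) => x y; move: (dot3 x x) (dot3 x y) (dot3 y y) => s t w.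
by rewrite -[(l *: u).1]/(l * u.1) -[(l *: u).2]/(l * u.2); ring.
Qed.

(** Linear independence makes the form positive on the compact unit sphere; homogeneity does the
    rest. *)
Lemma first_form_lb : exists2 c : R, 0 < c & forall u, c * `|u| ^+ 2 <= first_form r u.
Proof.
have [||x /= x1|c c0 hc] := @compact_pos R [set u | `|u| = 1] Q.
- apply: (@subclosed_compact _ _ [set u : R * R | `|u| <= 1]); last by move=> u /= ->.
    have -> : [set u : R * R | `|u| = 1] = (fun u : R * R => `|u|) @^-1` [set 1] by [].
    by apply: closed_comp; [move=> x _; exact: norm_continuous|exact: closed_eq].
  exact: maxball_compact.
- by move=> x _; exact: (proj1 (smooth_first_form openT 0) x).
- rewrite /Q first_formE lt_neqAle eq_sym; apply/andP; split; last by apply: sumr_ge0 => k _; exact: sqr_ge0.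
  apply/negP; rewrite psumr_eq0; last by move=> k _; exact: sqr_ge0.
  move=> /allP h; have x0 : x = 0.
    by apply: lin0 => k; have := h k (mem_index_enum k); rewrite /= sqrf_eq0 => /eqP.
  by move: x1; rewrite x0 normr0 => /eqP; rewrite eq_sym oner_eq0.
exists c => // u; have [->|u0] := eqVneq u 0.
  by have := first_form_homog 0 0; rewrite scale0r !expr0n/= !mul0r normr0 expr0n mulr0 => ->.
have n0 : 0 < `|u| by rewrite normr_gt0.
have -> : first_form r u = `|u| ^+ 2 * Q (`|u|^-1 *: u).
  by rewrite /Q -first_form_homog scalerA divff ?scale1r// gt_eqF.
rewrite mulrC ler_wpM2l ?exprn_ge0// hc//= normrZ ger0_norm ?invr_ge0// mulVf//; exact: lt0r_neq0.
Qed.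

Lemma lin_ub : exists2 L : R, 0 <= L & forall k u, `|lin k u| <= L * `|u|.
Proof.
exists (\sum_(k < 3) (`|partial_u r 0 0 k| + `|partial_v r 0 0 k|)).
  by apply: sumr_ge0 => k _; rewrite addr_ge0.
move=> k u; rewrite (le_trans (ler_normD _ _))// !normrM (bigD1 k)//= mulrDl ler_wpDr//.
  by rewrite mulr_ge0//; apply: sumr_ge0 => i _; rewrite addr_ge0.
by rewrite mulrDl lerD// ler_wpM2l// prod_normE le_max lexx ?orbT.
Qed.

Lemma comp_lin : exists2 C : R, 0 <= C & forall k u, `|u| <= a -> `|comp k u - lin k u| <= C * `|u| ^+ 2.
Proof.
have h k : {C : R | 0 <= C /\ forall u, `|u| <= a -> `|comp k u - lin k u| <= C * `|u| ^+ 2}.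
  apply: cid; have [C C0 hC] := smooth_taylor_remainder 1 a0 (scomp k) aU.
  exists C; split=> // u ua; have := hC u ua; rewrite !big_ord_recl big_ord0 /= linE.
  have -> : taylor_part (comp k) 0 u = 0.
    rewrite taylor_partE big_ord_recl big_ord0 /tcoef /=; have -> : comp k 0 = 0 by rewrite /comp r0 mxE.
    by rewrite mul0r mul0r addr0.
  by rewrite add0r addr0.
exists (\sum_k sval (h k)); first by apply: sumr_ge0 => k _; exact: (svalP (h k)).1.
move=> k u ua; apply: le_trans ((svalP (h k)).2 u ua) _; rewrite ler_wpM2r ?exprn_ge0//.
by rewrite (bigD1 k)//= lerDl; apply: sumr_ge0 => i _; exact: (svalP (h i)).1.
Qed.

Lemma r2_first_form : exists2 C : R, 0 <= C & forall u, `|u| <= a -> `|r2 u - Q u| <= C * `|u| ^+ 3.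
Proof.
have [L L0 hL] := lin_ub; have [C C0 hC] := comp_lin.
exists (C * (C * a + 2 * L) *+ 3).
  by rewrite mulrn_wge0// mulr_ge0// addr_ge0// ?mulr_ge0// ltW.
move=> u ua; rewrite /r2 /dot3 /Q first_formE -sumrB (le_trans (ler_norm_sum _ _ _))//.
have -> (X : R) : X *+ 3 * `|u| ^+ 3 = \sum_(k < 3) X * `|u| ^+ 3 by rewrite sumr_const card_ord mulrnAl.
apply: ler_sum => k _.
have -> : r u 0 k * r u 0 k - lin k u ^+ 2 = (comp k u - lin k u) * ((comp k u - lin k u) + 2 * lin k u).
  by rewrite /comp; ring.
rewrite normrM; have -> : C * (C * a + 2 * L) * `|u| ^+ 3 = (C * `|u| ^+ 2) * ((C * a + 2 * L) * `|u|) by ring.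
apply: ler_pM => //; first exact: hC.
apply: (le_trans (ler_normD _ _)); rewrite [leRHS]mulrDl; apply: lerD; last first.
  by rewrite normrM ger0_norm// -mulrA ler_wpM2l.
apply: (le_trans (hC k u ua)); rewrite expr2 mulrA ler_wpM2r// ler_wpM2l//.
Qed.

(** Near the origin the first fundamental form dominates its cubic error; away from it injectivity
    keeps the surface off the origin, and compactness makes this uniform. *)
Lemma r2_lb : exists2 c : R, 0 < c & forall u, `|u| <= a -> c * `|u| ^+ 2 <= r2 u.
Proof.
have [c c0 hc] := first_form_lb; have [C C0 hC] := r2_first_form.
(* Below this radius the cubic error is at most half of the quadratic lower bound. *)
pose d := c / (2 * (C + 1)).
have C1 : 0 < C + 1 by rewrite ltr_wpDl.
have d0 : 0 < d by rewrite divr_gt0// mulr_gt0.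
have [||x /= /andP[x1 x2]|c' c'0 hc'] := @compact_pos R [set u | d <= `|u| <= a] r2.
- apply: (@subclosed_compact _ _ [set u : R * R | `|u| <= a]); last by move=> u /= /andP[].
    have -> : [set u : R * R | d <= `|u| <= a] = (fun u : R * R => `|u|) @^-1` [set` `[d, a]].
      by apply/seteqP; split => x /=; rewrite in_itv.
    by apply: closed_comp; [move=> x _; exact: norm_continuous|exact: itv_closed].
  exact: maxball_compact.
- by move=> x /andP[_ xa]; exact: (proj1 (smooth_r2 0) x (aU xa)).
- rewrite lt_neqAle eq_sym; apply/andP; split; last by apply: sumr_ge0 => k _; rewrite -expr2 sqr_ge0.
  apply/negP; rewrite psumr_eq0; last by move=> k _; rewrite -expr2 sqr_ge0.
  move=> /allP h; have x0 : x = 0.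
    apply: injr; rewrite ?inE/= ?normr0 ?(ltW a0)//; rewrite r0; apply/rowP => k.
    by have := h k (mem_index_enum k); rewrite /= -expr2 sqrf_eq0 mxE => /eqP.
  by move: x1; rewrite x0 normr0 leNgt d0.
exists (Num.min (c / 2) (c' / a ^+ 2)); first by rewrite lt_min !divr_gt0// exprn_gt0.
move=> u ua; have [ud|ud] := leP d `|u|.
  apply: (@le_trans _ _ c'); last by rewrite hc'//= ud.
  rewrite (@le_trans _ _ (c' / a ^+ 2 * `|u| ^+ 2))//.
    by rewrite ler_wpM2r ?exprn_ge0// ge_min lexx orbT.
  rewrite mulrAC ler_pdivrMr ?exprn_gt0// ler_wpM2l ?(ltW c'0)//.
  by apply: lerXn2r; rewrite ?nnegrE// ltW.
apply: (@le_trans _ _ (c / 2 * `|u| ^+ 2)); first by rewrite ler_wpM2r ?exprn_ge0// ge_min lexx.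
have h1 : C * `|u| ^+ 3 <= c / 2 * `|u| ^+ 2.
  rewrite exprS mulrA ler_wpM2r ?exprn_ge0//.
  have : (C + 1) * `|u| <= (C + 1) * d by rewrite ler_wpM2l// ltW.
  have -> : (C + 1) * d = c / 2 by rewrite /d; field; rewrite gt_eqF.
  by rewrite mulrDl mul1r; apply: le_trans; rewrite lerDl.
have := hC u ua; have := hc u; rewrite -/(Q u) ler_norml => h2 /andP[h3 _].
move: (Q u) (r2 u) (C * _) (`|u| ^+ 2) h1 h2 h3 => q w e n; lra.
Qed.

End PatchGeometry.

(** * Expansion of the inverse square root of a perturbed quadratic form *)

Section InverseSqrtExpansion.
Context {R : realType}.
Variables (M N : nat) (b c : R) (q D : R * R -> R).
Hypotheses (M0 : (0 < M)%N) (N0 : (0 < N)%N) (b0 : 0 < b) (c0 : 0 < c) (q0 : q 0 = 0) (D0 : D 0 = 0)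
  (q_lb : forall u : R * R, c * `|u| ^+ 2 <= q u)
  (cq : cls M [set u : R * R | `|u| <= b] 2 q) (cD : cls M [set u : R * R | `|u| <= b] 3 D).
Implicit Types (u x y : R * R).

Let iq u := (Num.sqrt (q u))^-1.
Let t u := D u * iq u ^+ 2.

Lemma cls_inv_root : cls M [set u : R * R | `|u| <= b] (-1) iq.
Proof. by apply: (@cls_invsqrt R M _ 1 q c) => // x _ _; exact: q_lb. Qed.

Let ct : cls M [set u : R * R | `|u| <= b] 1 t.
Proof. exact: (cls_mul cD (cls_exp 2 cls_inv_root)). Qed.

Let q_pos u : u != 0 -> 0 < q u.
Proof. by move=> u0; apply: lt_le_trans (q_lb u); rewrite mulr_gt0// exprn_gt0// normr_gt0. Qed.

Let t0 : t 0 = 0. Proof. by rewrite /t D0 mul0r. Qed.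

Let q_t u : q u + D u = q u * (1 + t u).
Proof.
have [->|/q_pos u0] := eqVneq u 0; first by rewrite q0 D0 mul0r addr0.
rewrite mulrDr mulr1 /t mulrCA /iq exprVn sqr_sqrtr; last exact: ltW.
by rewrite divff ?mulr1//; exact: lt0r_neq0.
Qed.

Let inv_root_t u : (Num.sqrt (q u + D u))^-1 = iq u * (Num.sqrt (1 + t u))^-1.
Proof.
rewrite q_t sqrtrM ?invfM//; have [->|/q_pos/ltW//] := eqVneq u 0.
by rewrite q0.
Qed.

(** Write [q + D = q (1 + t)] with [t = D / q] of degree 1. The remainder of [bser_sqrt] consists of
    [t ^+ N] and factors of degree 0; together with [iq], of degree -1, this gives degree
    [N - 1]. *)
Lemma inv_root_expansion : exists2 e : R, 0 < e <= b & cls M [set u : R * R | `|u| <= e] (N%:Z - 1)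
  (fun u => (Num.sqrt (q u + D u))^-1 -
     \sum_(n < N) gbinom (- 2^-1) n * (D u ^+ n * iq u ^+ (2 * n).+1)).
Proof.
have [H hH] := @bser_sqr R N; have [d /andP[d0 d2] hd] := @bser_half R N N0.
have [C C0 hC] := cls_bound ct.
pose e1 := Num.min b (d / (C + 1)).
have C1 : 0 < C + 1 by rewrite ltr_wpDl.
have e10 : 0 < e1 by rewrite lt_min b0 divr_gt0.
have td u : `|u| <= e1 -> `|t u| <= d.
  rewrite le_min => /andP[ub ud]; have [->|u0] := eqVneq u 0; first by rewrite t0 normr0 ltW.
  apply: le_trans (hC u ub u0) _; rewrite (@le_trans _ _ ((C + 1) * `|u|))//.
    by rewrite ler_wpM2r// lerDl.
  by rewrite mulrC -ler_pdivlMr.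
have t_half u : `|u| <= e1 -> 2^-1 <= 1 + t u.
  move=> /td; rewrite ler_norml => /andP[h _]; move: h d2; move: (t u) => s; lra.
(* Half the radius, so that the points [y] with [|y - x| <= |x|] compared by [cls_ext] still satisfy
   [|y| <= e1]. *)
pose A := [set u : R * R | `|u| <= e1 / 2].
have e2 : e1 / 2 <= e1 by lra.
have Ab x : A x -> `|x| <= b.
  by move=> xA; apply: le_trans (le_trans xA e2) _; rewrite ge_min lexx.
have Ae1 x y : A x -> `|y - x| <= 1 * `|x| -> `|y| <= e1.
  rewrite /A/= mul1r => xA yx; rewrite -(subrK x y) (le_trans (ler_normD _ _))//.
  move: xA yx; move: (`|x|) (`|_|) => s w; lra.
have cA s g : cls M [set u : R * R | `|u| <= b] s g -> cls M A s g.
  by apply: cls_sub => x /Ab.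
have ct0 : cls M A 0 t by apply: (@cls_down _ _ _ 1 _ _ b) => //; exact: cA.
have c1t : cls M A 0 (fun u => 1 + t u) by apply: cls_add => //; exact: cls_cst.
have ci : cls M A 0 (fun u => (Num.sqrt (1 + t u))^-1).
  apply: (@cls_invsqrt R M A 0 (fun u => 1 + t u) 2^-1) => // x /= xA _.
  by rewrite addr0 expr0z mulr1 t_half// (le_trans xA).
(* Only inverse square roots are known to preserve the class; the square root is obtained as
   [(1 + t) / Num.sqrt (1 + t)]. *)
have cw : cls M A 0 (fun u => Num.sqrt (1 + t u)).
  apply: (@cls_ext _ _ _ _ (fun u => (1 + t u) * (Num.sqrt (1 + t u))^-1) _ 1) => //; last exact: (cls_mul c1t ci).
  move=> x y xA _ yx; have h := t_half _ (Ae1 _ _ xA yx).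
  have h0 : 0 < 1 + t y by apply: lt_le_trans h; rewrite invr_gt0.
  by rewrite -[X in X / _]sqr_sqrtr ?ltW// expr2 mulfK// gt_eqF// sqrtr_gt0.
have cS : cls M A 0 (fun u => bser N (t u)).
  by apply: cls_sum => k; apply: cls_scale; have := cls_exp k ct0; rewrite mul0r.
have cSw : cls M A 0 (fun u => 1 + bser N (t u) * Num.sqrt (1 + t u)).
  by apply: cls_add; [exact: cls_cst|exact: (cls_mul cS cw)].
have Sw u : `|u| <= e1 -> 1 <= 1 + bser N (t u) * Num.sqrt (1 + t u).
  move=> ue; rewrite lerDl mulr_ge0 ?sqrtr_ge0//; apply: le_trans (hd _ (td _ ue)).
  by rewrite invr_ge0.
(* Likewise the inverse of a positive function is the inverse square root of its square. *)
have ciSw : cls M A 0 (fun u => (1 + bser N (t u) * Num.sqrt (1 + t u))^-1).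
  apply: (@cls_ext _ _ _ _ (fun u => (Num.sqrt ((1 + bser N (t u) * Num.sqrt (1 + t u)) ^+ 2))^-1) _ 1) => //.
    move=> x y xA _ yx; have h := Sw _ (Ae1 _ _ xA yx).
    by rewrite sqrtr_sqr ger0_norm// (le_trans _ h).
  apply: (@cls_invsqrt R M A 0 (fun u => (1 + bser N (t u) * Num.sqrt (1 + t u)) ^+ 2) 1) => //.
    by move=> x xA _; rewrite addr0 expr0z mulr1 expr_ge1// ?Sw ?(le_trans _ (Sw _ _))// (le_trans xA).
  by have := cls_exp 2 cSw; rewrite mul0r.
have cH : cls M A 0 (fun u => H.[t u]).
  apply: (@cls_ext _ _ _ _ (fun u => \sum_(i < size H) H`_i * t u ^+ i) _ 1) => //.
    by move=> x y _ _ _; rewrite horner_coef.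
  by apply: cls_sum => k; apply: cls_scale; have := cls_exp k ct0; rewrite mul0r.
exists (e1 / 2); first by rewrite divr_gt0//= (le_trans e2)// ge_min lexx.
pose rem u := iq u * (t u ^+ N * (H.[t u] * ((Num.sqrt (1 + t u))^-1 * (1 + bser N (t u) * Num.sqrt (1 + t u))^-1))).
apply: (@cls_ext _ _ _ _ (fun u => - 1 * rem u) _ 1) => //; last first.
  apply: cls_scale; have := cls_mul (cA _ _ cls_inv_root) (cls_mul (cls_exp N (cA _ _ ct)) (cls_mul cH (cls_mul ci ciSw))).
  by rewrite mul1r !addr0 addrC.
move=> x y xA _ yx; have ye := Ae1 _ _ xA yx.
have h0 : 0 < 1 + t y by apply: lt_le_trans (t_half _ ye); rewrite invr_gt0.
have h1 : 0 <= bser N (t y) by apply: le_trans (hd _ (td _ ye)); rewrite invr_ge0.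
have -> : \sum_(n < N) gbinom (- 2^-1) n * (D y ^+ n * iq y ^+ (2 * n).+1) = iq y * bser N (t y).
  rewrite /bser mulr_sumr; apply: eq_bigr => n _; rewrite /t exprMn -exprM exprS.
  by move: (gbinom _ _) (D y ^+ n) (iq y ^+ (2 * n)) => *; ring.
rewrite inv_root_t [in RHS](bser_sqrt h0 h1 hH) /rem.
have id5 (B i T h w : R) : -1 * (i * (T * (h * w))) = i * (B - T * h * w) - i * B by ring.
exact: id5.
Qed.

End InverseSqrtExpansion.

Section TaylorClass.
Context {R : realType}.
Implicit Types (u x y : R * R) (F : R * R -> R).

Lemma smooth_taylor_part V F k : open V -> smooth_on V (taylor_part F k).
Proof.
move=> oV; apply: (@smooth_on_eq _ _ (fun u => \sum_(i <- index_enum 'I_k.+1) tcoef F 0 i (k - i) * (u.1 ^+ i * u.2 ^+ (k - i)))) => //.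
  by move=> u _; rewrite taylor_partE.
apply: smooth_on_sum => // i; apply: smooth_onM => //; first exact: smooth_on_cst.
by apply: smooth_onM => //; apply: smooth_onX => //; [exact: smooth_on_fst|exact: smooth_on_snd].
Qed.

Lemma taylor_remainder_cls M V F (a b : R) J : open V -> smooth_on V F ->
  [set u : R * R | `|u| <= a] `<=` V -> 0 < b < a -> (J < M)%N ->
  cls M [set u : R * R | `|u| <= b] J.+1%:Z (fun u => F u - \sum_(k < J.+1) taylor_part F k u).
Proof.
move=> oV sF aV bb JM; have a0 : 0 < a by case/andP: bb => b0; apply: lt_trans.
have M0 : (0 < M)%N by exact: leq_ltn_trans JM.
have [C C0 hC] := smooth_taylor_remainder J a0 sF aV.
apply: (@smooth_cls _ _ V _ a _ C) => //.
apply: (@smooth_on_eq _ _ (fun u => F u + (- 1) * \sum_(k <- index_enum 'I_J.+1) taylor_part F k u)) => //.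
  by move=> u _; rewrite mulN1r.
apply: smooth_onD => //; apply: smooth_onM => //; first exact: smooth_on_cst.
by apply: smooth_on_sum => // k; exact: smooth_taylor_part.
Qed.

End TaylorClass.

(** * The homogeneous functions W^(m) u^i v^j *)

Section ExpansionTerms.
Context {R : realType}.
Variables (r : R * R -> 'rV[R]_3) (M : nat).
Hypotheses (M0 : (0 < M)%N) (indep : row_free (col_mx (partial_u r 0) (partial_v r 0))).
Implicit Types (u x y : R * R).
Let iQ u := (Num.sqrt (first_form r u))^-1.

Lemma first_form0 : first_form r 0 = 0.
Proof. by have := first_form_homog r 0 0; rewrite scale0r expr0n/= mul0r. Qed.

Lemma cls_first_form A : cls M A 2 (first_form r).
Proof.
apply: (@cls_ext _ _ _ _ (fun u => \sum_(k <- index_enum 'I_3) (partial_u r 0 0 k * u.1 + partial_v r 0 0 k * u.2) ^+ 2) _ 1) => //.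
  by move=> x y _ _ _; rewrite first_formE.
apply: cls_sum => k; apply: (@cls_exp _ _ _ 1 _ 2).
by apply: cls_add; apply: cls_scale; [exact: cls_coord1|exact: cls_coord2].
Qed.

Lemma cls_inv_first_form A : cls M A (-1) iQ.
Proof.
have [c c0 hc] := first_form_lb indep.
by apply: (@cls_invsqrt _ _ _ 1 (first_form r) c) => // [x _ _|]; [exact: hc|exact: cls_first_form].
Qed.

(** Trades the real exponent [n + 1/2] for the odd natural power [(2 * n).+1] of the inverse root,
    to which [cls_exp] applies. From here on indices are shifted by one, so degrees are [m - 1]. *)
Lemma WfunE m u : Wfun r m.+1 u =
  \sum_(n < m.+1) gbinom (- 2^-1) n * (q_part r n (m + 2 * n) u * iQ u ^+ (2 * n).+1).
Proof.
have Q0 : 0 <= first_form r u by rewrite first_formE; apply: sumr_ge0 => k _; exact: sqr_ge0.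
apply: eq_bigr => n _; congr (_ * (_ * _)); rewrite /iQ exprVn; congr (_^-1).
have h2 : (n%:R + 2^-1 : R) != 0 by rewrite gt_eqF// ltr_wpDl// invr_gt0.
rewrite powRD; last by rewrite (negPf h2).
by rewrite powR_mulrn// powR12_sqrt// exprS exprM sqr_sqrtr// mulrC.
Qed.

Lemma cls_Wfun A m : cls M A (m%:Z - 1) (Wfun r m.+1).
Proof.
apply: (@cls_ext _ _ _ _ (fun u => \sum_(n < m.+1) gbinom (- 2^-1) n * (q_part r n (m + 2 * n) u * iQ u ^+ (2 * n).+1)) _ 1) => //.
  by move=> x y _ _ _; rewrite WfunE.
apply: cls_sum => n; apply: cls_scale.
have -> : m%:Z - 1 = (m + 2 * n)%:Z + (-1) * (2 * n).+1%:Z by lia.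
apply: cls_mul; first exact: taylor_part_cls.
by apply: cls_exp; exact: cls_inv_first_form.
Qed.

Let iQ_homog (l : R) u : iQ (l *: u) = `|l|^-1 * iQ u.
Proof.
by rewrite /iQ first_form_homog sqrtrM ?sqr_ge0// sqrtr_sqr invfM.
Qed.

Let measurable_iQ : measurable_fun (setT : set (plane R)) iQ.
Proof.
apply: continuous_off_origin_measurable => x x0.
have [c c0 hc] := first_form_lb indep.
have Q0 : 0 < first_form r x by apply: lt_le_trans (hc x); rewrite mulr_gt0// exprn_gt0// normr_gt0.
apply: cvgV; first by rewrite gt_eqF// sqrtr_gt0.
apply: continuous_comp; last exact: sqrt_continuous.
exact: (proj1 (smooth_first_form r openT 0) x).
Qed.

Let measurable_taylor_part F k : measurable_fun (setT : set (plane R)) (taylor_part F k).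
Proof.
apply: open_continuous_measurable_fun2; first exact: openT.
by move=> x _; exact: (proj1 (smooth_taylor_part F k openT 0) x).
Qed.

Lemma measurable_Wfun m : measurable_fun (setT : set (plane R)) (Wfun r m.+1).
Proof.
have -> : Wfun r m.+1 = (fun u => \sum_(n < m.+1) gbinom (- 2^-1) n * (q_part r n (m + 2 * n) u * iQ u ^+ (2 * n).+1)).
  by apply/funext => u; rewrite WfunE.
apply: measurable_sum => n; apply: measurable_funM; first exact: measurable_cst.
apply: measurable_funM; first exact: measurable_taylor_part.
exact: measurable_funX.
Qed.

Definition Wmono (m i j : nat) u : R := Wfun r m.+1 u * u.1 ^+ i * u.2 ^+ j.

(** Stated for [l] of either sign: the odd power of the inverse root contributes [|l|^-1], so
    positive [l] gives the degree [m + i + j - 1], while [l = -1] gives the parity of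
    [m + i + j]. *)
Lemma Wmono_scale (l : R) m i j u : l != 0 ->
  Wmono m i j (l *: u) = l ^+ (m + i + j) * `|l|^-1 * Wmono m i j u.
Proof.
move=> l0; rewrite /Wmono.
have -> : Wfun r m.+1 (l *: u) = l ^+ m * `|l|^-1 * Wfun r m.+1 u.
  rewrite !WfunE mulr_sumr; apply: eq_bigr => n _.
  rewrite -/(iQ _) iQ_homog /q_part taylor_part_homog -/(iQ _) !exprMn exprD.
  have -> : `|l|^-1 ^+ (2 * n).+1 = `|l|^-1 * (l ^+ (2 * n))^-1.
    by rewrite exprS exprVn !exprM real_normK ?num_real.
  have hl : l ^+ (2 * n) != 0 by rewrite expf_neq0.
  move: (taylor_part _ _ _) (gbinom _ _) (l ^+ (2 * n)) (iQ u ^+ _) (`|l|^-1) hl => a b c d e hc.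
  by field.
rewrite -[(l *: u).1]/(l * u.1) -[(l *: u).2]/(l * u.2) !exprMn !exprD.
by move: (Wfun _ _ _) (l ^+ m) (l ^+ i) (l ^+ j) (u.1 ^+ i) (u.2 ^+ j) (`|l|^-1) => *; ring.
Qed.

Lemma Wmono_opp m i j u : Wmono m i j (- u) = (-1) ^+ (m + i + j) * Wmono m i j u.
Proof. by rewrite -scaleN1r Wmono_scale ?oppr_eq0 ?oner_eq0// normrN1 invr1 mulr1. Qed.

Lemma Wmono_homog m i j : homog M ((m + i + j)%:Z - 1) (Wmono m i j).
Proof.
split.
- apply: (@cls_ext _ _ _ _ (fun u => Wfun r m.+1 u * (u.1 ^+ i * u.2 ^+ j)) _ 1) => //.
    by move=> x y _ _ _; rewrite mulrA.
  have -> : (m + i + j)%:Z - 1 = (m%:Z - 1) + (i + j)%:Z by lia.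
  by apply: cls_mul; [exact: cls_Wfun|exact: cls_monomial].
- rewrite /Wmono WfunE big1 ?mul0r// => n _.
  by rewrite /iQ first_form0 sqrtr0 invr0 expr0n/= !mulr0.
- apply: measurable_funM; first (apply: measurable_funM; first exact: measurable_Wfun).
    by apply: measurable_funX; exact: measurable_fst.
  by apply: measurable_funX; exact: measurable_snd.
- move=> l u l0; rewrite Wmono_scale ?gt_eqF// gtr0_norm//.
  by rewrite expfzDr ?gt_eqF// exprnP exprN1.
Qed.

End ExpansionTerms.

Section PotentialExpansion.
Context {R : realType}.
Implicit Types (u x y : R * R) (F : R * R -> R).
Variables (a b : R) (r : R * R -> 'rV[R]_3) (U : set (R * R)) (M K : nat).
Hypotheses (oU : open U) (aU : [set u : R * R | `|u| <= a] `<=` U)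
  (sr : smooth_on U r) (injr : {in [set u : R * R | `|u| <= a] &, injective r})
  (indep : row_free (col_mx (partial_u r 0) (partial_v r 0))) (r0 : r 0 = 0)
  (bb : 0 < b < a) (K0 : (0 < K)%N) (KM : (6 * K <= M)%N).

Let a0 : 0 < a. Proof. by case/andP: bb => b0; apply: lt_trans. Qed.
Let M0 : (0 < M)%N. Proof. by lia. Qed.
Let b0 : 0 < b. Proof. by case/andP: bb. Qed.
Let ba : b <= a. Proof. by case/andP: bb => _ /ltW. Qed.
Let D u := dist_r r u ^+ 2 - first_form r u.
Let iQ u := (Num.sqrt (first_form r u))^-1.
Let Bl := [set u : R * R | `|u| <= b].

Let smooth_D : smooth_on U D.
Proof.
apply: (@smooth_on_eq _ _ (fun u => dot3 (r u) (r u) + (- 1) * first_form r u)) => //.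
  by move=> u _; rewrite mulN1r -dist_r_sqr.
apply: smooth_onD => //; first exact: smooth_r2.
by apply: smooth_onM => //; [exact: smooth_on_cst|exact: smooth_first_form].
Qed.

Let D_bound : exists2 C : R, 0 <= C & forall u, `|u| <= a -> `|D u| <= C * `|u| ^+ 3.
Proof.
have [C C0 hC] := r2_first_form a0 oU aU sr r0.
by exists C => // u /hC; rewrite -dist_r_sqr.
Qed.

Let D_0 : D 0 = 0.
Proof. 
rewrite /D first_form0 subr0 dist_r_sqr /dot3 r0 big1// => k _.
by rewrite mxE mul0r.
Qed.

Lemma q_part_low n k u : (k < 3 * n)%N -> q_part r n k u = 0.
Proof.
have [C C0 hC] := D_bound.
apply: (@taylor_part_vanish R U (fun u => D u ^+ n) a (C ^+ n) (3 * n)) => //.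
  exact: smooth_onX.
move=> x xa; rewrite normrX exprM -exprMn; apply: lerXn2r; rewrite ?nnegrE//; last exact: hC.
by rewrite mulr_ge0// exprn_ge0.
Qed.

Let cls_D : cls M Bl 3 D.
Proof.
have [C C0 hC] := D_bound.
by apply: (@smooth_cls _ _ U _ a _ C 3) => //; lia.
Qed.

Lemma cls_inv_dist : cls M Bl (-1) (fun u => (dist_r r u)^-1).
Proof.
have [c c0 hc] := r2_lb a0 oU aU sr injr indep r0.
apply: (@cls_invsqrt _ _ _ 1 (fun u => dot3 (r u) (r u)) c) => //.
  by move=> x xb _; apply: hc; exact: le_trans xb ba.
apply: (@cls_ext _ _ _ _ (fun u => first_form r u + D u) _ 1) => //.
  by move=> x y _ _ _; rewrite /D addrC subrK dist_r_sqr.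
apply: cls_add; first exact: cls_first_form.
by apply: (@cls_down _ _ _ 3 _ _ b) => //; exact: cls_D.
Qed.

(** The dropped indices, [k < 2 * n] on the left and [m < n] on the right, belong to degrees below
    [3 * n], where [q_part r n] vanishes. *)
Let sum_q_part n u : \sum_(k < (2 * K + 2 * n)) q_part r n k u = \sum_(m < 2 * K | (n <= m)%N) q_part r n (m + 2 * n) u.
Proof.
rewrite addnC big_split_ord/= big1 ?add0r.
  by rewrite [RHS]big_mkcond/=; apply: eq_bigr => m _; rewrite addnC; case: ifPn => // h; rewrite q_part_low//; lia.
by move=> k _; apply: q_part_low; have := ltn_ord k; lia.
Qed.

(** Near the origin, expand in powers of [D / Q], replace each power of [D] by a Taylor polynomial
    and regroup by total degree, which yields the [W^(m)]. On the remaining annulus the degree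
    carries no information. *)
Lemma invdist_expansion : cls M Bl ((2 * K)%:Z - 1)
  (fun u => (dist_r r u)^-1 - \sum_(m < 2 * K) Wfun r m.+1 u).
Proof.
have [c c0 hc] := first_form_lb indep.
have [||e /andP[e0 eb] ce] := inv_root_expansion (N := 2 * K) M0 _ b0 c0 (first_form0 r) D_0 hc _ cls_D.
- by lia.
- exact: cls_first_form.
pose A := [set u : R * R | `|u| <= e].
have near : cls M A ((2 * K)%:Z - 1) (fun u => (dist_r r u)^-1 - \sum_(m < 2 * K) Wfun r m.+1 u).
  pose rem u := \sum_(n < 2 * K) gbinom (- 2^-1) n *
    ((D u ^+ n - \sum_(k < (2 * K + 2 * n)) q_part r n k u) * iQ u ^+ (2 * n).+1).
  apply: (@cls_ext _ _ _ _ (fun u => ((Num.sqrt (first_form r u + D u))^-1 -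
     \sum_(n < 2 * K) gbinom (- 2^-1) n * (D u ^+ n * iQ u ^+ (2 * n).+1)) + rem u) _ 1) => //; last first.
    apply: cls_add; first exact: ce.
    apply: cls_sum => n; apply: cls_scale.
    (* The Taylor order grows with [n] so that dividing by [Q ^ (n + 1/2)], of degree [2 * n + 1],
       always leaves degree [2 * K - 1]. *)
    have -> : (2 * K)%:Z - 1 = (2 * K + 2 * n)%:Z + (-1) * (2 * n).+1%:Z by lia.
    apply: cls_mul; last by apply: cls_exp; exact: cls_inv_first_form.
    have -> : (2 * K + 2 * n)%N = (2 * K + 2 * n).-1.+1 by lia.
    apply: (@cls_sub _ _ Bl) => [x /le_trans/(_ eb)//|].
    apply: (taylor_remainder_cls oU _ aU bb); first exact: smooth_onX.
    by have := ltn_ord n; lia.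
  move=> x y _ _ _; have -> : Num.sqrt (first_form r y + D y) = dist_r r y by rewrite /D [first_form r y + _]addrC subrK dist_r_sqr.
  have -> : rem y = \sum_(n < 2 * K) gbinom (- 2^-1) n * (D y ^+ n * iQ y ^+ (2 * n).+1) -
      \sum_(n < 2 * K) \sum_(m < 2 * K | (n <= m)%N) gbinom (- 2^-1) n * (q_part r n (m + 2 * n) y * iQ y ^+ (2 * n).+1).
    rewrite -sumrB; apply: eq_bigr => n _; rewrite sum_q_part mulrBl mulrBr; congr (_ - _).
    by rewrite mulr_suml mulr_sumr.
  rewrite addrA subrK; congr (_ - _).
  rewrite (exchange_big_dep xpredT)//=; apply: eq_bigr => m _; rewrite WfunE.
  rewrite (big_ord_widen (2 * K) (fun n => gbinom (- 2^-1) n * (q_part r n (m + 2 * n) y * iQ y ^+ (2 * n).+1)) (ltn_ord m)).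
  by apply: eq_bigl => n; rewrite ltnS.
have far : cls M [set u : R * R | e <= `|u| <= b] ((2 * K)%:Z - 1) (fun u => (dist_r r u)^-1 - \sum_(m < 2 * K) Wfun r m.+1 u).
  apply: (@cls_ext _ _ _ _ (fun u => (dist_r r u)^-1 + (-1) * \sum_(m < 2 * K) Wfun r m.+1 u) _ 1) => //.
    by move=> x y _ _ _; rewrite mulN1r.
  apply: cls_add.
    apply: (@cls_far _ _ _ (-1) _ _ b e) => //; apply: cls_sub cls_inv_dist.
    by move=> x /andP[].
  apply: cls_scale; apply: cls_sum => m; apply: (@cls_far _ _ _ (m%:Z - 1) _ _ b e) => //.
  exact: cls_Wfun.
apply: cls_sub (cls_union near far) => x /= xb.
by have [|/ltW h] := leP `|x| e; [left|right; rewrite h].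
Qed.

Lemma potential_expansion (P : R * R -> R) : smooth_on setT P -> cls M Bl ((2 * K)%:Z - 1)
  (fun u => P u / dist_r r u - \sum_(m < 2 * K) \sum_(k < 2 * K - m) Wfun r m.+1 u * taylor_part P k u).
Proof.
move=> sP.
have rP k : (0 < k <= 2 * K)%N -> cls M Bl k%:Z (fun u => P u - \sum_(i < k) taylor_part P i u).
  case: k => // k /= hk; apply: (@taylor_remainder_cls _ _ setT _ a) => //; first exact: openT.
  lia.
have cP : cls M Bl 0 P.
  apply: (@cls_ext _ _ _ _ (fun u => (P u - \sum_(i < 1) taylor_part P i u) + taylor_part P 0 u) _ 1) => //.
    by move=> x y _ _ _; rewrite big_ord_recl big_ord0 addr0 subrK.
  apply: cls_add; last exact: taylor_part_cls.
  by apply: (@cls_down _ _ _ 1 _ _ b) => //; apply: rP; lia.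
apply: (@cls_ext _ _ _ _ (fun u => P u * ((dist_r r u)^-1 - \sum_(m < 2 * K) Wfun r m.+1 u) +
  \sum_(m < 2 * K) Wfun r m.+1 u * (P u - \sum_(k < 2 * K - m) taylor_part P k u)) _ 1) => //.
  move=> x y _ _ _; under [X in _ + X]eq_bigr do rewrite mulrBr mulr_sumr.
  by rewrite sumrB mulrBr -mulr_suml [_ * P y]mulrC addrA subrK.
apply: cls_add; first by have := cls_mul cP invdist_expansion; rewrite add0r.
apply: cls_sum => m.
have -> : (2 * K)%:Z - 1 = (m%:Z - 1) + (2 * K - m)%:Z by have := ltn_ord m; lia.
by apply: cls_mul; [exact: cls_Wfun|apply: rP; have := ltn_ord m; lia].
Qed.

End PotentialExpansion.

(** * Correction weights *)

Section TriangularGrid.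
Context {R : realType}.
Variables (N : nat) (x y : nat -> R).
Hypotheses (injx : injective x) (injy : injective y).

Definition trimom (t : nat -> nat -> R) (k l : nat) : R :=
  \sum_(i < N) \sum_(j < N | (i + j < N)%N) x i ^+ k * y j ^+ l * t i j.

Let trimom_poly t (p q : {poly R}) : (forall k l, (k + l < N)%N -> trimom t k l = 0) ->
  (size p + size q <= N.+1)%N ->
  \sum_(i < N) \sum_(j < N | (i + j < N)%N) p.[x i] * q.[y j] * t i j = 0.
Proof.
move=> h pq.
transitivity (\sum_(k < size p) \sum_(l < size q) p`_k * q`_l * trimom t k l).
  transitivity (\sum_(i < N) \sum_(j < N | (i + j < N)%N) \sum_(k < size p) \sum_(l < size q)
      p`_k * q`_l * (x i ^+ k * y j ^+ l * t i j)).
    apply: eq_bigr => i _; apply: eq_bigr => j _; rewrite !horner_coef mulr_suml mulr_suml.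
    apply: eq_bigr => k _; rewrite mulr_sumr mulr_suml; apply: eq_bigr => l _.
    by move: (p`_k) (q`_l) (x i ^+ k) (y j ^+ l) (t i j) => *; ring.
  under eq_bigr do rewrite exchange_big/=.
  rewrite exchange_big/=; apply: eq_bigr => k _.
  under eq_bigr do rewrite exchange_big/=.
  rewrite exchange_big/=; apply: eq_bigr => l _.
  by rewrite /trimom mulr_sumr; apply: eq_bigr => i _; rewrite mulr_sumr.
apply: big1 => k _; apply: big1 => l _; rewrite h ?mulr0//.
by have := ltn_ord k; have := ltn_ord l; lia.
Qed.

(* Testing against Newton's products vanishing at the first nodes isolates
   one unknown at a time, starting from the hypotenuse. *)
Lemma trimom_inj t : (forall k l, (k + l < N)%N -> trimom t k l = 0) ->
  forall i j, (i + j < N)%N -> t i j = 0.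
Proof.
move=> h i j; have [d] := ubnP (N - (i + j)); elim: d i j => // d IHd i j hd ij.
pose newton (z : nat -> R) a : {poly R} := \prod_(w <- [seq z k | k <- iota 0 a]) ('X - w%:P).
have snewton z a : size (newton z a) = a.+1 by rewrite size_prod_XsubC size_map size_iota.
have newton0 z a k : (k < a)%N -> (newton z a).[z k] = 0.
  by move=> ka; apply/eqP; rewrite -/(root _ _) root_prod_XsubC map_f// mem_iota.
have newtonP z a : injective z -> (newton z a).[z a] != 0.
  move=> zi; rewrite -/(root _ _) root_prod_XsubC; apply/mapP => -[k].
  by rewrite mem_iota => /andP[_ ka] /zi ak; move: ka; rewrite ak; lia.
have Ni : (i < N)%N by lia.
have Nj : (j < N)%N by lia.
have := @trimom_poly t (newton x i) (newton y j) h.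
rewrite !snewton => /(_ _)/wrap[]; first by lia.
rewrite (bigD1 (Ordinal Ni))//= (bigD1 (Ordinal Nj))//=.
(* Every other node is a root of one of the two products or lies closer to the hypotenuse, where the
   induction hypothesis applies. *)
rewrite big1 ?addr0 => [|j' /andP[ij' nj]]; last first.
  have [jj|jj] := ltnP j' j; first by rewrite [X in _ * X * _]newton0// mulr0 mul0r.
  have nj' : nat_of_ord j' != j by apply: contra nj => /eqP e; apply/eqP/val_inj.
  by rewrite IHd ?mulr0//; lia.
rewrite big1 ?addr0 => [/eqP|i' ni]; last first.
  have ni' : nat_of_ord i' != i by apply: contra ni => /eqP e; apply/eqP/val_inj.
  apply: big1 => j' ij'; have [ii|ii] := ltnP i' i; first by rewrite newton0// !mul0r.
  have [jj|jj] := ltnP j' j; first by rewrite [X in _ * X * _]newton0// mulr0 mul0r.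
  by rewrite IHd ?mulr0//; lia.
by rewrite !mulf_eq0 (negPf (newtonP _ _ injx)) (negPf (newtonP _ _ injy)) => /eqP.
Qed.

Let A : {set 'I_N * 'I_N} := [set p : 'I_N * 'I_N | (p.1 + p.2 < N)%N].
Let ev (f : 'I_#|A|) : 'I_N * 'I_N := enum_val f.
Let B : 'M[R]_#|A| := \matrix_(f, e)
  (x (ev f).1 ^+ (ev e).1 * y (ev f).2 ^+ (ev e).2).

Let sumA (F : nat -> nat -> R) : \sum_(i < N) \sum_(j < N | (i + j < N)%N) F i j =
  \sum_(f < #|A|) F (ev f).1 (ev f).2.
Proof.
transitivity (\sum_(p in A) F p.1 p.2); last exact: (big_enum_val (fun p : 'I_N * 'I_N => F p.1 p.2)).
by rewrite pair_big_dep/=; apply: eq_bigl => p; rewrite inE.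
Qed.

Let rankA i j : (i + j < N)%N -> exists f : 'I_#|A|, (ev f).1 = i :> nat /\ (ev f).2 = j :> nat.
Proof.
move=> ij; have Ni : (i < N)%N by lia.
have Nj : (j < N)%N by lia.
have hA : (Ordinal Ni, Ordinal Nj) \in A by rewrite inE.
by exists (enum_rank_in hA (Ordinal Ni, Ordinal Nj)); rewrite /ev enum_rankK_in.
Qed.

Let mulB (v : 'rV[R]_#|A|) e : (v *m B) 0 e =
  \sum_f x (ev f).1 ^+ (ev e).1 * y (ev f).2 ^+ (ev e).2 * v 0 f.
Proof. by rewrite mxE; apply: eq_bigr => f _; rewrite mxE mulrC. Qed.

(** Extends a vector indexed by the triangle to all pairs of naturals by 0. *)
Let vfun (v : 'rV[R]_#|A|) (i j : nat) : R :=
  \sum_f v 0 f * (((ev f).1 == i :> nat) && ((ev f).2 == j :> nat))%:R.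

Let vfunE v f : vfun v (ev f).1 (ev f).2 = v 0 f.
Proof.
rewrite /vfun (bigD1 f)//= !eqxx mulr1 big1 ?addr0// => g gf.
case: andP => [[/eqP h1 /eqP h2]|]; last by rewrite mulr0.
case/eqP: gf; apply: enum_val_inj; rewrite -/(ev g) -/(ev f); case: (ev g) (ev f) h1 h2 => [a b] [c d]/= h1 h2.
by congr (_, _); exact: val_inj.
Qed.

(** There are as many unknowns as equations, so injectivity is enough. *)
Let unitB : B \in unitmx.
Proof.
rewrite -row_free_unit; apply: inj_row_free => v vB; apply/rowP => f.
rewrite mxE -vfunE; apply: trimom_inj; last by have := enum_valP f; rewrite inE.
move=> k l /rankA[e [<- <-]]; rewrite /trimom (sumA (fun i j => x i ^+ _ * y j ^+ _ * vfun v i j)).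
by under eq_bigr do rewrite vfunE; rewrite -mulB vB mxE.
Qed.

Lemma trimom_surj (m : nat -> nat -> R) :
  exists t, forall k l, (k + l < N)%N -> trimom t k l = m k l.
Proof.
pose v := (\row_e m (ev e).1 (ev e).2) *m invmx B.
exists (vfun v) => k l /rankA[e [<- <-]].
rewrite /trimom (sumA (fun i j => x i ^+ _ * y j ^+ _ * vfun v i j)).
by under eq_bigr do rewrite vfunE; rewrite -mulB mulmxKV// mxE.
Qed.

(** The constant depends on the nodes only, hence is the same for all mesh sizes; it sums the
    absolute values of all entries of the inverse matrix. *)
Lemma trimom_bound : exists2 C : R, 0 <= C & forall t (a : R),
  (forall k l, (k + l < N)%N -> `|trimom t k l| <= a) ->
  forall i j, (i + j < N)%N -> `|t i j| <= C * a.
Proof.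
exists (\sum_f \sum_e `|invmx B e f|); first by apply: sumr_ge0 => f _; exact: sumr_ge0.
move=> t a h i j /rankA[f [<- <-]].
pose v : 'rV[R]_#|A| := \row_f t (ev f).1 (ev f).2.
have vB e : `|(v *m B) 0 e| <= a.
  have := enum_valP e; rewrite inE => /h; rewrite mulB /trimom (sumA (fun i j => x i ^+ _ * y j ^+ _ * t i j)).
  by under [in X in _ -> X]eq_bigr do rewrite mxE.
have a0 : 0 <= a by apply: le_trans (vB f).
have -> : t (ev f).1 (ev f).2 = v 0 f by rewrite mxE.
rewrite -[v](mulmxK unitB) mxE (le_trans (ler_norm_sum _ _ _))//.
rewrite mulr_suml [leRHS](bigD1 f)//=; apply: ler_wpDr; last first.
  by rewrite mulr_suml; apply: ler_sum => e _; rewrite normrM mulrC ler_wpM2l.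
by apply: sumr_ge0 => g _; rewrite mulr_ge0//; exact: sumr_ge0.
Qed.

End TriangularGrid.

(** * Sums over boxes under reflections *)

Section SymmetricSums.
Context {R : realType}.
Implicit Types (n : nat) (f : int -> R) (F : int * int -> R).

Lemma sum_zrangeS n f : \sum_(k <- zrange n.+1) f k = f n.+1%:Z + f (- n.+1%:Z) + \sum_(k <- zrange n) f k.
Proof.
have : perm_eq (zrange n.+1) [:: n.+1%:Z, - n.+1%:Z & zrange n].
  apply: uniq_perm; first exact: zrange_uniq.
    by rewrite 2!cons_uniq inE !mem_zrange zrange_uniq; apply/and3P; split=> //; lia.
  by move=> k; rewrite mem_zrange 2!in_cons mem_zrange; apply/idP/idP; lia.
by move=> h; rewrite (perm_big _ h)/= !big_cons addrA.
Qed.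

Lemma zrange0 : zrange 0 = [:: 0]. Proof. by []. Qed.

Lemma sum_zrange_opp n f : \sum_(k <- zrange n) f (- k) = \sum_(k <- zrange n) f k.
Proof.
elim: n => [|n IHn]; first by rewrite zrange0 !big_seq1 oppr0.
by rewrite !sum_zrangeS opprK IHn [f (- _) + _]addrC.
Qed.

(** The number of integers of absolute value [i]. *)
Definition foldw (i : nat) : R := (i != 0%N)%:R + 1.

Lemma foldw_ge1 i : 1 <= foldw i. Proof. by rewrite lerDr. Qed.

Lemma sum_zrange_fold n f : (forall k, f (- k) = f k) ->
  \sum_(k <- zrange n) f k = \sum_(i < n.+1) foldw i * f i%:Z.
Proof.
move=> fe; elim: n => [|n IHn].
  by rewrite zrange0 big_seq1 big_ord_recl big_ord0 /foldw /= add0r mul1r addr0.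
by rewrite sum_zrangeS big_ord_recr/= -IHn addrC fe /foldw /= mulrDl mul1r.
Qed.

Lemma sum_boxE n F : \sum_(p <- box n) F p = \sum_(i <- zrange n) \sum_(j <- zrange n) F (i, j).
Proof. by rewrite big_allpairs. Qed.

Lemma sum_box_opp1 n F : \sum_(p <- box n) F (- p.1, p.2) = \sum_(p <- box n) F p.
Proof. by rewrite !sum_boxE/= (sum_zrange_opp n (fun i => \sum_(j <- zrange n) F (i, j))). Qed.

Lemma sum_box_opp2 n F : \sum_(p <- box n) F (p.1, - p.2) = \sum_(p <- box n) F p.
Proof.
by rewrite !sum_boxE/=; apply: eq_bigr => i _; rewrite (sum_zrange_opp n (fun j => F (i, j))).
Qed.

Lemma sum_box_odd n F : (forall p, F (- p.1, p.2) = - F p) \/ (forall p, F (p.1, - p.2) = - F p) ->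
  \sum_(p <- box n) F p = 0.
Proof.
by case=> FN; [have := sum_box_opp1 n F|have := sum_box_opp2 n F]; (under eq_bigr do rewrite FN);
  rewrite sumrN => /eqP; rewrite eq_sym -addr_eq0 -mulr2n mulrn_eq0 => /eqP.
Qed.

Lemma sum_box_fold n F : (forall p, F (- p.1, p.2) = F p) -> (forall p, F (p.1, - p.2) = F p) ->
  \sum_(p <- box n) F p = \sum_(i < n.+1) \sum_(j < n.+1) foldw i * foldw j * F (i%:Z, j%:Z).
Proof.
move=> F1 F2; rewrite sum_boxE (@sum_zrange_fold n (fun i => \sum_(j <- zrange n) F (i, j))).
  apply: eq_bigr => i _; rewrite (@sum_zrange_fold n (fun j => F (i%:Z, j))).
    by rewrite mulr_sumr; apply: eq_bigr => j _; rewrite mulrA.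
  by move=> j; exact: (F2 (i%:Z, j)).
by move=> i; apply: eq_bigr => j _; exact: (F1 (i, j)).
Qed.

Lemma sum_shift (a N n : nat) (G : nat -> R) : (a + N <= n)%N ->
  (forall i, ~~ (a <= i < a + N)%N -> G i = 0) -> \sum_(i < n) G i = \sum_(i < N) G (i + a)%N.
Proof.
move=> aN G0; rewrite -(big_mkord xpredT G) -(big_mkord xpredT (fun i => G (i + a)%N)).
have -> : \sum_(0 <= i < N) G (i + a)%N = \sum_(a <= i < a + N) G i.
  by have := @big_addn _ 0 +%R 0 (a + N) a xpredT G; rewrite add0n addKn.
apply: big_uniq_supp; rewrite ?iota_uniq// => i Gi; rewrite !mem_index_iota.
have [h|/G0/eqP] := boolP (a <= i < a + N)%N; last by rewrite (negPf Gi).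
by lia.
Qed.

Lemma sum_shift_triangle (a b N n : nat) (G : nat -> nat -> R) : (a + N <= n)%N -> (b + N <= n)%N ->
  (forall i j, ~~ [&& a <= i, b <= j & (i - a) + (j - b) < N]%N -> G i j = 0) ->
  \sum_(i < n) \sum_(j < n) G i j = \sum_(i < N) \sum_(j < N | (i + j < N)%N) G (i + a)%N (j + b)%N.
Proof.
move=> aN bN G0; rewrite (@sum_shift a N n (fun i => \sum_(j < n) G i j))//.
  apply: eq_bigr => i _; rewrite (@sum_shift b N n (G (i + a)%N))//.
    rewrite [RHS]big_mkcond/=; apply: eq_bigr => j _; case: ifPn => // h.
    by apply: G0; lia.
  by move=> j h; apply: G0; have := ltn_ord i; lia.
by move=> i h; apply: big1 => j _; apply: G0; lia.
Qed.

End SymmetricSums.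

(** * Solvability and stability of the moment equations on the stencil *)

Section StencilWeights.
Context {R : realType}.
Variable K : nat.
Hypothesis K0 : (0 < K)%N.
Implicit Types (p : int * int) (tau : int * int -> R) (a b : bool).

Definition lmono (al be : nat) p : R := p.1%:~R ^+ al * p.2%:~R ^+ be.

(** Four times the component of [tau] of parity [a] in the first and [b] in the second coordinate,
    [true] meaning odd. *)
Definition parity_part a b tau p : R := tau p + (-1) ^+ a * tau (- p.1, p.2) +
  (-1) ^+ b * tau (p.1, - p.2) + (-1) ^+ (a + b) * tau (- p.1, - p.2).

(** Side of the triangle of pairs [(i - a, j - b)]: the nodes satisfy [i + j < K], but [i + j <= K]
    if both parities are odd. The same number counts the moments of these parities of degree at most
    [2 * (K - 1)], so the systems are square. *)
Let Nab a b : nat := (K - (a || b))%N.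
Let node a (i : nat) : R := ((i + a) ^ 2)%:R.

Let node_inj a : injective (node a).
Proof. by move=> i j /eqP; rewrite /node eqr_nat eqn_exp2r// eqn_add2r => /eqP. Qed.

Let supp a b (i j : nat) := [&& a <= i, b <= j & (i - a) + (j - b) < Nab a b]%N.

Let node_exp a i (k : nat) : ((i + a)%:R : R) ^+ (2 * k + a) = node a i ^+ k * (i + a)%:R ^+ a.
Proof. by rewrite exprD exprM /node -natrX. Qed.

Lemma parity_part_opp1 a b tau p : parity_part a b tau (- p.1, p.2) = (-1) ^+ a * parity_part a b tau p.
Proof.
rewrite /parity_part /= !opprK; case: p => i j /=.
by move: (tau (i, j)) (tau (- i, j)) (tau (i, - j)) (tau (- i, - j)); case: a; case: b => s t u v /=; rewrite ?expr0 ?expr1 ?sqrr_sign ?expr2; ring.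
Qed.

Lemma parity_part_opp2 a b tau p : parity_part a b tau (p.1, - p.2) = (-1) ^+ b * parity_part a b tau p.
Proof.
rewrite /parity_part /= !opprK; case: p => i j /=.
by move: (tau (i, j)) (tau (- i, j)) (tau (i, - j)) (tau (- i, - j)); case: a; case: b => s t u v /=; rewrite ?expr0 ?expr1 ?sqrr_sign ?expr2; ring.
Qed.

Lemma lmono_opp1 al be p : lmono al be (- p.1, p.2) = (-1) ^+ odd al * lmono al be p.
Proof. by rewrite /lmono /= mulrNz [in LHS]exprNn -signr_odd mulrA. Qed.

Lemma lmono_opp2 al be p : lmono al be (p.1, - p.2) = (-1) ^+ odd be * lmono al be p.
Proof. by rewrite /lmono /= mulrNz [in LHS]exprNn -signr_odd mulrCA. Qed.

Let sum_even_box (n : nat) a b (al be : nat) (g : int * int -> R) : odd al = a -> odd be = b ->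
  (forall p, g (- p.1, p.2) = (-1) ^+ a * g p) -> (forall p, g (p.1, - p.2) = (-1) ^+ b * g p) ->
  \sum_(p <- box n) lmono al be p * g p =
  \sum_(i < n.+1) \sum_(j < n.+1) foldw i * foldw j * (i%:R ^+ al * j%:R ^+ be * g (i%:Z, j%:Z)).
Proof.
move=> oa ob g1 g2; rewrite sum_box_fold// => p.
  by rewrite lmono_opp1 g1 oa mulrACA -expr2 sqrr_sign mul1r.
by rewrite lmono_opp2 g2 ob mulrACA -expr2 sqrr_sign mul1r.
Qed.

(** A reflection of the box changes the monomial by the same sign as the corresponding term of
    [parity_part], so all four terms contribute equally. *)
Let sum_parity_part (n : nat) tau (al be : nat) :
  4 * \sum_(p <- box n) lmono al be p * tau p =
  \sum_(p <- box n) lmono al be p * parity_part (odd al) (odd be) tau p.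
Proof.
rewrite /parity_part; under [RHS]eq_bigr do rewrite !mulrDr.
rewrite !big_split/=; set T := \sum_(p <- box n) _ * _.
have e1 : \sum_(p <- box n) lmono al be p * ((-1) ^+ odd al * tau (- p.1, p.2)) = T.
  rewrite /T -[RHS](sum_box_opp1 n); apply: eq_bigr => p _.
  by rewrite lmono_opp1 mulrCA mulrA.
have e2 : \sum_(p <- box n) lmono al be p * ((-1) ^+ odd be * tau (p.1, - p.2)) = T.
  rewrite /T -[RHS](sum_box_opp2 n); apply: eq_bigr => p _.
  by rewrite lmono_opp2 mulrCA mulrA.
have e3 : \sum_(p <- box n) lmono al be p * ((-1) ^+ (odd al + odd be) * tau (- p.1, - p.2)) = T.
  rewrite /T -[RHS](sum_box_opp1 n) -[RHS](sum_box_opp2 n); apply: eq_bigr => p _ /=.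
  rewrite (lmono_opp1 al be (p.1, - p.2)) lmono_opp2 exprD.
  by move: (lmono _ _ _) (tau _) ((-1) ^+ odd al) ((-1) ^+ odd be) => *; ring.
by rewrite e1 e2 e3; ring.
Qed.

(* On the outer layer of the stencil the symmetry condition removes the components
   of mixed parity and the normalization removes the even-even one. *)
Let parity_part_supp a b tau (i j : nat) : (forall p, ~ stencil K p -> tau p = 0) ->
  (forall mu nu : int, (stencil K `\` stencil_flat K) (mu, nu) -> tau (mu, nu) = tau (- mu, - nu)) ->
  (forall mu nu : int, (stencil K `\` stencil_flat K) (mu, nu) ->
    tau (mu, nu) + tau (- mu, nu) + tau (mu, - nu) + tau (- mu, - nu) = 0) ->
  ~~ supp a b i j -> parity_part a b tau (i%:Z, j%:Z) = 0.
Proof.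
move=> t0 sy nz; rewrite /supp /Nab /parity_part /= => h.
have [ai|ai] := leqP a i; last first.
  have [-> ->] : i = 0%N /\ a = true by move: ai; case: (a) => //; lia.
  by rewrite oppr0 exprD expr1; move: (tau _) (tau _) ((-1) ^+ b) => *; ring.
have [bj|bj] := leqP b j; last first.
  have [-> ->] : j = 0%N /\ b = true by move: bj; case: (b) => //; lia.
  by rewrite oppr0 exprD expr1; move: (tau _) (tau _) ((-1) ^+ a) => *; ring.
(* Outside the triangle a node is either off the stencil or on its outer layer, and only the latter
   needs conditions (2) and (3). *)
have [bd|nbd] := boolP [&& i + j == K, i < K & j < K]%N; last first.
  have out (x y : int) : `|x| = i%:Z -> `|y| = j%:Z -> tau (x, y) = 0.
    move=> xi yj; apply: t0; rewrite /stencil /= xi yj => -[h1]; rewrite gt_max => /andP[h2 h3].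
    by move: h nbd ai bj; case: (a); case: (b) => /=; lia.
  by rewrite !out ?normrN// !mulr0 !addr0.
have bnd : (stencil K `\` stencil_flat K) (i%:Z, j%:Z).
  by split; rewrite /stencil /stencil_flat /= ?gt_max; [split|]; lia.
have bnd' : (stencil K `\` stencil_flat K) (- i%:Z, j%:Z).
  by split; rewrite /stencil /stencil_flat /= ?gt_max normrN; [split|]; lia.
have := sy _ _ bnd; have := sy _ _ bnd'; have := nz _ _ bnd; rewrite opprK.
move: h ai bj bd; case: (a); case: (b) => /= h ai bj bd; rewrite ?expr0 ?expr1 ?mul1r.
- lia.
- by move=> _ -> ->; ring.
- by move=> _ -> ->; ring.
- by [].
Qed.

Let odd_2D (k : nat) a : odd (2 * k + a) = a.
Proof. by rewrite oddD mul2n odd_double oddb. Qed.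

Let Nab_deg a b k l : (k + l < Nab a b)%N -> (2 * k + a + (2 * l + b) <= 2 * (K - 1))%N.
Proof. by rewrite /Nab; case: a; case: b => /=; lia. Qed.

(** Monomial and weight having the same parities, the sum folds onto the quadrant [i, j >= 0]. One
    factor [i ^+ a * j ^+ b] goes into the unknown, and what remains of the monomial is a power of
    the squares. *)
Let fold_moment a b (g : int * int -> R) (k l : nat) :
  (forall p, g (- p.1, p.2) = (-1) ^+ a * g p) -> (forall p, g (p.1, - p.2) = (-1) ^+ b * g p) ->
  (forall i j : nat, ~~ supp a b i j -> g (i%:Z, j%:Z) = 0) ->
  \sum_(p <- box K) lmono (2 * k + a) (2 * l + b) p * g p =
  trimom (Nab a b) (node a) (node b) (fun i j => foldw (i + a) * foldw (j + b) *
    ((i + a)%:R ^+ a * (j + b)%:R ^+ b) * g ((i + a)%N%:Z, (j + b)%N%:Z)) k l.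
Proof.
move=> g1 g2 gs; rewrite (sum_even_box _ (odd_2D k a) (odd_2D l b) g1 g2).
rewrite (@sum_shift_triangle _ a b (Nab a b) K.+1 (fun i j => foldw i * foldw j *
  (i%:R ^+ (2 * k + a) * j%:R ^+ (2 * l + b) * g (i%:Z, j%:Z)))).
- apply: eq_bigr => i _; apply: eq_bigr => j _; rewrite !node_exp.
  by move: (foldw _) (foldw _) (g _) (node a i ^+ k) (node b j ^+ l) (_ ^+ a) (_ ^+ b) => *; ring.
- by rewrite /Nab; case: (a); case: (b) => /=; lia.
- by rewrite /Nab; case: (a); case: (b) => /=; lia.
- by move=> i j h; rewrite gs// !mulr0.
Qed.

(** Vanishing off the stencil turns stencil sums into sums over [box K], which reflections
    preserve. *)
Definition admissible tau : Prop := [/\ forall p, ~ stencil K p -> tau p = 0,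
  forall mu nu : int, (stencil K `\` stencil_flat K) (mu, nu) -> tau (mu, nu) = tau (- mu, - nu) &
  forall mu nu : int, (stencil K `\` stencil_flat K) (mu, nu) ->
    tau (mu, nu) + tau (- mu, nu) + tau (mu, - nu) + tau (- mu, - nu) = 0].

Let parity_part_abs a b tau p : `|parity_part a b tau p| = `|parity_part a b tau ((absz p.1)%:Z, (absz p.2)%:Z)|.
Proof.
have n1 q : `|parity_part a b tau (- q.1, q.2)| = `|parity_part a b tau q|.
  by rewrite parity_part_opp1 normrM normr_sign mul1r.
have n2 q : `|parity_part a b tau (q.1, - q.2)| = `|parity_part a b tau q|.
  by rewrite parity_part_opp2 normrM normr_sign mul1r.
have [h1|h1] : p.1 = (absz p.1)%:Z \/ p.1 = - (absz p.1)%:Z by lia.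
  have [h2|h2] : p.2 = (absz p.2)%:Z \/ p.2 = - (absz p.2)%:Z by lia.
    by rewrite -h1 -h2; case: p {h1 h2}.
  by rewrite -h1 -[in RHS]n2 /= -h2; case: p {h1 h2}.
have [h2|h2] : p.2 = (absz p.2)%:Z \/ p.2 = - (absz p.2)%:Z by lia.
  by rewrite -h2 -[in RHS]n1 /= -h1; case: p {h1 h2}.
by rewrite -[in RHS]n1 -[in RHS]n2 /= -h1 -h2; case: p {h1 h2}.
Qed.

(* In the squares of the coordinates the moment equations of a given parity are
   those of a triangular grid. *)
Let parity_part_bound a b : exists2 C : R, 0 <= C & forall tau (A : R), admissible tau ->
  (forall k l, (k + l < Nab a b)%N -> `|\sum_(p <- box K) lmono (2 * k + a) (2 * l + b) p * tau p| <= A) ->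
  0 <= A -> forall p, `|parity_part a b tau p| <= C * A.
Proof.
have [C C0 hC] := trimom_bound (Nab a b) (@node_inj a) (@node_inj b).
exists (C * 4); first by rewrite mulr_ge0.
move=> tau A [t0 sy nz] hA A0 p; rewrite parity_part_abs; move: (absz p.1) (absz p.2) => i j.
have [/and3P[ai bj ij]|h] := boolP (supp a b i j); last first.
  by rewrite (parity_part_supp t0 sy nz)// normr0 !mulr_ge0.
pose t (i j : nat) := foldw (i + a) * foldw (j + b) * ((i + a)%:R ^+ a * (j + b)%:R ^+ b) *
  parity_part a b tau ((i + a)%N%:Z, (j + b)%N%:Z).
have ht : `|t (i - a)%N (j - b)%N| <= C * (4 * A).
  apply: hC => // k l kl.
  rewrite -(fold_moment k l (parity_part_opp1 a b tau) (parity_part_opp2 a b tau)); last first.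
    by move=> i' j'; exact: parity_part_supp.
  have := sum_parity_part K tau (2 * k + a) (2 * l + b).
  rewrite !odd_2D => <-.
  by rewrite normrM ger0_norm// ler_wpM2l// hA.
rewrite -mulrA; apply: le_trans ht; rewrite /t !subnK// normrM.
have pow_ge1 (c : bool) (m : nat) : (c <= m)%N -> 1 <= (m%:R : R) ^+ c.
  by case: c => // m0; rewrite expr1 ler1n.
have w1 : 1 <= foldw i * foldw j * (i%:R ^+ a * j%:R ^+ b) :> R.
  by apply: mulr_ege1; apply: mulr_ege1; rewrite ?foldw_ge1// pow_ge1.
by rewrite ler_peMl// ger0_norm// (le_trans _ w1).
Qed.

Let parity_sum tau p : 4 * tau p = parity_part false false tau p + parity_part true false tau p +
  parity_part false true tau p + parity_part true true tau p.
Proof.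
rewrite /parity_part /= ?expr0 ?expr1 expr2.
by move: (tau p) (tau _) (tau _) (tau _) => *; ring.
Qed.

Let parity_diff tau p : 2 * (tau p - tau (- p.1, - p.2)) = parity_part true false tau p + parity_part false true tau p.
Proof.
rewrite /parity_part /= ?expr0 ?expr1.
by move: (tau p) (tau _) (tau _) (tau _) => *; ring.
Qed.

(** The difference [tau p - tau (- p)] involves only the two components of mixed parity, and these
    are governed by the moments of odd degree alone; hence the separate bound [B]. *)
Lemma stencil_bound : exists2 C : R, 0 <= C & forall tau (A B : R), admissible tau -> 0 <= A -> 0 <= B ->
  (forall al be, (al + be <= 2 * (K - 1))%N -> `|\sum_(p <- box K) lmono al be p * tau p| <= A) ->
  (forall al be, (al + be <= 2 * (K - 1))%N -> odd (al + be) -> `|\sum_(p <- box K) lmono al be p * tau p| <= B) ->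
  forall p, `|tau p| <= C * A /\ `|tau p - tau (- p.1, - p.2)| <= C * B.
Proof.
have [C00 p00 h00] := parity_part_bound false false; have [C10 p10 h10] := parity_part_bound true false.
have [C01 p01 h01] := parity_part_bound false true; have [C11 p11 h11] := parity_part_bound true true.
exists (C00 + C10 + C01 + C11); first by rewrite !addr_ge0.
move=> tau A B adm A0 B0 hA hB p.
have {}h00 := h00 tau A adm _ A0 p; have {}h11 := h11 tau A adm _ A0 p.
have h10A := h10 tau A adm _ A0 p; have h01A := h01 tau A adm _ A0 p.
have {}h10 := h10 tau B adm _ B0 p; have {}h01 := h01 tau B adm _ B0 p.
have io a b k l : odd (2 * k + a + (2 * l + b)) = a (+) b.
  by rewrite oddD !odd_2D.
have {}h00 := h00 (fun k l kl => hA _ _ (Nab_deg kl)); have {}h11 := h11 (fun k l kl => hA _ _ (Nab_deg kl)).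
have {}h10A := h10A (fun k l kl => hA _ _ (Nab_deg kl)); have {}h01A := h01A (fun k l kl => hA _ _ (Nab_deg kl)).
have {}h10 := h10 (fun k l kl => hB _ _ (Nab_deg kl) (io true false k l)).
have {}h01 := h01 (fun k l kl => hB _ _ (Nab_deg kl) (io false true k l)).
have C0A : 0 <= (C00 + C10 + C01 + C11) * A by rewrite mulr_ge0// !addr_ge0.
have C0B : 0 <= (C00 + C11) * B by rewrite mulr_ge0// addr_ge0.
split.
  have n4 : `|4 * tau p| <= (C00 + C10 + C01 + C11) * A.
    rewrite parity_sum !mulrDl (le_trans (ler_normD _ _))// lerD// (le_trans (ler_normD _ _))// lerD//.
    by rewrite (le_trans (ler_normD _ _))// lerD.
  move: n4 C0A; rewrite normrM ger0_norm//; move: (_ * A) (`|tau p|) => s t; lra.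
have n2 : `|2 * (tau p - tau (- p.1, - p.2))| <= C10 * B + C01 * B.
  by rewrite parity_diff (le_trans (ler_normD _ _))// lerD.
have := normr_ge0 (tau p - tau (- p.1, - p.2)).
move: n2 C0B; rewrite normrM ger0_norm// !mulrDl.
move: (C00 * B) (C10 * B) (C01 * B) (C11 * B) (`|_|) => s t u v w; lra.
Qed.

(** Each moment involves only the component of its own parities. So the four triangular systems are
    solved separately, and the solutions are extended to all quadrants with the matching signs and
    added. *)
Lemma stencil_exists (m : nat -> nat -> R) : exists tau, admissible tau /\
  forall al be, (al + be <= 2 * (K - 1))%N -> \sum_(p <- box K) lmono al be p * tau p = m al be.
Proof.
have ht (c : bool * bool) : {t : nat -> nat -> R | forall k l, (k + l < Nab c.1 c.2)%N ->
    trimom (Nab c.1 c.2) (node c.1) (node c.2) t k l = m (2 * k + c.1)%N (2 * l + c.2)%N}.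
  by apply: cid; exact: (@trimom_surj R (Nab c.1 c.2) _ _ (@node_inj c.1) (@node_inj c.2) (fun k l => m (2 * k + c.1)%N (2 * l + c.2)%N)).
pose t c := sval (ht c).
(* The division undoes the factor that [fold_moment] puts into the unknown. *)
pose g (c : bool * bool) (i j : nat) : R := if supp c.1 c.2 i j then
  t c (i - c.1)%N (j - c.2)%N / (foldw i * foldw j * (i%:R ^+ c.1 * j%:R ^+ c.2)) else 0.
pose sg (k : int) : R := (sgz k)%:~R.
pose tc (c : bool * bool) p := sg p.1 ^+ c.1 * sg p.2 ^+ c.2 * g c (absz p.1) (absz p.2).
pose tau p := \sum_(c : bool * bool) tc c p.
have sgN k (a : bool) : sg (- k) ^+ a = (-1) ^+ a * sg k ^+ a by rewrite /sg sgzN mulrNz [in LHS]exprNn.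
have tc1 c p : tc c (- p.1, p.2) = (-1) ^+ c.1 * tc c p by rewrite /tc /= sgN abszN !mulrA.
have tc2 c p : tc c (p.1, - p.2) = (-1) ^+ c.2 * tc c p.
  by rewrite /tc /= sgN abszN; move: (sg _ ^+ _) (sg _ ^+ _) (g _ _ _) ((-1) ^+ _) => *; ring.
have gsupp c i j : g c i j != 0 -> supp c.1 c.2 i j by rewrite /g; case: ifP => //; rewrite eqxx.
(* On the outer layer only the odd-odd component reaches, and its parity implies both conditions
   there. *)
have tau_bd mu nu : (stencil K `\` stencil_flat K) (mu, nu) -> tau (mu, nu) = tc (true, true) (mu, nu).
  rewrite /stencil /stencil_flat /= gt_max => -[[h1 /andP[h2 h3]] h4].
  rewrite /tau (bigD1 (true, true))//= big1 ?addr0// => -[a b] ab.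
  have [|] := eqVneq (g (a, b) (absz mu) (absz nu)) 0; first by rewrite /tc /= => ->; rewrite mulr0.
  by move=> /gsupp; rewrite /supp /Nab; move: ab; case: (a); case: (b) => //= _; lia.
have bdN mu nu : (stencil K `\` stencil_flat K) (mu, nu) ->
    (stencil K `\` stencil_flat K) (- mu, nu) /\ (stencil K `\` stencil_flat K) (mu, - nu).
  by rewrite /stencil /stencil_flat /= !normrN.
exists tau; split.
  split=> [p np|mu nu bd|mu nu bd].
  - apply: big1 => -[a b] _; have [|] := eqVneq (g (a, b) (absz p.1) (absz p.2)) 0.
      by rewrite /tc /= => ->; rewrite mulr0.
    move=> /gsupp h; case: np; rewrite /stencil /= gt_max.
    by move: h; rewrite /supp /Nab; case: (a); case: (b) => //= h; split; lia.
  - have [b1 b2] := bdN _ _ bd; have [_ b3] := bdN _ _ b1.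
    rewrite !tau_bd//; have := tc1 (true, true) (mu, - nu); have := tc2 (true, true) (mu, nu).
    by rewrite /= => -> ->; rewrite expr1; ring.
  - have [b1 b2] := bdN _ _ bd; have [_ b3] := bdN _ _ b1.
    rewrite !tau_bd//; have := tc1 (true, true) (mu, - nu); have := tc2 (true, true) (mu, nu).
    have := tc1 (true, true) (mu, nu); rewrite /= => -> -> ->; rewrite expr1.
    by move: (tc _ _) => w; ring.
move=> al be albe; rewrite /tau; under eq_bigr do rewrite mulr_sumr.
rewrite exchange_big/= (bigD1 (odd al, odd be))//= [X in _ + X]big1 ?addr0 => [|[a b] ab]; last first.
  (* A component of other parities than the monomial makes the summand odd in one of the
     coordinates. *)
  apply: sum_box_odd; have [aa|aa] := eqVneq a (odd al).
    have bb : b != odd be by apply: contraNneq ab => bb; rewrite aa bb.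
    right=> p; rewrite lmono_opp2 tc2 /= mulrACA; move: bb; case: (b); case: (odd be) => //= _; rewrite ?expr0 ?expr1 ?mulr1 ?mul1r mulN1r//.
  left=> p; rewrite lmono_opp1 tc1 /= mulrACA; move: aa; case: (a); case: (odd al) => //= _; rewrite ?expr0 ?expr1 ?mulr1 ?mul1r mulN1r//.
pose c := (odd al, odd be).
have eal : al = (2 * al./2 + odd al)%N by rewrite mul2n addnC odd_double_half.
have ebe : be = (2 * be./2 + odd be)%N by rewrite mul2n addnC odd_double_half.
have sg_pow (a : bool) (i : nat) : (a <= i)%N -> sg i%:Z ^+ a = 1.
  by case: a => //; case: i => // i _; rewrite /sg expr1.
rewrite [X in lmono X _]eal [X in lmono _ X]ebe.
rewrite (@fold_moment (odd al) (odd be) (tc c))//; last first.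
  by move=> i j h; rewrite /tc /= /g /= (negPf h) mulr0.
rewrite [in RHS]eal [in RHS]ebe -(svalP (ht c)) -/(t c) /=; last first.
  by rewrite /Nab; move: eal ebe albe; case: (odd al); case: (odd be) => /=; lia.
apply: eq_bigr => i _; apply: eq_bigr => j ij; congr (_ * _).
rewrite /tc /= !sg_pow ?leq_addl// /g /= /supp !leq_addl !addnK ij !mul1r /=.
rewrite mulrC divfK//; have pow0 (a : bool) (k : nat) : ((k + a)%:R : R) ^+ a != 0.
  by case: a; rewrite ?expr0 ?oner_eq0// expr1 pnatr_eq0 addn1.
rewrite !mulf_neq0 ?pow0//; rewrite gt_eqF//; apply: lt_le_trans (foldw_ge1 _); exact: ltr01.
Qed.

End StencilWeights.

(** * Error expansions *)

Section WeightAsymptotics.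
Context {R : realType}.

Lemma sum_simplex n (X : nat -> nat -> nat -> R) :
  \sum_(i < n) \sum_(j < n | (i + j < n)%N) \sum_(m < n - (i + j)) X i j m =
  \sum_(x : 'I_n * 'I_n * 'I_n | (x.1.1 + x.1.2 + x.2 < n)%N) X x.1.1 x.1.2 x.2.
Proof.
rewrite pair_big_dep/=.
transitivity (\sum_(p : 'I_n * 'I_n | (p.1 + p.2 < n)%N)
    \sum_(m : 'I_n | (p.1 + p.2 + m < n)%N) X p.1 p.2 m).
  apply: eq_bigr => p pn; rewrite (big_ord_widen n (fun m => X p.1 p.2 m)) ?leq_subr//.
  by apply: eq_bigl => m; rewrite ltn_subRL.
rewrite pair_big_dep/=; apply: eq_bigl => x.
by case: (ltnP (x.1.1 + x.1.2 + x.2) n) => h; rewrite ?andbF// andbT (leq_ltn_trans _ h)// leq_addr.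
Qed.

Lemma term_le_sum n (F : nat -> R) i : (forall k, 0 <= F k) -> (i < n)%N -> F i <= \sum_(k < n) F k.
Proof.
move=> F0 iN; rewrite (bigD1 (Ordinal iN)) ?erefl//= lerDl.
by apply: sumr_ge0 => k _; exact: F0.
Qed.

Lemma mesh_pow_le (h H : R) (k m : nat) : 0 < h <= H -> (k <= m)%N -> h ^+ m <= H ^+ (m - k) * h ^+ k.
Proof.
move=> /andP[h0 hH] km; rewrite -{1}(subnK km) exprD ler_wpM2r ?exprn_ge0 ?(ltW h0)//.
by apply: lerXn2r; rewrite ?nnegrE// ltW// (lt_le_trans h0).
Qed.

Variables (a : R) (r : R * R -> 'rV[R]_3) (eta : R * R -> R) (K : nat).
Hypotheses (a0 : 0 < a) (indep : row_free (col_mx (partial_u r 0) (partial_v r 0)))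
  (seta : smooth_on setT eta)
  (suppeta : compactly_supported_in [set u : R * R | `|u| <= a] eta)
  (etae : forall u, eta u = eta (- u)) (K0 : (0 < K)%N).

Let L m i j := Lop eta (Wmono r m i j).

Lemma Lop_Wmono_odd m i j : odd (m + i + j) -> L m i j = 0.
Proof.
(* Parity requires no accuracy of the quadrature, so the lowest orders do. *)
move=> o; apply: (Lop_odd (M := 1) (q := 1) _ _ a0 seta suppeta etae (Wmono_homog _ indep m i j)) => //; first by lia.
by move=> u; rewrite Wmono_opp -signr_odd o expr1 mulN1r.
Qed.

Definition moment_rhs h al be : R := \sum_(m < 2 * K - (al + be)) - L m al be * h ^+ m.+1.

(** The index set is completed to an interval; the terms added are those that [Lop_Wmono_odd]
    annihilates. This removes the parity condition from all later sums. *)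
Lemma moment_index_sum h al be : (al + be <= 2 * (K - 1))%N ->
  \sum_(m \in moment_index K al be)
    - Lop eta (fun u => Wfun r m u * u.1 ^+ al * u.2 ^+ be) * h ^+ (m + al + be) =
  h ^+ (al + be) * moment_rhs h al be.
Proof.
move=> albe; pose F m := - Lop eta (fun u => Wfun r m u * u.1 ^+ al * u.2 ^+ be) * h ^+ (m + al + be).
transitivity (\sum_(m <- index_iota 1 (2 * K - (al + be)).+1) F m).
  rewrite (fsbig_seq _ _ (iota_uniq _ _)); apply: fsbig_widen => m /=.
    by rewrite mem_index_iota => -[m0 [k /andP[k0 kK] mk]]; lia.
  rewrite mem_index_iota => -[/andP[m0 mK] nm]; rewrite /F.
  case: m m0 mK nm => // m _ mK nm; rewrite -/(Wmono r m al be) -/(L m al be).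
  rewrite Lop_Wmono_odd ?oppr0 ?mul0r//; apply/negP => ev; apply: nm; split=> //.
  exists (m + al + be)./2.+1; have := odd_double_half (m + al + be); rewrite (negPf (introN idP ev)); lia.
rewrite big_add1 /= big_mkord mulr_sumr; apply: eq_bigr => m _.
by rewrite /F -/(Wmono r m al be) -/(L m al be) -addnA exprD; ring.
Qed.

Definition moments_ok h tau := forall al be, (al + be <= 2 * (K - 1))%N ->
  \sum_(p <- box K) lmono al be p * tau p = moment_rhs h al be.

(** All right-hand sides are [O(h)]. If [al + be] is odd, the term of order [h] vanishes by parity,
    leaving [O(h ^+ 2)]. The bound [H] on the mesh absorbs the higher powers into the constant. *)
Lemma weights_bound (H : R) : 0 < H -> exists2 C : R, 0 <= C & forall h tau, 0 < h <= H ->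
  admissible K tau -> moments_ok h tau ->
  forall p, `|tau p| <= C * h /\ `|tau p - tau (- p.1, - p.2)| <= C * h ^+ 2.
Proof.
move=> H0; have [C C0 hC] := @stencil_bound R K K0.
pose B k := \sum_(al < 2 * K) \sum_(be < 2 * K) \sum_(m < 2 * K) `|L m al be| * H ^+ (m.+1 - k).
have HX n : 0 <= H ^+ n by rewrite exprn_ge0// ltW.
have B0 k : 0 <= B k by do 3 (apply: sumr_ge0 => ? _); rewrite mulr_ge0.
have key h k al be : 0 < h <= H -> (al + be <= 2 * (K - 1))%N ->
    (forall m, (m.+1 < k)%N -> L m al be = 0) -> `|moment_rhs h al be| <= B k * h ^+ k.
  move=> hH albe L0; have h0 : 0 < h by case/andP: hH.
  have al2 : (al < 2 * K)%N by lia.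
  have be2 : (be < 2 * K)%N by lia.
  pose D al be := \sum_(m < 2 * K) `|L m al be| * H ^+ (m.+1 - k).
  have D0 al' be' : 0 <= D al' be' by apply: sumr_ge0 => m _; rewrite mulr_ge0.
  apply: (@le_trans _ _ (D al be * h ^+ k)); last first.
    rewrite ler_wpM2r ?exprn_ge0 ?(ltW h0)//.
    apply: le_trans (term_le_sum (fun be' => D0 al be') be2) _.
    apply: (@term_le_sum (2 * K) (fun al' => \sum_(be' < 2 * K) D al' be') al) => // al'.
    by apply: sumr_ge0 => be' _; exact: D0.
  rewrite /moment_rhs (le_trans (ler_norm_sum _ _ _))//.
  rewrite (big_ord_widen (2 * K) (fun m => `|- L m al be * h ^+ m.+1|)) ?leq_subr//.
  rewrite big_mkcond mulr_suml; apply: ler_sum => m _.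
  have pos : 0 <= `|L m al be| * H ^+ (m.+1 - k) * h ^+ k.
    by rewrite mulr_ge0// ?mulr_ge0// exprn_ge0// ltW.
  case: ifPn => // _; rewrite normrM normrN normrX (gtr0_norm h0).
  have [mk|mk] := ltnP m.+1 k; first by rewrite L0// normr0 !mul0r.
  by rewrite -mulrA ler_wpM2l//; exact: mesh_pow_le.
exists (C * (B 1 + B 2)); first by rewrite mulr_ge0// addr_ge0.
move=> h tau hH adm mom p; have h0 : 0 < h by case/andP: hH.
have [||al be albe|al be albe o|t1 t2] := hC tau (B 1 * h ^+ 1) (B 2 * h ^+ 2) adm _ _ _ _ p.
- by rewrite mulr_ge0// expr1 ltW.
- by rewrite mulr_ge0// exprn_ge0// ltW.
- by rewrite mom// key.
- by rewrite mom// key// => -[_|//]; apply: Lop_Wmono_odd.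
split.
  rewrite (le_trans t1)// expr1 mulrA ler_wpM2r ?(ltW h0)// ler_wpM2l// lerDl//.
by rewrite (le_trans t2)// mulrA ler_wpM2r ?exprn_ge0 ?(ltW h0)// ler_wpM2l// lerDr.
Qed.

(** The stencil sum plus this quantity, and the trapezoidal error plus this quantity, are both of
    order [2 * K + 1], so it cancels between them. *)
Definition main_term (P : R * R -> R) h : R :=
  \sum_(x : 'I_(2 * K) * 'I_(2 * K) * 'I_(2 * K) | (x.1.1 + x.1.2 + x.2 < 2 * K)%N)
    tcoef P 0 x.1.1 x.1.2 * L x.2 x.1.1 x.1.2 * h ^+ (x.1.1 + x.1.2 + x.2).+1.

(** Expand [P] to total degree [2 * K - 1]. The remainder [O(h ^+ (2 * K))] meets weights of size
    [O(h)]; degrees up to [2 * K - 2] are matched exactly by the moment equations; the last degree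
    is estimated through the antisymmetric part of the weights. *)
Lemma stencil_sum_asymptotics (P : R * R -> R) (H : R) : smooth_on setT P -> 0 < H ->
  exists2 C : R, 0 <= C & forall h tau, 0 < h <= H -> admissible K tau -> moments_ok h tau ->
  `|\sum_(p <- box K) P (h *: pt p) * tau p + main_term P h| <= C * h ^+ (2 * K + 1).
Proof.
move=> sP H0; have [C C0 hC] := weights_bound H0.
have HK : 0 < H * K%:R by rewrite mulr_gt0// ltr0n.
have [CP CP0 hP] := smooth_taylor_remainder (2 * K).-1 HK sP (fun _ _ => Logic.I).
have K2 : (2 * K).-1.+1 = (2 * K)%N by lia.
rewrite K2 in hP.
pose G h (tau : int * int -> R) (i j : nat) := tcoef P 0 i j * h ^+ (i + j) * \sum_(p <- box K) lmono i j p * tau p.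
pose E (i j : nat) := `|tcoef P 0 i j| * \sum_(p <- box K) `|lmono i j p : R| * C.
have E0 i j : 0 <= E i j by rewrite mulr_ge0//; apply: sumr_ge0 => p _; rewrite mulr_ge0.
pose C1 := \sum_(p <- box K) CP * K%:R ^+ (2 * K) * C.
pose C2 := \sum_(i < 2 * K) \sum_(j < 2 * K | (i + j < 2 * K)%N) E i j.
exists (C1 + C2).
  rewrite addr_ge0//; last by do 2 (apply: sumr_ge0 => ? _).
  by apply: sumr_ge0 => p _; rewrite !mulr_ge0// exprn_ge0.
move=> h tau hH adm mom; have h0 : 0 < h by case/andP: hH.
have hh : h <= H by case/andP: hH.
have ht := hC h tau hH adm mom.
have part1 : `|\sum_(p <- box K) P (h *: pt p) * tau p -
    \sum_(i < 2 * K) \sum_(j < 2 * K | (i + j < 2 * K)%N) G h tau i j| <= C1 * h ^+ (2 * K + 1).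
  have -> : \sum_(i < 2 * K) \sum_(j < 2 * K | (i + j < 2 * K)%N) G h tau i j =
      \sum_(p <- box K) (\sum_(k < 2 * K) taylor_part P k (h *: pt p)) * tau p.
    rewrite big_antidiag; under [RHS]eq_bigr do rewrite mulr_suml.
    rewrite exchange_big/=; apply: eq_bigr => k _.
    under [RHS]eq_bigr do rewrite taylor_partE mulr_suml.
    rewrite exchange_big/=; apply: eq_bigr => i _; rewrite /G mulr_sumr; apply: eq_bigr => p _.
    rewrite /lmono -[h *: p.1%:~R]/(h * p.1%:~R) -[h *: p.2%:~R]/(h * p.2%:~R) !exprMn exprD.
    by move: (tcoef _ _ _ _) (h ^+ i) (h ^+ (k - i)) (_ ^+ i) (_ ^+ (k - i)) (tau p) => *; ring.
  rewrite -sumrB (le_trans (ler_norm_sum _ _ _))// /C1 mulr_suml.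
  rewrite big_seq [leRHS]big_seq; apply: ler_sum => p; rewrite mem_box => pK.
  have pn : `|h *: pt p : R * R| <= h * K%:R.
    by rewrite normrZ gtr0_norm// ler_wpM2l ?(ltW h0)// norm_pt pmulrn ler_int.
  rewrite -mulrBl normrM addn1 exprSr mulrA -[X in _ <= X * h]mulrA.
  have hp : `|h *: pt p : R * R| <= H * K%:R by rewrite (le_trans pn)// ler_wpM2r.
  have -> : CP * K%:R ^+ (2 * K) * (C * h ^+ (2 * K)) * h = (CP * (h * K%:R) ^+ (2 * K)) * (C * h).
    by rewrite exprMn; move: (K%:R ^+ _) (h ^+ (2 * K)) => *; ring.
  apply: ler_pM => //; last exact: (ht p).1.
  apply: le_trans (hP _ hp) _; rewrite ler_wpM2l//; apply: lerXn2r; rewrite ?nnegrE//.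
  by rewrite mulr_ge0// ltW.
have part2 : `|\sum_(i < 2 * K) \sum_(j < 2 * K | (i + j < 2 * K)%N) G h tau i j + main_term P h| <=
    C2 * h ^+ (2 * K + 1).
  rewrite /main_term -(sum_simplex (2 * K) (fun i j m => tcoef P 0 i j * L m i j * h ^+ (i + j + m).+1)).
  rewrite -big_split/= (le_trans (ler_norm_sum _ _ _))// /C2 mulr_suml; apply: ler_sum => i _.
  rewrite -big_split/= (le_trans (ler_norm_sum _ _ _))// mulr_suml; apply: ler_sum => j ij.
  have [ij2|ij2] := leqP (i + j) (2 * (K - 1)).
    rewrite /G mom// /moment_rhs mulr_sumr -big_split/= big1 ?normr0.
      by rewrite mulr_ge0// exprn_ge0// ltW.
    move=> m _; rewrite -addnS [h ^+ (i + j + m.+1)]exprD.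
    by move: (h ^+ (i + j)) (h ^+ m.+1) (L _ _ _) => *; ring.
  have ij3 : (i + j = 2 * K - 1)%N by clear -ij ij2; lia.
  (* In this degree the inner sum of [main_term] has the single index [m = 0], and the parity of
     [i + j] kills it. *)
  rewrite [X in _ + X]big1 ?addr0; last first.
    move=> m _; rewrite Lop_Wmono_odd ?mulr0 ?mul0r//.
    have -> : (m + i + j = (K - 1).*2.+1)%N by have := ltn_ord m; clear -ij3 K0; lia.
    by rewrite /= odd_double.
  (* A monomial of odd degree sees only the odd part of the weights, which gains a second factor
     [h]. *)
  have half : \sum_(p <- box K) lmono i j p * tau p =
      2^-1 * \sum_(p <- box K) lmono i j p * (tau p - tau (- p.1, - p.2)).
    under [in RHS]eq_bigr do rewrite mulrBr.
    rewrite sumrB; have -> : \sum_(p <- box K) lmono i j p * tau (- p.1, - p.2) = - \sum_(p <- box K) lmono i j p * tau p.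
      rewrite -[in RHS](sum_box_opp1 K) -[in RHS](sum_box_opp2 K) -sumrN; apply: eq_bigr => p _ /=.
      rewrite (lmono_opp1 i j (p.1, - p.2)) lmono_opp2 mulrA -signr_addb -oddD ij3.
      have -> : (2 * K - 1 = (K - 1).*2.+1)%N by clear -K0; lia.
      by rewrite /= odd_double expr1 !mulN1r mulNr opprK.
    by move: (\sum_(p <- box K) _) => s; field.
  rewrite /G half /E; move: (tcoef P 0 i j) => tc; rewrite !normrM -!mulrA ler_wpM2l//.
  rewrite ger0_norm ?exprn_ge0 ?(ltW h0)// ij3.
  apply: (@le_trans _ _ (h ^+ (2 * K - 1) * ((\sum_(p <- box K) `|lmono i j p : R| * C) * h ^+ 2))); last first.
    have -> : (2 * K + 1 = (2 * K - 1) + 2)%N by clear -K0; lia.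
    by rewrite exprD mulrCA.
  rewrite ler_wpM2l ?exprn_ge0 ?(ltW h0)//.
  have h2 : `|2^-1 : R| <= 1 by rewrite ger0_norm ?invr_ge0// invf_le1// ler1n.
  rewrite -[leRHS]mul1r; apply: ler_pM => //.
  rewrite (le_trans (ler_norm_sum _ _ _))// mulr_suml; apply: ler_sum => p _.
  by rewrite normrM -mulrA ler_wpM2l// (ht p).2.
rewrite mulrDl; set S := \sum_(p <- box K) _ in part1 *.
set T := \sum_(i < 2 * K) _ in part1 part2 *.
have -> : S + main_term P h = (S - T) + (T + main_term P h) by rewrite addrA subrK.
by rewrite (le_trans (ler_normD _ _))// lerD.
Qed.

End WeightAsymptotics.

(** * Expansion of the punctured trapezoidal error *)

Section IntegralAsymptotics.
Context {R : realType}.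

Lemma support_radius (a : R) (P : R * R -> R) : 0 < a ->
  compactly_supported_in [set u : R * R | `|u| < a] P ->
  exists2 b : R, 0 < b < a & forall u, b < `|u| -> P u = 0.
Proof.
move=> a0 [cP sP].
have [x _|x /sP|c c0 hc] := @compact_pos R _ (fun u : R * R => a - `|u|) cP.
- by apply: cvgB; [exact: cvg_cst|exact: norm_continuous].
- by rewrite /= subr_gt0.
(* The value [a / 2] only serves to make the radius positive. *)
exists (Num.max (a - c) (a / 2)).
  by rewrite lt_max gt_max; apply/and3P; split; rewrite ?divr_gt0 ?orbT//; lra.
move=> u; rewrite gt_max => /andP[uc _]; apply/eqP; apply: contraTT uc => Pu.
rewrite -leNgt lerBrDr addrC -lerBrDr; apply: hc; exact: subset_closure.
Qed.

Lemma lerr_lin M (I : Type) (s : seq I) (c : I -> R) (F : I -> R * R -> R) p :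
  (forall x, area.-integrable (cell p) (EFin \o F x)) ->
  lerr M (fun u => \sum_(x <- s) c x * F x u) p = \sum_(x <- s) c x * lerr M (F x) p.
Proof.
move=> iF; rewrite /lerr.
have -> : \int[area]_(u in cell p) (\sum_(x <- s) c x * F x u) =
    \sum_(x <- s) \int[area]_(u in cell p) (c x * F x u).
  apply: Rintegral_sum; first exact: measurable_cell.
  by move=> x; have := integrableZl (measurable_cell p) (c x) (iF x).
under [RHS]eq_bigr do rewrite mulrBr.
rewrite sumrB; congr (_ - _).
  by apply: eq_bigr => x _; rewrite RintegralZl//; exact: measurable_cell.
under [RHS]eq_bigr do rewrite mulr_sumr.
rewrite [RHS]exchange_big/=; apply: eq_bigr => k _.
under [RHS]eq_bigr do rewrite mulr_sumr.
rewrite [RHS]exchange_big/=; apply: eq_bigr => l _.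
by rewrite mulr_sumr; apply: eq_bigr => x _; rewrite mulrCA.
Qed.

Lemma lerr_le_sup M (F : R * R -> R) p (A : R) : (0 < M)%N -> area.-integrable (cell p) (EFin \o F) ->
  (forall z, `|z| <= M%:R -> `|F (pt p + z)| <= A) -> `|lerr M F p| <= A * (1 + cweight1 M).
Proof.
move=> M0 iF hF; apply: (lerr_bound (c := fun _ _ => 0)) => // z zM.
rewrite /pv big1 ?subr0; first exact: hF.
by move=> i _; apply: big1 => j _; rewrite !mul0r.
Qed.

Variables (a : R) (r : R * R -> 'rV[R]_3) (U : set (R * R)) (eta P : R * R -> R) (K : nat).
Hypotheses (a0 : 0 < a) (oU : open U) (aU : [set u : R * R | `|u| <= a] `<=` U)
  (sr : smooth_on U r) (injr : {in [set u : R * R | `|u| <= a] &, injective r})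
  (indep : row_free (col_mx (partial_u r 0) (partial_v r 0))) (r0 : r 0 = 0)
  (seta : smooth_on setT eta)
  (suppeta : compactly_supported_in [set u : R * R | `|u| <= a] eta) (eta1 : eta 0 = 1)
  (K0 : (0 < K)%N) (sP : smooth_on setT P)
  (suppP : compactly_supported_in [set u : R * R | `|u| < a] P).

(** The Taylor polynomials of the powers of [r^2 - Q] have orders [2 * K + 2 * n] with [n < 2 * K],
    hence [6 * K]; the 4 makes room for [2 * K - 1 + (q + 4) <= M], needed by the tail bounds when
    [K = 1]. *)
Let M := (6 * K + 4)%N.
(** A tail of order [n ^- q] at radius [n] of order [1 / h] is [O(h ^+ (2 * K))]. *)
Let q := (2 * K)%N.
Let M0 : (0 < M)%N. Proof. by rewrite /M addn4. Qed.
Let q0 : (0 < q)%N. Proof. by rewrite /q muln_gt0. Qed.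
Let KM : (6 * K <= M)%N. Proof. exact: leq_addr. Qed.
Let G u := P u / dist_r r u.
Let L m i j := Lop eta (Wmono r m i j).
Let I3 := ('I_q * 'I_q * 'I_q)%type.
Let deg (x : I3) : nat := (x.1.1 + x.1.2 + x.2)%N.
Let W (x : I3) := Wmono r x.2 x.1.1 x.1.2.
Let co (x : I3) := tcoef P 0 x.1.1 x.1.2.
Let T u := \sum_(x : I3 | (deg x < q)%N) co x * W x u.

Let W_homog x : homog M ((deg x)%:Z - 1) (W x).
Proof.
have := Wmono_homog M0 indep x.2 x.1.1 x.1.2.
by rewrite /deg; have -> : (x.2 + x.1.1 + x.1.2 = x.1.1 + x.1.2 + x.2)%N by rewrite -addnA addnC.
Qed.

Let deg_ge x : -1 <= (deg x)%:Z - 1. Proof. by rewrite lerBrDr. Qed.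

Let W_integrable x p : area.-integrable (cell p) (EFin \o W x).
Proof.
have [b hb] := @maxball_cell R p.
exact: (homog_integrable M0 q0 (W_homog x) (deg_ge x) (measurable_cell p) hb).
Qed.

Let W_tail : exists (C : R) (n0 : nat), [/\ 0 <= C, (0 < n0)%N & forall x : I3, (deg x < q)%N ->
  forall n, (n0 <= n)%N -> `|bsum M (W x) n + Lop eta (W x)| <= C * n%:R ^- q].
Proof.
have h x : {Cn : R * nat | 0 <= Cn.1 /\ ((deg x < q)%N -> forall n, (Cn.2 <= n)%N ->
    `|bsum M (W x) n + Lop eta (W x)| <= Cn.1 * n%:R ^- q)}.
  apply: cid; have [dx|dx] := ltnP (deg x) q; last by exists (0, 0%N).
  have [|C [n0 [C0 n00 hC]]] := Lop_homog M0 q0 a0 seta suppeta eta1 (W_homog x) (deg_ge x).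
    by move: dx; rewrite /q /M => dx; lia.
  by exists (C, n0).
exists (\sum_x (sval (h x)).1), (\max_x (sval (h x)).2).+1; split=> //.
  by apply: sumr_ge0 => x _; exact: (svalP (h x)).1.
move=> x dx n hn; apply: le_trans ((svalP (h x)).2 dx n _) _.
  by apply: leq_trans hn; rewrite ltnW// ltnS leq_bigmax.
rewrite ler_wpM2r ?invr_ge0 ?exprn_ge0// (bigD1 x)//= lerDl.
by apply: sumr_ge0 => y _; exact: (svalP (h y)).1.
Qed.

Let TE u : \sum_(m < 2 * K) \sum_(k < 2 * K - m) Wfun r m.+1 u * taylor_part P k u = T u.
Proof.
rewrite /T -(sum_simplex q (fun i j m => tcoef P 0 i j * Wmono r m i j u)).
rewrite (@big_antidiag _ q (fun i j => \sum_(m < q - (i + j)) tcoef P 0 i j * Wmono r m i j u)).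
transitivity (\sum_(m < q) \sum_(k < q | (m + k < q)%N) Wfun r m.+1 u * taylor_part P k u).
  apply: eq_bigr => m _; rewrite (big_ord_widen q (fun k => Wfun r m.+1 u * taylor_part P k u)) ?leq_subr//.
  by apply: eq_bigl => k; rewrite ltn_subRL.
rewrite (exchange_big_dep xpredT)//=; apply: eq_bigr => k _.
transitivity (\sum_(m < q - k) Wfun r m.+1 u * taylor_part P k u).
  rewrite (big_ord_widen q (fun m => Wfun r m.+1 u * taylor_part P k u)) ?leq_subr//.
  by apply: eq_bigl => m; rewrite ltn_subRL addnC.
transitivity (\sum_(m < q - k) \sum_(i < k.+1) tcoef P 0 i (k - i) * Wmono r m i (k - i) u).
  apply: eq_bigr => m _; rewrite taylor_partE mulr_sumr; apply: eq_bigr => i _.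
  by rewrite /Wmono; move: (Wfun _ _ _) (tcoef _ _ _ _) (_ ^+ i) (_ ^+ (k - i)) => *; ring.
rewrite exchange_big/=; apply: eq_bigr => i _.
by rewrite subnKC// -ltnS.
Qed.

Let G0 : G 0 = 0.
Proof. by rewrite /G /dist_r /eucl_norm /dot3 r0 big1 ?sqrtr0 ?invr0 ?mulr0// => k _; rewrite mxE mul0r. Qed.

Let dist_cont x : `|x| <= a -> {for x, continuous (dist_r r)}.
Proof.
move=> xa; apply: (@continuous_comp _ _ _ (fun u => dot3 (r u) (r u)) Num.sqrt); last exact: sqrt_continuous.
exact: (proj1 (smooth_r2 oU sr 0) x (aU xa)).
Qed.

Let dist_pos x : `|x| <= a -> x != 0 -> 0 < dist_r r x.
Proof.
move=> xa x0; have [c c0 hc] := r2_lb a0 oU aU sr injr indep r0.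
by rewrite sqrtr_gt0; apply: lt_le_trans (hc x xa); rewrite mulr_gt0// exprn_gt0// normr_gt0.
Qed.

Variable b : R.
Hypotheses (b0 : 0 < b) (ba : b < a) (Pb : forall u, b < `|u| -> P u = 0).

Let Gb u : b < `|u| -> G u = 0. Proof. by move=> /Pb; rewrite /G => ->; rewrite mul0r. Qed.

Let measurable_G : measurable_fun (setT : set (plane R)) G.
Proof.
apply: continuous_off_origin_measurable => x x0; have [xb|xb] := leP `|x| b.
  have xa : `|x| <= a by rewrite (le_trans xb)// ltW.
  apply: cvgM; first exact: (proj1 (sP 0) x Logic.I).
  by apply: cvgV; [rewrite gt_eqF// dist_pos|exact: dist_cont].
have nz : \forall y \near x, G y = 0.
  have : nbhs x [set y : R * R | b < `|y|].
    apply: open_nbhs_nbhs; split=> //; apply: (@open_comp _ _ (fun y : R * R => `|y|) [set s : R | b < s]).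
      by move=> y _; exact: norm_continuous.
    exact: open_gt.
  by apply: filterS => y /Gb.
have Gx : G x = 0 by exact: Gb.
by apply: cvg_near_cst; apply: filterS nz => y; rewrite Gx.
Qed.

(** An intermediate radius: the expansion of the integrand holds up to [b1 < a], and beyond [b1]
    there is a margin [b1 - b] to the support of [P]. *)
Let b1 : R := (b + a) / 2.
Let bb1 : b < b1. Proof. exact: (midf_lt ba).1. Qed.
Let b1a : b1 < a. Proof. exact: (midf_lt ba).2. Qed.
Let b10 : 0 < b1. Proof. exact: lt_trans bb1. Qed.
Let b1a2 : 0 < b1 < a. Proof. by rewrite b10. Qed.
Let B1 := [set u : R * R | `|u| <= b1].

Let cls_rem : cls M B1 ((2 * K)%:Z - 1) (fun u => G u - T u).
Proof.
apply: (@cls_ext _ _ _ _ _ _ 1 _ _ (potential_expansion oU aU sr injr indep r0 b1a2 K0 KM sP)) => //.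
by move=> x y _ _ _; rewrite TE.
Qed.

Let G_integrable : area.-integrable setT (EFin \o G).
Proof.
have cG : cls M B1 (-1) G.
  apply: (@cls_ext _ _ _ _ (fun u => (G u - T u) + T u) _ 1) => //; first by move=> x y _ _ _; rewrite subrK.
  apply: cls_add; first by apply: (@cls_down _ _ _ ((2 * K)%:Z - 1) _ _ b1) => //; lia.
  apply: (@cls_ext _ _ _ _ (fun u => \sum_(x <- [seq x <- index_enum I3 | (deg x < q)%N]) co x * W x u) _ 1) => //.
    by move=> x y _ _ _; rewrite big_filter.
  apply: cls_sum => x; apply: cls_scale; apply: (@cls_down _ _ _ ((deg x)%:Z - 1) _ _ b1) => //.
  by have [c _ _ _] := W_homog x; apply: cls_sub c.
have [C C0 hC] := cls_bound cG.
have i1 : area.-integrable (maxball b) (EFin \o G).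
  apply: (sing_integrable (M := M) M0 q0 (d := -1) (b := b) (C := C)) => //; first exact: measurable_maxball.
  by move=> u ub u0; apply: hC => //; apply: le_trans (ltW bb1).
have : area.-integrable setT ((EFin \o G) \_ (maxball b)).
  by apply/(integrable_mkcond _ (measurable_maxball _)).
congr (area.-integrable _ _); apply/funext => u; rewrite /patch; case: ifPn => //= ua.
by rewrite Gb// ltNge; apply: contra ua => ua; rewrite inE.
Qed.

Let single_layerE : single_layer a r P = \int[area]_u G u.
Proof.
rewrite /single_layer [LHS]Rintegral_mkcond; apply: eq_Rintegral => u _; rewrite /patch.
case: ifPn => //; rewrite notin_setE/= => /negP; rewrite -ltNge => ua.
by rewrite Gb// (lt_trans ba).
Qed.

Let affine2_scale (h : R) (u : R * R) : affine2 h 0 u = h *: u.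
Proof. by rewrite /affine2 !addr0. Qed.

Let Gh_integrable h : 0 < h -> area.-integrable setT (EFin \o (fun u : R * R => G (h *: u))).
Proof.
move=> h0; have := integrable_affine2 0 (lt0r_neq0 h0) G_integrable.
by congr (area.-integrable _ _); apply/funext => u; rewrite /= affine2_scale.
Qed.

Let Gh_integrable_cell h p : 0 < h -> area.-integrable (cell p) (EFin \o (fun u : R * R => G (h *: u))).
Proof.
move=> h0; apply: integrableS (Gh_integrable h0) => //; exact: measurable_cell.
Qed.

Let Ws := [seq x <- index_enum I3 | (deg x < q)%N].
Let hc (h : R) x : R := co x * (h ^+ deg x * h^-1).

Let ThE h u : 0 < h -> T (h *: u) = \sum_(x <- Ws) hc h x * W x u.
Proof.
move=> h0; rewrite /T /Ws big_filter; apply: eq_bigr => x _.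
rewrite /W Wmono_scale ?gt_eqF// gtr0_norm// /hc /deg.
have -> : (x.2 + x.1.1 + x.1.2 = x.1.1 + x.1.2 + x.2)%N by rewrite -addnA addnC.
by move: (co x) (_ / h) (Wmono _ _ _ _ _) => *; ring.
Qed.

Let Th_integrable h p : 0 < h -> area.-integrable (cell p) (EFin \o (fun u : R * R => T (h *: u))).
Proof.
move=> h0; have -> : EFin \o (fun u : R * R => T (h *: u)) =
    (fun u : R * R => \sum_(x <- Ws) ((hc h x)%:E * (W x u)%:E)%E)%E.
  by apply/funext => u; rewrite /= ThE// -sumEFin.
apply: integrable_sum; first exact: measurable_cell.
by move=> x _; have := integrableZl (measurable_cell p) (hc h x) (W_integrable x p).
Qed.

Let rem_integrable h p : 0 < h ->
  area.-integrable (cell p) (EFin \o (fun u : R * R => G (h *: u) - T (h *: u))).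
Proof.
move=> h0; exact: (integrableB (measurable_cell p) (Gh_integrable_cell p h0) (Th_integrable p h0)).
Qed.

Let T0 : T 0 = 0.
Proof. by rewrite /T big1// => x _; have [_ -> _ _] := W_homog x; rewrite mulr0. Qed.

Let bsum_split h n : 0 < h -> bsum M (fun u => G (h *: u)) n =
  bsum M (fun u => G (h *: u) - T (h *: u)) n +
  \sum_(x | (deg x < q)%N) hc h x * bsum M (W x) n.
Proof.
move=> h0; have -> : \sum_(x | (deg x < q)%N) hc h x * bsum M (W x) n = bsum M (fun u => T (h *: u)) n.
  rewrite -big_filter -/Ws /bsum; under eq_bigr do rewrite mulr_sumr.
  rewrite exchange_big/=; apply: eq_bigr => p _; rewrite -lerr_lin//.
  by congr (lerr M _ p); apply/funext => u; rewrite ThE.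
rewrite /bsum -big_split/=; apply: eq_bigr => p _.
by rewrite (lerrB M (Gh_integrable_cell p h0) (Th_integrable p h0)) subrK.
Qed.

(** As [h * N = a - h / 2], the condition [h <= 2 * (a - b)] places the support inside [box N]. A
    cell with index beyond [n1] has [h * |p| > b1], and [h * M <= b1 - b] keeps all points of its
    rule outside the support, so its error is 0. *)
Let integral_bsum N n1 (h := mesh a N) : h <= 2 * (a - b) -> h * M%:R <= b1 - b ->
  n1%:R * h <= b1 < n1.+1%:R * h ->
  single_layer a r P - \sum_(i \in [set i : int * int | i != 0 /\ maxnorm i <= N%:Z])
     P (lattice_pt h i) / dist_r r (lattice_pt h i) * h ^+ 2 =
  h ^+ 2 * bsum M (fun u => G (h *: u)) n1.
Proof.
have h0 : 0 < h by rewrite divr_gt0.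
have hN : h * (N%:R + 2^-1) = a by rewrite divfK// gt_eqF.
move=> hab hM /andP[n1h n1h'].
have out u : N%:R < `|u| -> G (h *: u) = 0.
  move=> uN; apply: Gb; rewrite normrZ gtr0_norm//.
  apply: (@le_lt_trans _ _ (h * N%:R)); last by rewrite ltr_pM2l.
  by move: hN hab; rewrite mulrDr; move: (h * N%:R) => s; lra.
have -> : \sum_(i \in [set i : int * int | i != 0 /\ maxnorm i <= N%:Z])
     P (lattice_pt h i) / dist_r r (lattice_pt h i) * h ^+ 2 = h ^+ 2 * \sum_(p <- box N) G (h *: pt p).
  rewrite (@fsum_box _ _ _ N) => [|p []//|p pN np].
    by rewrite mulr_sumr; apply: eq_bigr => p _; rewrite lattice_ptE mulrC.
  (* The omitted origin contributes the default value [G 0 = 0]. *)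
  have [->|p0] := eqVneq p 0; last by case: np.
  by rewrite lattice_ptE pt0 scaler0 -/(G 0) G0 mul0r.
have -> : single_layer a r P = h ^+ 2 * \int[area]_u G (h *: u).
  rewrite single_layerE (Rintegral_affine2 0 (lt0r_neq0 h0) G_integrable).
  by congr (_ * _); apply: eq_Rintegral => u _; rewrite affine2_scale.
rewrite -mulrBr; congr (_ * _).
have := sum_lerr M0 (Gh_integrable h0) out (ltnSn (N + M)).
have -> : \sum_(p <- box (N + M).+1) G (h *: pt p) = \sum_(p <- box N) G (h *: pt p).
  apply: big_uniq_supp; rewrite ?box_uniq// => p Gp; rewrite !mem_box.
  have : ~ (N%:R < `|pt p : R * R|) by move=> /out h'; rewrite h' eqxx in Gp.
  move/negP; rewrite -leNgt norm_pt pmulrn ler_int => pN; rewrite pN.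
  by apply: le_trans pN _; rewrite lez_nat -addnS leq_addr.
move=> <-; apply: big_uniq_supp; rewrite ?box_uniq// => p lp; rewrite !mem_box.
have n1N : (n1 <= N)%N.
  have : n1%:R * h < (N%:R + 2^-1) * h by rewrite [ltRHS]mulrC hN (le_lt_trans n1h).
  rewrite ltr_pM2r// => lt1; rewrite -ltnS -(ltr_nat R) (lt_le_trans lt1)// -[N.+1%:R]natr1 lerD2l.
  by rewrite invf_le1// ler1n.
have : maxnorm p <= n1%:Z.
  rewrite leNgt; apply: contraNN lp => pn; rewrite -normr_le0.
  rewrite -[leRHS](mul0r (1 + cweight1 M)); apply: lerr_le_sup => //; first exact: Gh_integrable_cell.
  move=> z zM; rewrite Gb ?normr0// normrZ gtr0_norm//.
  have pz : `|pt p : R * R| - `|z| <= `|pt p + z|.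
    by rewrite -[z]opprK normrN (le_trans _ (lerB_dist _ _))// normrN.
  apply: (@lt_le_trans _ _ (h * (`|pt p : R * R| - `|z|))); last by rewrite ler_pM2l.
  have pn1 : n1.+1%:R <= `|pt p : R * R| by rewrite norm_pt pmulrn ler_int; clear -pn; lia.
  have e1 : n1.+1%:R * h <= h * `|pt p : R * R| by rewrite mulrC ler_pM2l.
  have e2 : h * `|z| <= h * M%:R by rewrite ler_pM2l.
  rewrite mulrBr; move: n1h' e1 e2 hM; move: (n1.+1%:R * h) (h * `|z|) (h * M%:R) (h * `|_|) => s t w v; lra.
by move=> pn; rewrite pn; apply: le_trans pn _; rewrite lez_nat (leq_trans n1N)// -addnS leq_addr.
Qed.

(** Split the rescaled integrand into its homogeneous terms and a remainder of degree [2 * K - 1].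
    The error sums of the former are those of [Lop] up to tails at radius about [1 / h]; that of the
    latter is [O(h ^+ (2 * K - 1))], and the area factor [h ^+ 2] completes the order. *)
Lemma integral_asymptotics : exists C h0 : R, [/\ 0 <= C, 0 < h0 &
  forall N, mesh a N <= h0 ->
  `|single_layer a r P - \sum_(i \in [set i : int * int | i != 0 /\ maxnorm i <= N%:Z])
     P (lattice_pt (mesh a N) i) / dist_r r (lattice_pt (mesh a N) i) * mesh a N ^+ 2
   + main_term r eta K P (mesh a N)| <= C * mesh a N ^+ (2 * K + 1)].
Proof.
have [CW [nW [CW0 nW0 hW]]] := W_tail.
have s_le : (2 * K)%:Z - 1 + (q + 4)%:Z <= M%:Z by rewrite /q /M; clear; lia.
have [CT [nT [CT0 nT0 hT]]] := cls_bsum_tail M0 q0 cls_rem s_le.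
have [CB CB0 hB] := cls_bound cls_rem.
have sE (h : R) : h ^ ((2 * K)%:Z - 1) = h ^+ (2 * K - 1).
  by rewrite -[1 in LHS]/(1%N%:Z) subzn// muln_gt0.
pose nn := (nW + nT + 1)%N.
pose near_const := \sum_(p <- box nT) CB * (nT + M)%:R ^+ (2 * K - 1) * (1 + cweight1 M).
pose CC := near_const + CT * nT%:R ^- q + \sum_(x : I3) `|co x| * CW * (2 / b1) ^+ q.
have cw0 : 0 <= cweight1 M :> R by do 2 (apply: sumr_ge0 => ? _).
have near0 : 0 <= near_const.
  by apply: sumr_ge0 => p _; rewrite mulr_ge0// ?addr_ge0// mulr_ge0// exprn_ge0.
have sum0 : 0 <= \sum_(x : I3) `|co x| * CW * (2 / b1) ^+ q.
  by apply: sumr_ge0 => x _; rewrite !mulr_ge0// exprn_ge0// divr_ge0// ltW.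
have tail0 : 0 <= CT * nT%:R ^- q by rewrite mulr_ge0// invr_ge0 exprn_ge0.
(* The first two bounds are the hypotheses of [integral_bsum], the third makes powers of [h]
   decreasing, and the last ensures [n1 >= nn] and keeps the nodes near the origin within [b1]. *)
pose h0 := Num.min (Num.min (2 * (a - b)) ((b1 - b) / M%:R)) (Num.min 1 (b1 / (nn + M)%:R)).
exists CC, h0; split.
- by rewrite !addr_ge0.
- have Mp : 0 < M%:R :> R by rewrite ltr0n.
  have nMp : 0 < (nn + M)%:R :> R by rewrite ltr0n ltn_addl.
  have p1 : 0 < 2 * (a - b) by rewrite mulr_gt0// subr_gt0.
  have p2 : 0 < (b1 - b) / M%:R by rewrite divr_gt0// subr_gt0.
  have p3 : 0 < b1 / (nn + M)%:R by rewrite divr_gt0.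
  by rewrite /h0 !lt_min p1 p2 p3 ltr01.
move=> N; have : 0 < mesh a N by rewrite divr_gt0// ltr_wpDl.
move: (@integral_bsum N); rewrite /=; move: (mesh a N) => h idb hp.
rewrite !le_min -!andbA => /and4P[hab hM h1 hn].
have {}hM : h * M%:R <= b1 - b by rewrite -ler_pdivlMr// ltr0n.
have {}hn : h * (nn + M)%:R <= b1 by rewrite -ler_pdivlMr// ltr0n ltn_addl.
have := @truncn_itv _ (b1 / h); set n1 := Num.truncn _ => /(_ _)/wrap[].
  by rewrite divr_ge0// ltW.
rewrite ler_pdivlMr// ltr_pdivrMr// => n1h.
have nn1 : (nn <= n1)%N.
  case/andP: n1h => _ n1h'; rewrite -ltnS -(ltr_nat R) -(ltr_pM2r hp); apply: le_lt_trans n1h'.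
  by apply: le_trans hn; rewrite mulrC ler_pM2l// ler_nat leq_addr.
rewrite (idb n1 hab hM n1h) (bsum_split n1 hp) mulrDr -addrA.
have n1p : 0 < n1%:R :> R by rewrite ltr0n (leq_trans _ nn1)// /nn addn1.
(* From [b1 < (n1 + 1) * h] and [n1 + 1 <= 2 * n1]. *)
have inv_n1 : n1%:R^-1 <= 2 / b1 * h.
  rewrite -[leLHS]mul1r ler_pdivrMr// mulrAC -mulrA -mulrA [b1^-1 * _]mulrC mulrA ler_pdivlMr// mul1r.
  case/andP: n1h => _ /ltW n1h'; apply: (le_trans n1h'); rewrite mulrA ler_pM2r//.
  rewrite -natr1 mulr_natl mulr2n lerD2l ler1n (leq_trans _ nn1)// /nn addn1//.
have main : `|h ^+ 2 * \sum_(x | (deg x < q)%N) hc h x * bsum M (W x) n1 + main_term r eta K P h| <=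
    (\sum_(x : I3) `|co x| * CW * (2 / b1) ^+ q) * h ^+ (2 * K + 1).
  rewrite mulr_sumr /main_term -big_split/= (le_trans (ler_norm_sum _ _ _))//.
  rewrite mulr_suml [leRHS](bigID (fun x => (deg x < q)%N))/= ler_wpDr//.
    apply: sumr_ge0 => x _; rewrite mulr_ge0 ?exprn_ge0 ?(ltW hp)//.
    by rewrite !mulr_ge0// exprn_ge0// divr_ge0// ltW.
  apply: ler_sum => x dx.
  have -> : h ^+ 2 * (hc h x * bsum M (W x) n1) +
      tcoef P 0 x.1.1 x.1.2 * Lop eta (Wmono r x.2 x.1.1 x.1.2) * h ^+ (x.1.1 + x.1.2 + x.2).+1 =
      co x * h ^+ (deg x).+1 * (bsum M (W x) n1 + Lop eta (W x)).
    rewrite /hc -/(co x) -/(W x) -/(deg x) [h ^+ (deg x).+1]exprS; move: (co x) (h ^+ deg x) (bsum _ _ _) (Lop _ _) => *.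
    by field; rewrite gt_eqF.
  rewrite normrM normrM -!mulrA ler_wpM2l//.
  have hx : `|h ^+ (deg x).+1| <= h.
    rewrite ger0_norm ?exprn_ge0 ?(ltW hp)// exprS ler_piMr ?(ltW hp)//.
    by rewrite exprn_ile1 ?(ltW hp).
  have bx : `|bsum M (W x) n1 + Lop eta (W x)| <= CW * ((2 / b1) ^+ q * h ^+ q).
    apply: le_trans (hW x dx n1 _) _; first by rewrite (leq_trans _ nn1)// /nn -addnA leq_addr.
    rewrite ler_wpM2l// -exprMn -exprVn; apply: lerXn2r; rewrite ?nnegrE ?invr_ge0//.
    by rewrite mulr_ge0 ?(ltW hp)// divr_ge0// ltW.
  apply: (@le_trans _ _ (h * (CW * ((2 / b1) ^+ q * h ^+ q)))); first exact: ler_pM.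
  by rewrite addn1 exprS -/q; move: (h ^+ q) ((2 / b1) ^+ q) => s t; rewrite le_eqVlt; apply/orP; left; apply/eqP; ring.
(* Beyond [nT] the uniform tail bound applies. On the fixed box [nT] the remainder is bounded by its
   size, of order [h ^+ (2 * K - 1)], its degree being positive. *)
have rest : `|bsum M (fun u => G (h *: u) - T (h *: u)) n1| <= (near_const + CT * nT%:R ^- q) * h ^+ (2 * K - 1).
  have e1 : `|bsum M (fun u => G (h *: u) - T (h *: u)) n1 - bsum M (fun u => G (h *: u) - T (h *: u)) nT| <=
      CT * h ^+ (2 * K - 1) * nT%:R ^- q.
    rewrite -sE; apply: (hT h nT n1) => //.
    - by rewrite (leq_trans _ nn1)// /nn addnAC leq_addl.
    - move=> p /andP[_ pn1]; rewrite /B1 /= normrZ gtr0_norm// mulrC.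
      by case/andP: n1h => n1h _; apply: le_trans n1h; rewrite ler_pM2r// norm_pt pmulrn ler_int.
    - by move=> p; exact: rem_integrable.
  have e2 : `|bsum M (fun u => G (h *: u) - T (h *: u)) nT| <= near_const * h ^+ (2 * K - 1).
    rewrite /bsum (le_trans (ler_norm_sum _ _ _))// /near_const mulr_suml big_seq [leRHS]big_seq.
    apply: ler_sum => p; rewrite mem_box => pnT.
    rewrite mulrAC; apply: lerr_le_sup => //; first exact: rem_integrable.
    move=> z zM.
    have nz : `|pt p + z| <= (nT + M)%:R.
      by rewrite (le_trans (ler_normD _ _))// natrD lerD// norm_pt pmulrn ler_int.
    have nhz : `|h *: (pt p + z)| <= h * (nT + M)%:R by rewrite normrZ gtr0_norm// ler_pM2l.
    have [z0|z0] := eqVneq (h *: (pt p + z)) 0.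
      rewrite z0 G0 T0 subr0 normr0 !mulr_ge0// ?exprn_ge0// ltW//.
    apply: le_trans (hB _ _ z0) _.
      apply: (le_trans nhz); apply: le_trans hn; rewrite ler_pM2l// ler_nat /nn.
      by rewrite leq_add2r addnAC leq_addl.
    rewrite sE -mulrA ler_wpM2l// -exprMn [(_ + _)%:R * _]mulrC; apply: lerXn2r; rewrite ?nnegrE//.
    by rewrite mulr_ge0// ltW.
  set X := bsum _ _ n1 in e1 *; set Y := bsum _ _ nT in e1 e2.
  rewrite -(subrK Y X) (le_trans (ler_normD _ _))// addrC mulrDl lerD//.
  by rewrite mulrAC.
rewrite (le_trans (ler_normD _ _))// /CC mulrDl lerD// normrM ger0_norm ?exprn_ge0 ?(ltW hp)//.
have -> : (2 * K + 1 = 2 + (2 * K - 1))%N by clear -K0; lia.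
by rewrite exprD mulrCA ler_wpM2l// exprn_ge0// ltW.
Qed.

End IntegralAsymptotics.

Section CorrectionWeights.
Context {R : realType}.
Variables (a : R) (r : R * R -> 'rV[R]_3) (eta : R * R -> R) (K : nat).
Hypotheses (a0 : 0 < a) (indep : row_free (col_mx (partial_u r 0) (partial_v r 0)))
  (seta : smooth_on setT eta)
  (suppeta : compactly_supported_in [set u : R * R | `|u| <= a] eta)
  (etae : forall u, eta u = eta (- u)) (K0 : (0 < K)%N).

Lemma sum_stencil (F tau : int * int -> R) : (forall p, ~ stencil K p -> tau p = 0) ->
  \sum_(p \in stencil K) F p * tau p = \sum_(p <- box K) F p * tau p.
Proof.
move=> t0; apply: fsum_box => [p [_ /ltW//]|p _ /t0 ->]; exact: mulr0.
Qed.

Lemma sum_stencil_moment h al be (tau : int * int -> R) : (forall p, ~ stencil K p -> tau p = 0) ->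
  \sum_(p \in stencil K) (p.1%:~R * h) ^+ al * (p.2%:~R * h) ^+ be * tau p =
  h ^+ (al + be) * \sum_(p <- box K) lmono al be p * tau p.
Proof.
move=> t0; rewrite (sum_stencil (fun p => (p.1%:~R * h) ^+ al * (p.2%:~R * h) ^+ be) t0).
rewrite mulr_sumr; apply: eq_bigr => p _; rewrite /lmono !exprMn exprD.
by move: (_%:~R ^+ al) (_%:~R ^+ be) (h ^+ al) (h ^+ be) (tau p) => *; ring.
Qed.

Lemma correction_weights_exist h : 0 < h -> exists tau, correction_weights K r eta h tau.
Proof.
move=> h0; have [tau [[t0 sy nz] mom]] := stencil_exists K0 (moment_rhs r eta K h).
exists tau; split=> // al be albe.
by rewrite (sum_stencil_moment _ _ _ t0) mom// -(moment_index_sum a0 indep seta suppeta etae K0 h albe).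
Qed.

(** The given weights are unconstrained off the stencil and are replaced there by 0. Positivity of
    [h] allows the common power of [h] to be cancelled from the moment equations. *)
Lemma correction_weights_box h tau : 0 < h -> correction_weights K r eta h tau ->
  exists tau', [/\ admissible K tau', moments_ok r eta K h tau' &
    forall F : int * int -> R, \sum_(p \in stencil K) F p * tau p = \sum_(p <- box K) F p * tau' p].
Proof.
move=> h0 [mom sy nz]; pose tau' p := if pselect (stencil K p) then tau p else 0.
have tE p : stencil K p -> tau' p = tau p by rewrite /tau'; case: pselect.
have t0 p : ~ stencil K p -> tau' p = 0 by rewrite /tau'; case: pselect.
have sumE (F : int * int -> R) : \sum_(p \in stencil K) F p * tau p = \sum_(p \in stencil K) F p * tau' p.
  by apply: eq_fsbigr => p; rewrite inE => /tE ->.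
exists tau'; split; last by move=> F; rewrite sumE (sum_stencil F t0).
- have bd mu nu : (stencil K `\` stencil_flat K) (mu, nu) -> [/\ stencil K (mu, nu), stencil K (- mu, nu),
      stencil K (mu, - nu) & stencil K (- mu, - nu)] by move=> [+ _]; rewrite /stencil /= !normrN.
  split=> // mu nu h'; have [b1 b2 b3 b4] := bd _ _ h'; rewrite !tE//; first exact: sy.
  exact: nz.
- move=> al be albe; apply: (mulfI (lt0r_neq0 (exprn_gt0 (al + be) h0))).
  rewrite -(moment_index_sum a0 indep seta suppeta etae K0 h albe) -mom//.
  by rewrite -(sum_stencil_moment h al be t0) [RHS]sumE.
Qed.

End CorrectionWeights.

Theorem theorem6 (R : realType) (a : R) (r : R * R -> 'rV[R]_3)
    (eta : R * R -> R) (K : nat) :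
  0 < a ->
  regular_patch a r ->
  smooth_on setT eta ->
  compactly_supported_in [set u : R * R | `|u| <= a] eta ->
  eta 0 = 1 ->
  (forall u, eta u = eta (- u)) ->
  (1 <= K <= 5)%N ->
  (exists tau : R -> int * int -> R,
     forall h : R, 0 < h -> correction_weights K r eta h (tau h)) /\
  (forall tau : R -> int * int -> R,
     (forall N : nat,
        correction_weights K r eta (mesh a N) (tau (mesh a N))) ->
     forall P : R * R -> R,
       smooth_on setT P ->
       compactly_supported_in [set u : R * R | `|u| < a] P ->
       (fun N : nat => single_layer a r P -
          corrected_trapezoidal K r P N (mesh a N) (tau (mesh a N)))
       =O_\oo (fun N : nat => mesh a N ^+ (2 * K + 1))).
Proof.
move=> a0 [[U [oU aU] sr] injr indepr r0] seta suppeta eta1 etae /andP[K0 _].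
have indep : row_free (col_mx (partial_u r 0) (partial_v r 0)) by apply: indepr; rewrite normr0 ltW.
split.
  have ex h : {t : int * int -> R | 0 < h -> correction_weights K r eta h t}.
    apply: cid; have [h0|h0] := ltP 0 h; last by exists (fun=> 0).
    by have [t ht] := correction_weights_exist a0 indep seta suppeta etae K0 h0; exists t.
  by exists (fun h => sval (ex h)) => h; exact: (svalP (ex h)).
move=> tau cw P sP suppP.
have [b /andP[b0 ba] Pb] := support_radius a0 suppP.
have [C1 [h0 [C10 h00 hC1]]] := integral_asymptotics a0 oU aU sr injr indep r0 seta suppeta eta1 K0 sP b0 ba Pb.
(* The largest mesh is [mesh a 0 = 2 * a]. *)
have H0 : 0 < 2 * a by rewrite mulr_gt0.
have [C2 C20 hC2] := stencil_sum_asymptotics a0 indep seta suppeta etae K0 sP H0.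
apply/eqO_exP; exists (C1 + C2 + 1); first by rewrite ltr_wpDl// addr_ge0.
(* From this index on [N] exceeds [a / h0], so the mesh is at most [h0]. *)
exists (Num.truncn (a / h0)).+1 => // N /= hN.
have hp : 0 < mesh a N by rewrite divr_gt0.
have hh0 : mesh a N <= h0.
  rewrite /mesh ler_pdivrMr// mulrC -ler_pdivrMr//.
  have /andP[_ /ltW h1] := truncn_itv (ltW (divr_gt0 a0 h00)).
  by rewrite (le_trans h1)// (@le_trans _ _ N%:R) ?ler_nat// lerDl.
have hH : 0 < mesh a N <= 2 * a.
  rewrite hp /mesh ler_pdivrMr//; have -> : 2 * a * (N%:R + 2^-1) = a + 2 * a * N%:R by field.
  by rewrite lerDl mulr_ge0// ltW.
have [tau' [adm mom sumE]] := correction_weights_box a0 indep seta suppeta etae K0 hp (cw N).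
have e1 := hC1 N hh0; have e2 := hC2 _ _ hH adm mom.
have -> : single_layer a r P - corrected_trapezoidal K r P N (mesh a N) (tau (mesh a N)) =
  (single_layer a r P - \sum_(i \in [set i : int * int | i != 0 /\ maxnorm i <= N%:Z])
     P (lattice_pt (mesh a N) i) / dist_r r (lattice_pt (mesh a N) i) * mesh a N ^+ 2
   + main_term r eta K P (mesh a N)) -
  (\sum_(p <- box K) P (mesh a N *: pt p) * tau' p + main_term r eta K P (mesh a N)).
  rewrite /corrected_trapezoidal.
  have -> : \sum_(p \in stencil K) P (lattice_pt (mesh a N) p) * tau (mesh a N) p =
      \sum_(p <- box K) P (mesh a N *: pt p) * tau' p.
    by rewrite sumE; apply: eq_bigr => p _; rewrite lattice_ptE.
  move: (single_layer _ _ _) (main_term _ _ _ _ _) (\sum_(p <- box K) _) (\sum_(i \in _) _) => s m t u.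
  by ring.
rewrite (le_trans (ler_normB _ _))//.
have hn0 : 0 <= mesh a N ^+ (2 * K + 1) by rewrite exprn_ge0// ltW.
rewrite (ger0_norm hn0) 2!mulrDl mul1r ler_wpDr// lerD//.
Qed.
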